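(* Let $(F_t,J_0)$ be a Hamiltonian flow deformation of a symplectic type generalized Kähler structure $(F_0,J_0)$ on a compact manifold $M$, with respect to a time dependent smooth function $\phi_t$, and let $I_t=-F_t^{-1}J_0^*F_t$. Let $\Phi_t\in\mathrm{Diff}(M)$, $\Phi_0=\mathrm{Id}$, be the isotopy of diffeomorphisms corresponding to the time dependent vector field $Z_t:=-F_t^{-1}(I_td\phi_t)$. Let $$J_t:=(\Phi_t)_*^{-1}J_0(\Phi_t)_*,\qquad \psi_t:=\Phi_t^*(\phi_t),\qquad Y_{\psi_t}:=-F_0^{-1}(d\psi_t).$$ Then for any $t$ $$\Phi_t^*(F_t)=F_0,\qquad \dot J_t=J_t\big(\mathcal L_{Y_{\psi_t}}J_t\big).$$
   Context: Conventions. A bilinear form $B$ on $TM$ is viewed as a map $TM\to T^*M$, $X\mapsto B(X,\cdot)$; a bivector as a map $T^*M\to TM$, $\beta\mapsto\Pi(\beta,\cdot)$. For an almost complex structure $I$, $(I^*\beta)(X)=\beta(IX)$ on 1-forms, $I\beta:=-I^*\beta$, and $dd^c_I\phi:=d(Id\phi)$. A symplectic type generalized Kähler structure $(F,J)$ is a complex structure $J$ with a symplectic form $F$ such that $F(v,Jv)>0$ for $v\neq0$ and $I:=-F^{-1}J^*F$ is integrable. Then $-FJ=g+b$ with $g$ a Riemannian metric and $b$ a 2-form, and $\pi:=\frac12[I,J]g^{-1}$ is a real Poisson bivector. Hamiltonian flow deformation of $(F_0,J_0)$ by a smooth family of functions $\phi_t$: let $I_0=-F_0^{-1}J_0^*F_0$,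 $\pi$ the Poisson bivector of $(F_0,J_0)$, and $\Xi_t$, $\Xi_0=\mathrm{Id}$, the isotopy of the time-dependent vector field $-\pi(d\phi_t)$. Put $I_s=(\Xi_s)_*I_0(\Xi_s)_*^{-1}$ and $F_t=F_0+\int_0^t dd^c_{I_s}\phi_s\,ds$, as long as $F_t(v,J_0v)>0$ for all $v\ne0$. Then $(F_t,J_0)$ are symplectic type generalized Kähler structures with the same $\pi$, $I_t=-F_t^{-1}J_0^*F_t$ and $\dot F_t=dd^c_{I_t}\phi_t$. *)

(* Defs.v *)
(* Differential geometry on smooth manifolds, over MathComp-Analysis.

   Vector fields are the R-linear derivations of the algebra C^oo(M), and
   tensor fields are the C^oo(M)-multilinear maps on vector fields; on a
   Hausdorff second countable manifold these are the usual sections. *)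
From HB Require Import structures.
From mathcomp Require Import all_boot all_order all_algebra.
From mathcomp Require Import ring.
From mathcomp Require Import all_classical all_reals all_analysis.
Import Order.TTheory GRing.Theory Num.Theory.
Import numFieldNormedType.Exports.

Set Implicit Arguments.
Unset Strict Implicit.
Unset Printing Implicit Defensive.

Local Open Scope classical_set_scope.
Local Open Scope ring_scope.

Section Euclidean.
Context {R : realType} {n : nat}.
Implicit Types (U : set 'rV[R]_n) (f g : 'rV[R]_n -> R).

(* On an open set U: the partial derivatives of f up to order k exist and are
   continuous. *)
Fixpoint Ck_on (k : nat) U f : Prop :=
  (forall x, U x -> {for x, continuous f}) /\
  if k is k'.+1 then
    forall i : 'I_n, (forall x, U x -> derivable f x (delta_mx 0 i)) /\
                     Ck_on k' U ('D_(delta_mx 0 i) f)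
  else True.

Definition Cinfty_on U f := forall k, Ck_on k U f.

Lemma Ck_on_ext k U f g : open U -> {in U, f =1 g} ->
  Ck_on k U f -> Ck_on k U g.
Proof.
move=> oU.
have near_ext (h1 h2 : 'rV[R]_n -> R) x : {in U, h1 =1 h2} -> U x -> {near x, h1 =1 h2}.
  move=> h12 Ux; near=> y; apply: h12; apply/mem_set; near: y.
  exact: open_nbhs_nbhs.
have cont_ext (h1 h2 : 'rV[R]_n -> R) : {in U, h1 =1 h2} ->
    (forall x, U x -> {for x, continuous h1}) ->
    forall x, U x -> {for x, continuous h2}.
  move=> h12 ch1 x Ux; rewrite /prop_for /continuous_at -(h12 x) ?inE//.
  by apply: cvg_trans (ch1 x Ux); apply: (@near_eq_cvg _ _ (nbhs x));
     apply: near_ext => // y yU; rewrite h12.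
elim: k f g => [|k IH] f g fg [cf df]; split=> //; try exact: cont_ext cf.
move=> i; have [dfi Ci] := df i; split=> [x Ux|].
  by apply: near_eq_derivable (dfi x Ux); exact: near_ext.
apply: IH Ci => // x /set_mem Ux.
by apply: near_eq_derive; exact: near_ext.
Unshelve. all: by end_near. Qed.

Lemma Ck_on_leq k U f : Ck_on k.+1 U f -> Ck_on k U f.
Proof.
elim: k f => [|k IH] f [cf df]; first by split.
by split=> // i; have [d C] := df i; split=> //; exact: IH.
Qed.

Lemma Ck_on_cst k U c : open U -> Ck_on k U (cst c).
Proof.
move=> oU; elim: k c => [|k IH] c; first by split=> // x _; exact: cst_continuous.
split=> [x _|i]; first exact: cst_continuous.
split=> [x _|]; first exact: derivable_cst.
by apply: Ck_on_ext (IH 0) => // x _; rewrite derive_cst.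
Qed.

Lemma Ck_onD k U f g : open U -> Ck_on k U f -> Ck_on k U g ->
  Ck_on k U (f + g).
Proof.
move=> oU; elim: k f g => [|k IH] f g [cf df] [cg dg].
  by split=> // x Ux; apply: continuousD; [exact: cf|exact: cg].
split=> [x Ux|i]; first by apply: continuousD; [exact: cf|exact: cg].
have [df1 df2] := df i; have [dg1 dg2] := dg i.
split=> [x Ux|]; first by apply: derivableD; [exact: df1|exact: dg1].
apply: Ck_on_ext (IH _ _ df2 dg2) => // x /set_mem Ux.
by rewrite deriveD//; [exact: df1|exact: dg1].
Qed.

Lemma Ck_onM k U f g : open U -> Ck_on k U f -> Ck_on k U g ->
  Ck_on k U (f * g).
Proof.
move=> oU; elim: k f g => [|k IH] f g Cf Cg.
  have [cf _] := Cf; have [cg _] := Cg.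
  by split=> // x Ux; apply: continuousM; [exact: cf|exact: cg].
have [cf df] := Cf; have [cg dg] := Cg.
split=> [x Ux|i]; first by apply: continuousM; [exact: cf|exact: cg].
have [df1 df2] := df i; have [dg1 dg2] := dg i.
split=> [x Ux|]; first by apply: derivableM; [exact: df1|exact: dg1].
have C := Ck_onD oU (IH _ _ (Ck_on_leq Cf) dg2) (IH _ _ (Ck_on_leq Cg) df2).
apply: Ck_on_ext C => // x /set_mem Ux.
by rewrite deriveM//; [exact: df1|exact: dg1].
Qed.

End Euclidean.

(* Smooth manifolds without boundary of dimension n, given by a smooth atlas:
   the chart a is the homeomorphism coord a from the open set dom a onto its
   open image, with inverse param a (values outside are irrelevant). *)
Record manifold (R : realType) (n : nat) := Manifold {
  carrier :> topologicalType;
  chart : Type;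
  dom : chart -> set carrier;
  coord : chart -> carrier -> 'rV[R]_n;
  param : chart -> 'rV[R]_n -> carrier;
  hausdorff_carrier : hausdorff_space carrier;
  second_countable_carrier : @second_countable carrier;
  chart_cover : forall x, exists a, dom a x;
  dom_open : forall a, open (dom a);
  cod_open : forall a, open (coord a @` dom a);
  coordK : forall a x, dom a x -> param a (coord a x) = x;
  coord_continuous : forall a x, dom a x -> {for x, continuous (coord a)};
  param_continuous : forall a y, (coord a @` dom a) y ->
    {for y, continuous (param a)};
  transition_smooth : forall a b (j : 'I_n),
    Cinfty_on (coord a @` (dom a `&` dom b))
              (fun y => coord b (param a y) 0 j)
}.

Definition cod (R : realType) (n : nat) (M : manifold R n) (a : chart M) :=
  coord a @` dom a.

Section SmoothFunctions.
Context {R : realType} {n : nat} (M : manifold R n).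

Definition smooth (f : M -> R) : Prop :=
  forall a : chart M, Cinfty_on (cod a) (f \o param a).

(* f t x depends smoothly on (t, x) in T x M, for T open. *)
Definition smooth_family (T : set R) (f : R -> M -> R) : Prop :=
  forall a : chart M,
    Cinfty_on [set z : 'rV[R]_(1 + n) | T (lsubmx z 0 0) /\ cod a (rsubmx z)]
              (fun z => f (lsubmx z 0 0) (param a (rsubmx z))).

Definition smooth_pred : {pred M -> R} := fun f => `[< smooth f >].

Record Cinf := MkCinf { Cfun :> M -> R; _ : Cfun \in smooth_pred }.
HB.instance Definition _ := [isSub for Cfun].
HB.instance Definition _ := [Choice of Cinf by <:].

Lemma smooth_cst c : smooth (cst c).
Proof. by move=> a k; exact/Ck_on_cst/cod_open. Qed.

Lemma smoothD f g : smooth f -> smooth g -> smooth (f + g).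
Proof. by move=> sf sg a k; apply: Ck_onD; [exact: cod_open|exact: sf|exact: sg]. Qed.

Lemma smoothM f g : smooth f -> smooth g -> smooth (f * g).
Proof. by move=> sf sg a k; apply: Ck_onM; [exact: cod_open|exact: sf|exact: sg]. Qed.

Lemma smooth_subring : subring_closed smooth_pred.
Proof.
split=> [|f g /asboolP sf /asboolP sg|f g /asboolP sf /asboolP sg].
- exact/asboolP/smooth_cst.
- apply/asboolP; have -> : f - g = f + cst (-1) * g.
    by apply/funext => x; rewrite !fctE mulN1r.
  by apply: smoothD => //; apply: smoothM => //; exact: smooth_cst.
- exact/asboolP/smoothM.
Qed.
HB.instance Definition _ :=
  GRing.isSubringClosed.Build (M -> R) smooth_pred smooth_subring.

Lemma smooth_scale : scaler_closed (R := R) (V := M -> R^o) smooth_pred.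
Proof.
move=> c f /asboolP sf; apply/asboolP.
by apply: (smoothM _ sf); exact: smooth_cst.
Qed.
HB.instance Definition _ :=
  GRing.isScaleClosed.Build R (M -> R^o) smooth_pred smooth_scale.
HB.instance Definition _ :=
  GRing.SubChoice_isSubComPzRing.Build (M -> R) smooth_pred Cinf
    (GRing.subringClosedP smooth_pred).
HB.instance Definition _ :=
  GRing.SubZmodule_isSubLmodule.Build R (M -> R^o) smooth_pred Cinf
    (GRing.subsemimodClosedP smooth_pred).

Lemma Cinf_eq (f g : Cinf) : f =1 g -> f = g.
Proof. by move=> /funext fg; exact/val_inj. Qed.

Lemma Cinf0E (x : M) : (0 : Cinf) x = 0. Proof. by []. Qed.
Lemma Cinf1E (x : M) : (1 : Cinf) x = 1. Proof. by []. Qed.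
Lemma CinfNE (f : Cinf) x : (- f) x = - f x. Proof. by []. Qed.
Lemma CinfDE (f g : Cinf) x : (f + g) x = f x + g x. Proof. by []. Qed.
Lemma CinfME (f g : Cinf) x : (f * g) x = f x * g x. Proof. by []. Qed.
Lemma CinfZE (c : R) (f : Cinf) x : (c *: f) x = c * f x. Proof. by []. Qed.
Definition CinfE := (Cinf0E, Cinf1E, CinfNE, CinfDE, CinfME, CinfZE).

End SmoothFunctions.

Notation "'C^oo' M" := (Cinf M) (at level 10, M at level 9).

Section VectorFields.
Context {R : realType} {n : nat} (M : manifold R n).
Implicit Types f g : Cinf M.

Definition derivation (X : Cinf M -> Cinf M) : Prop :=
  linear X /\ forall f g, X (f * g) = X f * g + f * X g.

Definition derivation_pred : {pred Cinf M -> (Cinf M)^o} :=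
  fun X => `[< derivation X >].

Record vfield :=
  MkVfield { vfun :> Cinf M -> Cinf M; _ : vfun \in derivation_pred }.
HB.instance Definition _ := [isSub for vfun].
HB.instance Definition _ := [Choice of vfield by <:].

Lemma derivation_submod : submod_closed derivation_pred.
Proof.
split=> [|a X Y /asboolP[lX dX] /asboolP[lY dY]]; apply/asboolP.
  by split=> [c|] f g; apply/Cinf_eq => x; rewrite !CinfE; ring.
have E h : (a *: X + Y) h = a * X h + Y h by [].
split=> [c|] f g; apply/Cinf_eq => x; first by rewrite !E lX lY !CinfE; ring.
by rewrite !E dX dY !CinfE; ring.
Qed.

HB.instance Definition _ :=
  GRing.isSubmodClosed.Build (Cinf M) (Cinf M -> (Cinf M)^o) derivation_pred
   derivation_submod.
HB.instance Definition _ :=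
  GRing.SubChoice_isSubLmodule.Build (Cinf M) (Cinf M -> (Cinf M)^o)
    derivation_pred vfield (GRing.subsemimodClosedP derivation_pred).
End VectorFields.

Notation "'Vect' M" := (vfield M) (at level 10, M at level 9).

Section TensorFields.
Context {R : realType} {n : nat} (M : manifold R n).
Implicit Types (f : C^oo M) (X Y Z : Vect M).

Lemma lie_subproof X Y :
  (fun f => X (Y f) - Y (X f)) \in @derivation_pred R n M.
Proof.
case: X Y => [X /= /asboolP[lX dX]] [Y /= /asboolP[lY dY]]; apply/asboolP.
split=> [c|] f g; apply/Cinf_eq => x; first by rewrite !(lX, lY) !CinfE; ring.
have aX u v : X (u + v) = X u + X v by rewrite -{1}[u]scale1r lX scale1r.
have aY u v : Y (u + v) = Y u + Y v by rewrite -{1}[u]scale1r lY scale1r.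
by rewrite !(dX, dY, aX, aY) !CinfE; ring.
Qed.
Definition lie X Y : Vect M := MkVfield (lie_subproof X Y).

(* X does not vanish at the point x *)
Definition nonzero_at X (x : M) : Prop := exists f, X f x != 0.

(* Differential forms, bilinear forms and endomorphisms of TM. A bilinear form
   B is, by currying, the map X |-> B(X, .) from vector fields to 1-forms. *)
Definition form1 := Vect M -> C^oo M.
Definition form2 := Vect M -> form1.
Definition endo := Vect M -> Vect M.
Implicit Types (alpha beta : form1) (B F : form2) (J : endo).

Definition tensor1 alpha := linear (alpha : Vect M -> (C^oo M)^o).
Definition tensor2 B := (forall X, tensor1 (B X)) /\ forall Y, tensor1 (B^~ Y).
Definition tensor_endo J := linear J.

Definition d0 f : form1 := fun X => X f.
Definition d1 alpha : form2 :=
  fun X Y => X (alpha Y) - Y (alpha X) - alpha (lie X Y).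
Definition d2 F X Y Z : C^oo M :=
  X (F Y Z) - Y (F X Z) + Z (F X Y)
  - F (lie X Y) Z + F (lie X Z) Y - F (lie Y Z) X.

(* the map from 1-forms to vector fields inverse to X |-> B(X, .) *)
Definition inv_form B : form1 -> Vect M :=
  fun alpha => xget 0 [set X | B X = alpha].

(* I^* *)
Definition dual_endo J : form1 -> form1 := fun alpha X => alpha (J X).
(* I beta := - I^* beta *)
Definition act1 J : form1 -> form1 := fun alpha X => - dual_endo J alpha X.
(* dd^c_I f *)
Definition ddc J f : form2 := d1 (act1 J (d0 f)).

(* Lie derivative of an endomorphism field along Y *)
Definition Lie_endo Y J : endo := fun X => lie Y (J X) - J (lie Y X).

Definition nijenhuis J X Y : Vect M :=
  lie (J X) (J Y) - J (lie (J X) Y) - J (lie X (J Y)) - lie X Y.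
Definition integrable_endo J := forall X Y, nijenhuis J X Y = 0.
Definition complex_structure J :=
  [/\ tensor_endo J, forall X, J (J X) = - X & integrable_endo J].

Definition symplectic F :=
  [/\ tensor2 F, forall X Y, F X Y = - F Y X,
      forall X x, nonzero_at X x -> exists Y, F X Y x != 0
    & forall X Y Z, d2 F X Y Z = 0].

(* F(v, J v) > 0 for every nonzero tangent vector v *)
Definition tames F J := forall X x, nonzero_at X x -> 0 < F X (J X) x.

(* I = - F^-1 J^* F *)
Definition GK_I F J : endo := fun X => - inv_form F (dual_endo J (F X)).

Definition symplectic_GK F J :=
  [/\ complex_structure J, symplectic F, tames F J & integrable_endo (GK_I F J)].

Definition half_fun : C^oo M := (2^-1 : R) *: (1 : C^oo M).

(* g, the symmetric part of - F J : X |-> - F(J X, .) *)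
Definition GK_g F J : form2 :=
  fun X Y => half_fun * (- F (J X) Y - F (J Y) X).

(* pi = 1/2 [I, J] g^-1, as a map from 1-forms to vector fields *)
Definition GK_pi F J : form1 -> Vect M := fun alpha =>
  let I := GK_I F J in let X := inv_form (GK_g F J) alpha in
  half_fun *: (I (J X) - J (I X)).

End TensorFields.
Arguments half_fun {R n M}.

Section Diffeomorphisms.
Context {R : realType} {n : nat} {M : manifold R n}.
Implicit Types (f : C^oo M) (X Y : Vect M).

(* Smoothness of a map, tested on smooth functions. *)
Definition smooth_map (h : M -> M) := forall f, smooth (f \o h).

Record diffeo := MkDiffeo {
  dfun :> M -> M;
  dinv : M -> M;
  dfunK : cancel dfun dinv;
  dinvK : cancel dinv dfun;
  smooth_dfun : smooth_map dfun;
  smooth_dinv : smooth_map dinv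
}.

Definition diffeo_inv (Phi : diffeo) : diffeo :=
  MkDiffeo (dinvK Phi) (dfunK Phi) (smooth_dinv Phi) (smooth_dfun Phi).

Lemma pull_subproof (Phi : diffeo) f : f \o Phi \in @smooth_pred R n M.
Proof. exact/asboolP/smooth_dfun. Qed.
Definition pull (Phi : diffeo) f : C^oo M := MkCinf (pull_subproof Phi f).

Lemma push_subproof (Phi : diffeo) X :
  (fun f => pull (diffeo_inv Phi) (X (pull Phi f))) \in @derivation_pred R n M.
Proof.
case: X => [X /= /asboolP[lX dX]]; apply/asboolP; split=> [c|] f g.
- have -> : pull Phi (c *: f + g) = c *: pull Phi f + pull Phi g.
    exact/Cinf_eq.
  by rewrite lX; exact/Cinf_eq.
- have -> : pull Phi (f * g) = pull Phi f * pull Phi g by exact/Cinf_eq.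
  rewrite dX; apply/Cinf_eq => x; rewrite CinfDE !CinfME.
  by congr (_ * _ + _ * _); rewrite /= dinvK.
Qed.
(* Phi_* *)
Definition push (Phi : diffeo) X : Vect M := MkVfield (push_subproof Phi X).

Definition pull_form2 (Phi : diffeo) (F : form2 M) : form2 M :=
  fun X Y => pull Phi (F (push Phi X) (push Phi Y)).

(* Phi is the isotopy generated by the time-dependent vector field X over the
   open time interval T *)
Definition isotopy_of (T : set R) (X : R -> Vect M) (Phi : R -> diffeo) :=
  [/\ forall x, Phi 0 x = x,
      forall f, smooth_family T (fun t x => f (Phi t x))
    & forall t f x, T t ->
        is_derive t 1 (fun s => f (Phi s x)) (X t f (Phi t x))].

End Diffeomorphisms.
Arguments diffeo {R n} M.

(* \int_a^b f, for a <= b or b <= a *)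
Definition oriented_int (R : realType) (a b : R) (f : R -> R) : R :=
  (\int[lebesgue_measure]_(s in `[a, b]) f s -
   \int[lebesgue_measure]_(s in `[b, a]) f s)%R.

(* (F t, J0), t in T, is the deformation of (F 0, J0) by the family phi *)
Definition Hamiltonian_flow_deformation (R : realType) (n : nat)
    (M : manifold R n) (T : set R) (phi : R -> C^oo M)
    (J0 : endo M) (F : R -> form2 M) : Prop :=
  [/\ symplectic_GK (F 0) J0,
      smooth_family T (fun t => phi t),
      exists2 Xi : R -> diffeo M,
        isotopy_of T (fun t => - GK_pi (F 0) J0 (d0 (phi t))) Xi &
        let I s X :=
          push (Xi s) (GK_I (F 0) J0 (push (diffeo_inv (Xi s)) X)) in
        forall t X Y x, T t ->
          F t X Y x = F 0 X Y x +
            oriented_int 0 t (fun s => ddc (I s) (phi s) X Y x)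
    & forall t, T t -> tames (F t) J0].

(* Main.v *)
(* Let pi be the Poisson bivector of (F_0, J_0) and P f = pi(df), so that
   P f = J_0 X - I_0 X for F_0(X, .) = df. The closedness of F_0 and the
   integrability of I_0, J_0 give L_{P f} I_0 = - pi o dd^c_{I_0} f and the Jacobi
   identity for pi. Hence the flow Xi_t preserves pi, and I_t - J_0 + pi o F_t has
   derivative zero; the derivative of F_t I_t + J_0^* F_t then reduces to the
   (2,0)+(0,2) part of dd^c_{I_t} phi_t, which vanishes. So F_t is a closed form
   with I_t = - F_t^-1 J_0^* F_t, and Moser's argument applies to Z_t, as
   L_{Z_t} F_t = d(F_t Z_t) = - dd^c_{I_t} phi_t. Finally, if Y is the Phi_t-push
   forward of Y_{psi_t}, then J_0 Y = Z_t, and dJ_t/dt = Phi_t^* (L_{J_0 Y} J_0) =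
   Phi_t^* (J_0 L_Y J_0).

   Compactness gives vector fields E_k and functions x_k with
   X f = \sum_k X(x_k) E_k f; in this frame the smoothness in time of pulled back
   vector fields and the inversion of positive forms reduce to matrices of smooth
   functions. *)
From Pilot Require Import Defs.
From HB Require Import structures.
From mathcomp Require Import all_boot all_order all_algebra.
From mathcomp Require Import ring.
From mathcomp Require Import all_classical all_reals all_analysis.
Import Order.TTheory GRing.Theory Num.Theory.
Import numFieldNormedType.Exports.
Set Implicit Arguments.
Unset Strict Implicit.
Unset Printing Implicit Defensive.
Local Open Scope classical_set_scope.
Local Open Scope ring_scope.

Import Pilot.Defs.

(** * Calculus in several variables *)

(** Two gaps in the data shape the analytic half. An isotopy prescribes smoothness in time of
    [f (Phi t x)] only, not of the inverse [dinv (Phi t)], although pulled back fields and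
    conjugated structures contain that inverse. Its joint continuity is recovered from compactness,
    and its time derivative is never taken: identities are differentiated along the moving point
    [Phi t x] instead. Moreover [F t] is given by integrals at each point, so that being a tensor,
    skew and closed has to be derived. Each such identity is tested on fixed fields at a fixed
    point, where a real function of t vanishes at 0 and has derivative 0 on the interval [T]. What
    is available about the derivative of [F t] is joint continuity in (t, x), also after a field is
    applied; hence a version of Schwarz' theorem that assumes one mixed derivative and produces the
    other. Finally, vector fields are abstract derivations, so their local formula rests on
    Hadamard's lemma and on cutoffs built from exp(-1/x). *)

Section RealLemmas.
Context {R : realType}.
Implicit Types (f g : R -> R) (t d : R).

(** The first-order expansion holds on a full neighbourhood, [h = 0] included, so such estimates can
    be intersected and added; every derivative computed by hand below goes through it. *)
Lemma is_deriveP f t d :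
  is_derive t 1 f d <->
  forall e, 0 < e -> \forall h \near (0 : R), `|f (t + h) - f t - d * h| <= e * `|h|.
Proof.
split=> [[df <-] e e0|H].
  move: df => /cvgrPdist_le /(_ _ e0).
  rewrite /= near_withinE; apply: filterS => h H.
  have [->|h0] := eqVneq h 0.
    by rewrite addr0 subrr mulr0 subr0 normr0 mulr0.
  have := H h0; rewrite -/(derive _ _ _) scaler1 [h + t]addrC => H'.
  have -> : f (t + h) - f t - 'D_1 f t * h = - (('D_1 f t - h^-1 *: (f (t + h) - f t)) * h).
    by rewrite /GRing.scale/=; field.
  by rewrite normrN normrM ler_wpM2r.
suff C : h^-1 *: ((f \o shift t) (h *: (1 : R)) - f t) @[h --> 0^'] --> d.
  by apply: DeriveDef; [apply/cvg_ex; exists d|exact/cvg_lim].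
apply/cvgrPdist_le => e e0; rewrite near_withinE.
apply: filterS (H _ e0) => h Hh h0 /=.
rewrite scaler1 [h + t]addrC.
have -> : d - h^-1 *: (f (t + h) - f t) = - ((f (t + h) - f t - d * h) / h).
  by rewrite /GRing.scale/=; field.
by rewrite normrN normf_div ler_pdivrMr ?normr_gt0.
Qed.

Lemma is_derive_near_cont f t d : is_derive t 1 f d -> {for t, continuous f}.
Proof. by move=> [df _]; apply/differentiable_continuous/derivable1_diffP. Qed.

(** The mean value theorem with a reference slope [l] and unordered endpoints. It is the only source
    of the error bounds for total differentiability, Schwarz' theorem, derivatives under the
    integral and moving points. *)
Lemma mean_value_le f (df : R -> R) (a b l e : R) : 
  (forall x, Num.min a b <= x <= Num.max a b -> is_derive x 1 f (df x)) ->
  (forall x, Num.min a b <= x <= Num.max a b -> `|df x - l| <= e) ->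
  `|f b - f a - l * (b - a)| <= e * `|b - a|.
Proof.
wlog ab : a b / a < b => [W|].
  have [->|] := eqVneq a b; first by rewrite !subrr mulr0 subrr normr0 mulr0.
  rewrite neq_lt => /orP[|ba]; first exact: W.
  move=> H1 H2; rewrite -normrN opprD opprB -mulrN opprB [`|b - a|]distrC.
  by apply: W => // x; rewrite minC maxC; [exact: H1|exact: H2].
rewrite (min_l (ltW ab)) (max_r (ltW ab)) => H1 H2.
have [x||x xab ->] := @MVT R f df a b ab.
- by rewrite in_itv/= => /andP[/ltW ? /ltW ?]; apply: H1; apply/andP.
- apply: derivable_within_continuous => x; rewrite in_itv/= => /H1 [D _].
  exact: D.
- rewrite -mulrBl normrM ler_wpM2r//; apply: H2.
  by move: xab; rewrite in_itv/= => /andP[/ltW -> /ltW ->].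
Qed.

Lemma is_derive0_cst (T : set R) f : is_interval T ->
  (forall t, T t -> is_derive t 1 f 0) -> forall a b, T a -> T b -> f a = f b.
Proof.
move=> iT df a b Ta Tb; apply/eqP; rewrite eq_sym -subr_eq0 -normr_le0.
have I x : Num.min a b <= x <= Num.max a b -> T x.
  have [ab|ba] := leP a b; [exact: iT|exact: iT].
have := @mean_value_le f (cst 0) a b 0 0 (fun x Ix => df x (I x Ix)).
rewrite !mul0r subr0; apply => x _.
by rewrite subrr normr0.
Qed.

End RealLemmas.

Section RowVectors.
Context {R : realType}.

Lemma coord_le_norm n (v : 'rV[R]_n) j : `|v 0 j| <= `|v|.
Proof.
rewrite [leRHS]/Num.Def.normr/= mx_normrE.
by apply: le_trans (le_bigmax _ _ (0, j)).
Qed.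

Lemma norm_le_coord n (v : 'rV[R]_n) e : 0 <= e ->
  (forall j, `|v 0 j| <= e) -> `|v| <= e.
Proof.
move=> e0 H; rewrite [leLHS]/Num.Def.normr/= mx_normrE bigmax_le// => -[i j] _.
by rewrite ord1.
Qed.

Lemma norm_lt_coord n (v : 'rV[R]_n) e : 0 < e ->
  (forall j, `|v 0 j| < e) -> `|v| < e.
Proof.
move=> e0 H; rewrite [ltLHS]/Num.Def.normr/= mx_normrE bigmax_lt// => -[i j] _.
by rewrite ord1.
Qed.

Lemma cvg_rowP n (T : Type) (F : set_system T) {FF : Filter F} (f : T -> 'rV[R]_n) (l : 'rV[R]_n) :
  (forall j, f x 0 j @[x --> F] --> (l 0 j : R)) -> f @ F --> l.
Proof.
move=> H; apply/cvgrPdist_lt => e e0.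
have K : \forall x \near F, forall j : 'I_n, `|l 0 j - f x 0 j| < e.
  by apply: filter_forall => j; have /cvgrPdist_lt/(_ _ e0) := H j.
by apply: filterS K => x Kx; apply: norm_lt_coord => // j; rewrite !mxE.
Qed.

Lemma continuous_coord n j : continuous (fun v : 'rV[R]_n => v 0 j).
Proof. exact: matrix_normedtype.coord_continuous. Qed.

End RowVectors.

Section CkTheory.
Context {R : realType}.

Lemma Ck_on_sub n k (U V : set 'rV[R]_n) f : V `<=` U -> Ck_on k U f -> Ck_on k V f.
Proof.
move=> VU; elim: k f => [|k IH] f [cf df]; split=> //; try by move=> x /VU /cf.
by move=> i; have [d C] := df i; split=> [x /VU /d|]; [|exact: IH].
Qed.

Lemma Ck_on_local n k (U : set 'rV[R]_n) f :
  (forall x, U x -> exists V, [/\ open V, V x & Ck_on k V f]) -> Ck_on k U f.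
Proof.
elim: k f => [|k IH] f H; split=> //.
- by move=> x /H[V [_ Vx [cf _]]]; exact: cf.
- by move=> x /H[V [_ Vx [cf _]]]; exact: cf.
move=> i; split=> [x /H[V [_ Vx [_ df]]]|]; first by have [d _] := df i; exact: d.
apply: IH => x /H[V [oV Vx [_ df]]]; exists V; split=> //.
by have [_] := df i.
Qed.

Lemma Ck_on_cont n k (U : set 'rV[R]_n) f x : Ck_on k U f -> U x -> {for x, continuous f}.
Proof. by case: k => [|k] [cf _] Ux; exact: cf. Qed.

Lemma derivable_lineP n (f : 'rV[R]_n -> R) x v d :
  is_derive x v f d <-> is_derive (0 : R) (1 : R) (fun r : R => f (x + r *: v)) d.
Proof.
have E : (fun r : R => f (x + r *: v)) = (fun r : R => f (r *: v + x)).
  by apply/funext => r; rewrite addrC.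
have E2 : 'D_v f x = 'D_1 (fun r : R => f (r *: v + x)) 0.
  rewrite /derive/= scale0r add0r.
  by under [in RHS]eq_fun do rewrite addr0 scaler1.
rewrite E; split=> [[df <-]|[df <-]].
  by apply: DeriveDef; [exact: (derivable1P f x v).1 df|exact/esym].
by apply: DeriveDef; [exact: (derivable1P f x v).2 df|].
Qed.

Lemma is_derive_line n (f : 'rV[R]_n -> R) x v s :
  derivable f (x + s *: v) v ->
  is_derive s (1 : R) (fun r : R => f (x + r *: v)) ('D_v f (x + s *: v)).
Proof.
move=> /derivableP/derivable_lineP/is_deriveP H.
apply/is_deriveP => e e0; apply: filterS (H e e0) => h.
by rewrite add0r scale0r addr0 scalerDl addrA.
Qed.

(** One walks from [y] to [y + v] changing one coordinate at a time and applies the mean value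
    inequality on each edge. The whole path stays in the ball where the partial derivatives are
    [e]-close to their values at [y], because the norm is the maximum of the coordinates. *)
Lemma Ck_on_frechet n (V : set 'rV[R]_n) f y : open V -> Ck_on 1 V f -> V y ->
  forall e, 0 < e -> \forall v \near (0 : 'rV[R]_n),
    `|f (y + v) - f y - \sum_j 'D_(delta_mx 0 j) f y * v 0 j| <= e * \sum_j `|v 0 j|.
Proof.
move=> oV [_ df] Vy e e0.
have [r r0 Br] : exists2 r : R, 0 < r & forall w, `|w| < r ->
    V (y + w) /\ forall j, `|'D_(delta_mx 0 j) f (y + w) - 'D_(delta_mx 0 j) f y| <= e.
  have : \forall w \near y, V w /\ forall j : 'I_n,
      `|'D_(delta_mx 0 j) f w - 'D_(delta_mx 0 j) f y| <= e.
    near=> w; split; first by near: w; exact: open_nbhs_nbhs.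
    near: w; apply: filter_forall => j.
    have [_ [cd _]] := df j.
    have /cvgrPdist_le/(_ _ e0) := cd _ Vy.
    by apply: filterS => w; rewrite distrC.
  move=> /nbhs_ballP[r r0 Br]; exists r => // w wr; apply: Br.
  by rewrite -ball_normE /ball_/= opprD addrA subrr sub0r normrN.
near=> v.
have vr : `|v| < r.
  near: v; apply/nbhs_ballP; exists r => // u.
  by rewrite -ball_normE /ball_/= sub0r normrN.
pose w k : 'rV[R]_n := \row_j (if (j < k)%N then v 0 j else 0).
have w0 : w 0%N = 0 by apply/rowP => j; rewrite !mxE.
have wn : w n = v by apply/rowP => j; rewrite !mxE ltn_ord.
have wS (k : 'I_n) : w k.+1 = w k + v 0 k *: delta_mx 0 k.
  apply/rowP => j; rewrite !mxE eqxx/= ltnS leq_eqVlt.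
  have [->|jk] := eqVneq j k; first by rewrite eqxx ltnn/= add0r mulr1.
  by rewrite mulr0 addr0 (negbTE (_ : nat_of_ord j != k)).
have -> : f (y + v) - f y = \sum_(k < n) (f (y + w k.+1) - f (y + w k)).
  rewrite -(big_mkord xpredT (fun k => f (y + w k.+1) - f (y + w k))).
  by rewrite telescope_sumr// wn w0 addr0.
rewrite -sumrB mulr_sumr; apply: le_trans (ler_norm_sum _ _ _) _.
apply: ler_sum => k _.
have P s : Num.min 0 (v 0 k) <= s <= Num.max 0 (v 0 k) -> `|w k + s *: delta_mx 0 k| < r.
  move=> ms; apply: le_lt_trans vr; apply: norm_le_coord => // j.
  rewrite !mxE eqxx/=; have [->|jk] := eqVneq j k.
    rewrite ltnn add0r mulr1; apply: le_trans (coord_le_norm v k).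
    move: ms; case: (leP 0 (v 0 k)) => v0 /andP[s1 s2].
      by rewrite !ger0_norm.
    by rewrite !ler0_norm ?lerN2// ltW.
  rewrite mulr0 addr0; case: ifP => _; last by rewrite normr0.
  exact: coord_le_norm.
have D s : Num.min 0 (v 0 k) <= s <= Num.max 0 (v 0 k) ->
    is_derive s (1 : R) (fun s : R => f (y + w k + s *: delta_mx 0 k))
      ('D_(delta_mx 0 k) f (y + w k + s *: delta_mx 0 k)).
  move=> /P/Br[Vs _]; apply: is_derive_line; have [d _] := df k.
  by apply: d; rewrite -addrA.
have := mean_value_le (l := 'D_(delta_mx 0 k) f y) (e := e) D.
rewrite subr0 scale0r addr0 wS addrA; apply => s /P/Br[_]; rewrite -addrA.
exact.
Unshelve. all: by end_near. Qed.

Lemma is_derive_curve n (V : set 'rV[R]_n) f (c : R -> 'rV[R]_n) s (d : 'I_n -> R) :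
  open V -> Ck_on 1 V f -> V (c s) ->
  (forall j, is_derive s (1 : R) (fun r => c r 0 j) (d j)) ->
  is_derive s (1 : R) (f \o c) (\sum_j 'D_(delta_mx 0 j) f (c s) * d j).
Proof.
move=> oV Cf Vc dc; apply/is_deriveP => e e0.
(* The first sum bounds the coordinate increments of [c] (by [(|d j| + 1) |h|], thanks to
   [e' <= 1]), which multiply the Fréchet remainder; the second one weighs the first-order errors of
   the coordinates. The last 1 makes [K] positive. *)
pose K : R := \sum_j (`|d j| + 1) + \sum_j `|'D_(delta_mx 0 j) f (c s)| + 1.
have K0 : 0 < K.
  by rewrite ltr_pwDr// addr_ge0// sumr_ge0// => j _; rewrite addr_ge0.
pose e' := Num.min 1 (e / K).
have e'0 : 0 < e' by rewrite lt_min ltr01 divr_gt0.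
have cc : c (s + h) - c s @[h --> (0 : R)] --> (0 : 'rV[R]_n).
  apply: cvg_rowP => j; rewrite mxE.
  have /is_derive_near_cont C := dc j.
  under eq_fun do rewrite !mxE.
  apply/subr_cvg0.
  have : (s + h) @[h --> (0:R)] --> s.
    by rewrite -[X in _ --> X]addr0; apply: cvgD; [exact: cvg_cst|exact: cvg_id].
  by move=> /(cvg_comp _ _) /(_ C).
have F : \forall h \near (0 : R), `|f (c s + (c (s + h) - c s)) - f (c s) -
    \sum_j 'D_(delta_mx 0 j) f (c s) * (c (s + h) - c s) 0 j|
    <= e' * \sum_j `|(c (s + h) - c s) 0 j|.
  exact: cc _ (Ck_on_frechet oV Cf Vc e'0).
have G : \forall h \near (0 : R), forall j : 'I_n,
    `|c (s + h) 0 j - c s 0 j - d j * h| <= e' * `|h|.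
  have H (j : 'I_n) : \forall h \near (0 : R), `|c (s + h) 0 j - c s 0 j - d j * h| <= e' * `|h|.
    by have /is_deriveP/(_ _ e'0) := dc j.
  exact: filter_forall H.
apply: filterS2 F G => h /=; rewrite subrKC => F G.
rewrite /=; set A := f (c (s + h)) - f (c s) in F *.
have E : A - (\sum_j 'D_(delta_mx 0 j) f (c s) * d j) * h =
  (A - \sum_j 'D_(delta_mx 0 j) f (c s) * (c (s + h) - c s) 0 j) +
  \sum_j 'D_(delta_mx 0 j) f (c s) * (c (s + h) 0 j - c s 0 j - d j * h).
  have -> : \sum_j 'D_(delta_mx 0 j) f (c s) * (c (s + h) 0 j - c s 0 j - d j * h) =
    \sum_j 'D_(delta_mx 0 j) f (c s) * (c (s + h) - c s) 0 j -
    (\sum_j 'D_(delta_mx 0 j) f (c s) * d j) * h.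
    rewrite mulr_suml -sumrB; apply: eq_bigr => j _; rewrite !mxE; ring.
  ring.
rewrite {}E; apply: le_trans (ler_normD _ _) _.
have H1 : e' * \sum_j `|(c (s + h) - c s) 0 j| <= e' * ((\sum_j (`|d j| + 1)) * `|h|).
  rewrite ler_wpM2l ?(ltW e'0)// mulr_suml; apply: ler_sum => j _.
  rewrite !mxE; have := G j.
  have -> : c (s + h) 0 j - c s 0 j = (c (s + h) 0 j - c s 0 j - d j * h) + d j * h by ring.
  rewrite addrK => HB; apply: le_trans (ler_normD _ _) _.
  rewrite addrC mulrDl mul1r normrM lerD2l; apply: le_trans HB _.
  by rewrite ler_piMl// ge_min lexx.
have H2 : `|\sum_j 'D_(delta_mx 0 j) f (c s) * (c (s + h) 0 j - c s 0 j - d j * h)|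
   <= e' * ((\sum_j `|'D_(delta_mx 0 j) f (c s)|) * `|h|).
  apply: le_trans (ler_norm_sum _ _ _) _; rewrite mulr_suml mulr_sumr.
  by apply: ler_sum => j _; rewrite normrM mulrCA ler_wpM2l.
apply: le_trans (lerD (le_trans F H1) H2) _.
rewrite -mulrDr -mulrDl mulrA ler_wpM2r//.
have : e' * K <= e by rewrite -ler_pdivlMr// ge_min lexx orbT.
by apply: le_trans; rewrite ler_wpM2l ?(ltW e'0)// lerDl.
Qed.

Lemma Ck_on_sum n k (U : set 'rV[R]_n) (I : Type) (r : seq I) (P : pred I)
  (f : I -> 'rV[R]_n -> R) : open U ->
  (forall i, P i -> Ck_on k U (f i)) -> Ck_on k U (fun z => \sum_(i <- r | P i) f i z).
Proof.
move=> oU H; elim: r => [|i r IH].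
  by under eq_fun do rewrite big_nil; exact: Ck_on_cst.
under eq_fun do rewrite big_cons.
by case Pi : (P i) => //; apply: Ck_onD => //; exact: H.
Qed.

Lemma Ck_on_prod n k (U : set 'rV[R]_n) (I : Type) (r : seq I) (P : pred I)
  (f : I -> 'rV[R]_n -> R) : open U ->
  (forall i, P i -> Ck_on k U (f i)) -> Ck_on k U (fun z => \prod_(i <- r | P i) f i z).
Proof.
move=> oU H; elim: r => [|i r IH].
  by under eq_fun do rewrite big_nil; exact: Ck_on_cst.
under eq_fun do rewrite big_cons.
by case Pi : (P i) => //; apply: Ck_onM => //; exact: H.
Qed.

Lemma Ck_on_comp m n k (U : set 'rV[R]_m) (V : set 'rV[R]_n) f (g : 'rV[R]_m -> 'rV[R]_n) :
  open U -> open V -> (forall x, U x -> V (g x)) ->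
  (forall j, Ck_on k U (fun x => g x 0 j)) -> Ck_on k V f -> Ck_on k U (f \o g).
Proof.
move=> oU oV UV.
have cont k' f' : (forall j, Ck_on k' U (fun x => g x 0 j)) -> Ck_on k' V f' ->
    forall x, U x -> {for x, continuous (f' \o g)}.
  move=> Cg Cf x Ux; apply: continuous_comp; last exact: Ck_on_cont Cf (UV _ Ux).
  apply: (@cvg_rowP R n _ (nbhs x) _ g (g x)) => j.
  exact: (Ck_on_cont (Cg j)).
elim: k f => [|k IH] f Cg Cf; first by split=> //; exact: (cont 0%N).
have D x i : U x -> is_derive x (delta_mx 0 i) (f \o g)
    (\sum_j 'D_(delta_mx 0 j) f (g x) * 'D_(delta_mx 0 i) (fun x => g x 0 j) x).
  move=> Ux; apply/derivable_lineP.
  have := @is_derive_curve n V f (fun r : R => g (x + r *: delta_mx 0 i)) 0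
    (fun j => 'D_(delta_mx 0 i) (fun x => g x 0 j) x) oV.
  rewrite /= scale0r addr0; apply => //.
  - by apply: (@Ck_on_sub _ 1 V V) => //; elim: k {IH} Cf {Cg} => // k IH /Ck_on_leq.
  - exact: UV.
  - move=> j; have := @is_derive_line m (fun x => g x 0 j) x (delta_mx 0 i) 0.
    rewrite scale0r addr0; apply.
    by have [_ /(_ i)[d _]] := Cg j; exact: d.
split=> [|i]; first exact: (cont k.+1).
split=> [x Ux|]; first by have [] := D x i Ux.
apply: (@Ck_on_ext _ _ _ _ (fun x => \sum_j 'D_(delta_mx 0 j) f (g x) *
    'D_(delta_mx 0 i) (fun x => g x 0 j) x)) => //.
  by move=> x /set_mem Ux; have [_ ->] := D x i Ux.
apply: Ck_on_sum => // j _; apply: Ck_onM => //.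
  apply: (IH ('D_(delta_mx 0 j) f)) => [l|]; first exact: Ck_on_leq.
  by have [_ /(_ j)[]] := Cf.
by have [_ /(_ i)[]] := Cg j.
Qed.

(** Here [g] is the t-derivative of [f], [p] its r-derivative at [r0], and [q] the mixed derivative,
    continuous at one point; that [p] is differentiable is part of the conclusion. Two mean value
    inequalities bound the second difference of [f] over an h by k rectangle; then k is made small
    while h stays fixed. *)
Lemma Schwarz_derive (f g q : R -> R -> R) (p : R -> R) (t0 r0 d0 : R) : 0 < d0 ->
  (forall t r, `|t - t0| < d0 -> `|r - r0| < d0 ->
     [/\ is_derive t (1 : R) (f^~ r) (g t r), is_derive r0 (1 : R) (f t) (p t) &
       is_derive r (1 : R) (g t) (q t r)]) ->
  (forall e, 0 < e -> exists2 d : R, 0 < d & forall t r, `|t - t0| < d -> `|r - r0| < d ->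
     `|q t r - q t0 r0| <= e) ->
  is_derive t0 (1 : R) p (q t0 r0).
Proof.
move=> d00 H cq; apply/is_deriveP => e e0.
have [d1 d10 {}cq] := cq e e0.
pose d := Num.min d0 d1.
have dp : 0 < d by rewrite lt_min d00.
have dd0 (x : R) : `|x| < d -> `|x| < d0 by move/lt_le_trans; apply; rewrite ge_min lexx.
have dd1 (x : R) : `|x| < d -> `|x| < d1 by move/lt_le_trans; apply; rewrite ge_min lexx orbT.
have btw (a x c : R) : Num.min a (a + x) <= c <= Num.max a (a + x) -> `|c - a| <= `|x|.
  have [x0|x0] := leP 0 x.
    rewrite min_l ?max_r ?lerDl// => /andP[ac cx].
    by rewrite ger0_norm ?subr_ge0// lerBlDl ger0_norm.
  rewrite min_r ?max_l ?gerDl ?(ltW x0)// => /andP[ac cx].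
  by rewrite ler0_norm ?subr_le0// ltr0_norm// lerN2 lerBrDl.
have D2 (h k : R) : `|h| < d -> `|k| < d ->
    `|f (t0 + h) (r0 + k) - f (t0 + h) r0 - (f t0 (r0 + k) - f t0 r0) - q t0 r0 * k * h|
      <= e * `|k| * `|h|.
  move=> hd kd.
  have := @mean_value_le R (fun t => f t (r0 + k) - f t r0)
    (fun t => g t (r0 + k) - g t r0) t0 (t0 + h) (q t0 r0 * k) (e * `|k|).
  rewrite [t0 + h - t0]addrC addKr; apply=> t /btw th.
    have td : `|t - t0| < d0 by apply/dd0/(le_lt_trans th).
    have [|A _ _] := H t (r0 + k) td; first by rewrite addrC addKr dd0.
    have [|B _ _] := H t r0 td; first by rewrite subrr normr0.
    exact: is_deriveB.
  have := @mean_value_le R (g t) (q t) r0 (r0 + k) (q t0 r0) e.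
  rewrite [r0 + k - r0]addrC addKr; apply=> r /btw rk.
    have [||//] := H t r; [exact/dd0/(le_lt_trans th)|exact/dd0/(le_lt_trans rk)].
  by apply: cq; [exact/dd1/(le_lt_trans th)|exact/dd1/(le_lt_trans rk)].
apply/nbhs_ballP; exists d => // h; rewrite -ball_normE /ball_/= sub0r normrN => hd.
(* The slack [e'] pays for replacing the two difference quotients in k by [p (t0 + h)] and [p t0]. A
   single small nonzero k is enough, chosen after h. *)
apply/ler_addgt0Pr => e' e'0.
have e2 : 0 < e' / 2 by rewrite divr_gt0.
have [||_ /is_deriveP/(_ _ e2) P1 _] := H (t0 + h) r0.
- by rewrite addrC addKr; exact: dd0.
- by rewrite subrr normr0.
have [||_ /is_deriveP/(_ _ e2) P2 _] := H t0 r0; rewrite ?subrr ?normr0//.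
have P3 : \forall k \near (0 : R), `|k| < d.
  apply/nbhs_ballP; exists d => // k.
  by rewrite -ball_normE /ball_/= sub0r normrN.
have [k [k0 kd {}P1 {}P2]] : exists k : R, [/\ k != 0, `|k| < d,
   `|f (t0 + h) (r0 + k) - f (t0 + h) r0 - p (t0 + h) * k| <= e' / 2 * `|k| &
   `|f t0 (r0 + k) - f t0 r0 - p t0 * k| <= e' / 2 * `|k|].
  have [r rp Br] := (nbhs_ballP (0 : R) _).1 (@filterI _ (nbhs (0 : R)) _ _ _ P3
    (@filterI _ (nbhs (0 : R)) _ _ _ P1 P2)).
  exists (r / 2); have r2 : 0 < r / 2 by rewrite divr_gt0.
  have [] := Br (r / 2).
    rewrite -ball_normE /ball_/= sub0r normrN gtr0_norm//.
    by rewrite ltr_pdivrMr// ltr_pMr// ltr1n.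
  by move=> ? [? ?]; split=> //; rewrite gt_eqF.
have k1 : 0 < `|k| by rewrite normr_gt0.
rewrite -(ler_pM2r k1) -normrM.
have := D2 h k hd kd.
set a := f _ _ - _ in P1 *; set b := f _ _ - _ in P2 * => D.
have -> : (p (t0 + h) - p t0 - q t0 r0 * h) * k =
   (a - b - q t0 r0 * k * h) - (a - p (t0 + h) * k) + (b - p t0 * k) by ring.
apply: le_trans (ler_normD _ _) _.
apply: le_trans (lerD (ler_normB _ _) (lexx _)) _.
apply: le_trans (lerD (lerD D P1) P2) _.
by rewrite le_eqVlt; apply/orP; left; apply/eqP; field.
Qed.

End CkTheory.

(** * Bump functions *)

Section Bump.
Context {R : realType}.
Implicit Types (P : {poly R}).

Lemma horner_bound P : exists2 C : R, 0 <= C &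
  forall y, 1 <= y -> `|P.[y]| <= C * y ^+ (size P).
Proof.
exists (\sum_(i < size P) `|P`_i|); first exact: sumr_ge0.
move=> y y1; rewrite horner_coef mulr_suml; apply: le_trans (ler_norm_sum _ _ _) _.
apply: ler_sum => i _; rewrite normrM ler_wpM2l// ger0_norm ?exprn_ge0//; last exact: le_trans y1.
by rewrite ler_weXn2l// ltnW.
Qed.

(* All derivatives of exp(-1/x) on x > 0 have this shape. *)
Definition flat_exp P (x : R) := if 0 < x then P.[x^-1] * expR (- x^-1) else 0.

(** With y = 1/x, the derivative of P(y) exp(-y) in x is y^2 (P - P')(y) exp(-y), so the shape is
    preserved. At 0, with N = [size P], the bounds |P(1/h)| <= C h^-N and exp(1/h) >= h^-(N+2) /
    (N+2)! make the function O(h^2). *)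
Lemma is_derive_flat_exp P (x : R) :
  is_derive x 1 (flat_exp P) (flat_exp ('X^2 * (P - P^`())) x).
Proof.
have [x0|x0|<-] := ltgtP 0 x.
- have E : \forall y \near x, P.[y^-1] * expR (- y^-1) = flat_exp P y.
    near=> y; rewrite /flat_exp ifT//; near: y; exact: lt_nbhsr.
  apply: (near_eq_is_derive E).
  have xn0 : x != 0 by rewrite gt_eqF.
  rewrite /flat_exp x0.
  have dV : is_derive x (1 : R) (fun y : R => y^-1) (- x ^- 2).
    apply: DeriveDef; first by apply: derivableV => //; exact: derivable_id.
    by rewrite deriveV// derive_id scaler1.
  have dN : is_derive x (1 : R) (fun y : R => - y^-1) (x ^- 2).
    by rewrite -[x ^- 2]opprK; exact: is_deriveN.
  have d1 := is_derive1_comp (is_derive_poly P x^-1) dV.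
  have d2 := @is_derive1_comp _ expR (fun y : R => - y^-1) x _ _ (is_derive_expR _) dN.
  apply: is_derive_eq (is_deriveM d1 d2) _.
  by rewrite !hornerE /GRing.scale/= !exprVn; ring.
- have E : \forall y \near x, cst 0 y = flat_exp P y.
    near=> y; rewrite /flat_exp ifF//; apply/negbTE; rewrite -leNgt ltW//.
    near: y; exact: lt_nbhsl.
  apply: (near_eq_is_derive E).
  by rewrite /flat_exp ltNge (ltW x0)/=; exact: is_derive_cst.
rewrite /flat_exp ltxx; apply/is_deriveP => e e0.
have [C C0 HC] := horner_bound P.
pose K : R := C * ((size P).+2)`!%:R.
have K0 : 0 <= K by rewrite mulr_ge0.
near=> h; rewrite add0r ltxx subr0 mul0r subr0.
case: ifP => h0; last by rewrite normr0 mulr_ge0// ltW.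
have h1 : h <= 1 by apply: ltW; near: h; exact: lt_nbhsl.
have hK : h * (K + 1) <= e.
  rewrite -ler_pdivlMr ?ltr_wpDl//; apply: ltW; near: h; apply: lt_nbhsl.
  by rewrite divr_gt0// ltr_wpDl.
have y1 : 1 <= h^-1 by rewrite invf_ge1.
have y0 : 0 < h^-1 by rewrite invr_gt0.
have Ey : expR (- h^-1) <= ((size P).+2)`!%:R * h ^+ (size P).+2.
  rewrite expRN -[leRHS]invrK lef_pV2 ?posrE ?expR_gt0//; last first.
    by rewrite invr_gt0 mulr_gt0 ?exprn_gt0// ltr0n fact_gt0.
  rewrite invfM -exprVn mulrC; apply: le_trans (expR_ge1Dxn (size P).+1 (ltW y0)).
  by rewrite lerDr.
rewrite normrM (ger0_norm (expR_ge0 _)).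
apply: le_trans (ler_pM _ (expR_ge0 _) (HC _ y1) Ey) _ => //.
have -> : C * h^-1 ^+ size P * (((size P).+2)`!%:R * h ^+ (size P).+2) = h * K * h.
  rewrite /K !exprS exprVn; field.
  by rewrite expf_neq0// gt_eqF.
rewrite (gtr0_norm h0) ler_wpM2r ?(ltW h0)//; apply: le_trans hK.
by rewrite ler_wpM2l ?(ltW h0)// lerDl.
Unshelve. all: by end_near. Qed.

(** The outer function is given with the whole sequence of its derivatives, so the induction on [k]
    keeps [m] free and moves to [m.+1]. *)
Lemma Ck_on_comp1 n k (U : set 'rV[R]_n) (h : nat -> R -> R) (V : set R) f : open U ->
  (forall m x, V x -> is_derive x 1 (h m) (h m.+1 x)) -> (forall x, U x -> V (f x)) ->
  Ck_on k U f -> forall m, Ck_on k U (h m \o f).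
Proof.
move=> oU dh UV.
have cont k' : Ck_on k' U f -> forall m x, U x -> {for x, continuous (h m \o f)}.
  move=> Cf m x Ux; apply: continuous_comp; first exact: Ck_on_cont Cf Ux.
  exact: is_derive_near_cont (dh m _ (UV _ Ux)).
elim: k => [|k IH] Cf m; first by split=> //; exact: (cont 0%N).
have D x i : U x -> is_derive x (delta_mx 0 i) (h m \o f)
    (h m.+1 (f x) * 'D_(delta_mx 0 i) f x).
  move=> Ux; apply/derivable_lineP.
  have [_ /(_ i)[df _]] := Cf.
  have := @is_derive_line R n f x (delta_mx 0 i) 0.
  rewrite scale0r addr0 => /(_ (df _ Ux)) dl.
  have dm := dh m (f x) (UV _ Ux).
  have dm' : is_derive (f (x + 0 *: delta_mx 0 i)) 1 (h m) (h m.+1 (f x)).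
    by rewrite scale0r addr0.
  exact: (@is_derive1_comp _ (h m) (fun r : R => f (x + r *: delta_mx 0 i)) 0 _ _ dm' dl).
split=> [|i]; first exact: (cont k.+1).
split=> [x Ux|]; first by have [] := D x i Ux.
apply: (@Ck_on_ext _ _ _ _ (fun x => h m.+1 (f x) * 'D_(delta_mx 0 i) f x)) => //.
  by move=> x /set_mem Ux; have [_ ->] := D x i Ux.
apply: Ck_onM => //; first exact: IH (Ck_on_leq Cf) m.+1.
by have [_ /(_ i)[]] := Cf.
Qed.

Lemma Ck_on_flat_exp n k (U : set 'rV[R]_n) P f : open U -> Ck_on k U f ->
  Ck_on k U (fun z => flat_exp P (f z)).
Proof.
move=> oU Cf.
pose h m := flat_exp (iter m (fun P => 'X^2 * (P - P^`())) P).
apply: (@Ck_on_comp1 n k U h setT f oU _ _ Cf 0) => // m x _.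
exact: is_derive_flat_exp.
Qed.

Lemma is_derive_inv_pow (x : R) m : x != 0 ->
  is_derive x (1 : R) (fun y : R => (y ^+ m.+1)^-1) (- m.+1%:R * (x ^+ m.+2)^-1).
Proof.
move=> x0.
have d : derivable (fun y : R => y ^+ m.+1) x 1 by exact: exprn_derivable.
apply: DeriveDef; first by apply: derivableV => //; rewrite expf_neq0.
rewrite deriveV ?expf_neq0// exp_derive scaler1 /GRing.scale/= -mulr_natl.
rewrite !exprS; field.
by rewrite x0 expf_neq0.
Qed.

Lemma Ck_onV n k (U : set 'rV[R]_n) f : open U -> (forall x, U x -> f x != 0) ->
  Ck_on k U f -> Ck_on k U (fun z => (f z)^-1).
Proof.
move=> oU f0 Cf.
(* The m-th derivative of 1/y. *)
pose h m (y : R) : R := (-1) ^+ m * m`!%:R * (y ^+ m.+1)^-1.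
have E : Ck_on k U (h 0%N \o f).
  apply: (@Ck_on_comp1 n k U h [set y | y != 0] f oU _ _ Cf 0) => // m x /= x0.
  have D := is_derive_inv_pow m x0.
  have := is_deriveZ ((-1) ^+ m * m`!%:R : R) D.
  move=> /is_derive_eq; apply.
  rewrite /h /GRing.scale/= factS natrM [(-1) ^+ m.+1]exprS; set i := (_ ^+ m.+2)^-1.
  ring.
apply: Ck_on_ext E => // x _.
by rewrite /h/= expr0 fact0 !mul1r expr1.
Qed.

(** A smooth cutoff, 1 on [-1, 1] and 0 outside (-2, 2). Since 4 - x^2 and x^2 - 1 add up to 3, one
    of them is positive and the denominator never vanishes. *)
Definition plateau (x : R) : R :=
  flat_exp 1 (4 - x ^+ 2) / (flat_exp 1 (4 - x ^+ 2) + flat_exp 1 (x ^+ 2 - 1)).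

Lemma flat_exp1_ge0 x : 0 <= flat_exp 1 x.
Proof. by rewrite /flat_exp; case: ifP => // _; rewrite hornerE mul1r expR_ge0. Qed.

Lemma flat_exp1_gt0 x : 0 < x -> 0 < flat_exp 1 x.
Proof. by rewrite /flat_exp => ->; rewrite hornerE mul1r expR_gt0. Qed.

Lemma plateau_den_gt0 x : 0 < flat_exp 1 (4 - x ^+ 2) + flat_exp 1 (x ^+ 2 - 1).
Proof.
have [x2|x2] := ltP (x ^+ 2) 4.
  by rewrite ltr_pwDl ?flat_exp1_ge0// flat_exp1_gt0 ?subr_gt0.
rewrite ltr_wpDl ?flat_exp1_ge0// flat_exp1_gt0// subr_gt0.
by apply: lt_le_trans x2; rewrite ltr1n.
Qed.

Lemma plateau_ge0 x : 0 <= plateau x.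
Proof. by rewrite mulr_ge0 ?flat_exp1_ge0// invr_ge0 ltW// plateau_den_gt0. Qed.

Lemma plateau1 x : `|x| <= 1 -> plateau x = 1.
Proof.
move=> x1; have x2 : x ^+ 2 <= 1 by rewrite -real_normK ?num_real// expr_le1.
have := plateau_den_gt0 x; rewrite /plateau.
have -> : flat_exp 1 (x ^+ 2 - 1) = 0 by rewrite /flat_exp ltNge subr_le0 x2.
by rewrite addr0 => /gt_eqF d; rewrite divff ?d.
Qed.

Lemma plateau0 x : 2 <= `|x| -> plateau x = 0.
Proof.
move=> x1; have x2 : 4 <= x ^+ 2.
  rewrite -real_normK ?num_real//; have -> : 4 = 2 ^+ 2 :> R by rewrite -natrX.
  by rewrite ler_pXn2r ?nnegrE.
by rewrite /plateau [flat_exp 1 (4 - _)]/flat_exp ltNge subr_le0 x2/= mul0r.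
Qed.

Lemma Ck_on_plateau n k (U : set 'rV[R]_n) f : open U -> Ck_on k U f ->
  Ck_on k U (fun z => plateau (f z)).
Proof.
move=> oU Cf.
have C1 c : Ck_on k U (cst c) by exact: Ck_on_cst.
have Cf2 : Ck_on k U (fun z => f z ^+ 2).
  by apply: (Ck_on_ext oU _ (Ck_onM oU Cf Cf)) => x _; rewrite expr2.
have CA : Ck_on k U (fun z => flat_exp 1 (4 - f z ^+ 2)).
  apply: Ck_on_flat_exp => //.
  apply: (Ck_on_ext oU _ (Ck_onD oU (C1 4) (Ck_onM oU (C1 (-1)) Cf2))) => x _.
  by rewrite !fctE mulN1r.
have CB : Ck_on k U (fun z => flat_exp 1 (f z ^+ 2 - 1)).
  by apply: Ck_on_flat_exp => //; exact: (Ck_onD oU Cf2 (C1 (-1))).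
apply: Ck_onM => //; apply: Ck_onV => // [x _|]; last exact: Ck_onD.
by rewrite gt_eqF// plateau_den_gt0.
Qed.

(** A product over coordinates suffices because balls of the maximum norm are cubes: the value is 1
    up to radius [r] and 0 from radius [2 * r] on. *)
Definition bump n (c : 'rV[R]_n) (r : R) (z : 'rV[R]_n) : R :=
  \prod_j plateau ((z 0 j - c 0 j) / r).

Lemma bump_ge0 n (c : 'rV[R]_n) r z : 0 <= bump c r z.
Proof. by apply: prodr_ge0 => j _; exact: plateau_ge0. Qed.

Lemma bump1 n (c : 'rV[R]_n) r z : 0 < r -> `|z - c| <= r -> bump c r z = 1.
Proof.
move=> r0 zc; rewrite /bump big1// => j _; apply: plateau1.
rewrite normf_div (gtr0_norm r0) ler_pdivrMr// mul1r; apply: le_trans zc.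
by have := coord_le_norm (z - c) j; rewrite !mxE.
Qed.

Lemma bump0 n (c : 'rV[R]_n) r z : 0 < r -> 2 * r <= `|z - c| -> bump c r z = 0.
Proof.
move=> r0 zc.
have [j Hj] : exists j, 2 * r <= `|(z - c) 0 j|.
  apply: contrapT => /forallNP H; move: zc; apply/negP; rewrite -ltNge.
  apply: norm_lt_coord => [|j]; first by rewrite mulr_gt0.
  by have /negP := H j; rewrite -ltNge.
rewrite /bump (bigD1 j)//= plateau0 ?mul0r//.
by move: Hj; rewrite !mxE normf_div (gtr0_norm r0) ler_pdivlMr.
Qed.

Lemma Ck_on_coord n k (U : set 'rV[R]_n) j : open U -> Ck_on k U (fun z => z 0 j).
Proof.
move=> oU; case: k => [|k].
  by split=> // x _; exact: continuous_coord.
have D x i : is_derive x (delta_mx 0 i) (fun z : 'rV[R]_n => z 0 j) ((j == i)%:R).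
  apply/derivable_lineP; apply/is_deriveP => e e0; near=> h.
  rewrite [X in `|X|](_ : _ = 0); last by rewrite !mxE eqxx/=; ring.
  rewrite normr0.
  by rewrite mulr_ge0// ltW.
split=> [x _|i]; first exact: continuous_coord.
split=> [x _|]; first by have [] := D x i.
apply: (Ck_on_ext oU _ (Ck_on_cst k (j == i)%:R oU)) => x _.
by have [_ ->] := D x i.
Unshelve. all: by end_near. Qed.

Lemma Ck_on_bump n m k (U : set 'rV[R]_n) (c : 'rV[R]_m) r (g : 'rV[R]_n -> 'rV[R]_m) :
  open U -> (forall j, Ck_on k U (fun z => g z 0 j)) ->
  Ck_on k U (fun z => bump c r (g z)).
Proof.
move=> oU Cg; apply: Ck_on_prod => // j _.
apply: (@Ck_on_plateau n k U (fun z => (g z 0 j - c 0 j) / r)) => //.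
apply: (@Ck_onM _ _ _ _ (fun z => g z 0 j - c 0 j) (cst r^-1)) => //; last exact: Ck_on_cst.
by apply: (@Ck_onD _ _ _ _ (fun z => g z 0 j) (cst (- c 0 j))) => //; exact: Ck_on_cst.
Qed.

End Bump.

Lemma continuous_forP (R : realType) (T : topologicalType) (f : T -> R) z :
  {for z, continuous f} <-> forall e, 0 < e -> \forall z' \near z, `|f z - f z'| <= e.
Proof.
split=> [C e e0|H]; first exact: (@cvgrPdist_le _ _ _ (nbhs z) _ f (f z)).1 C e e0.
apply: (@cvgrPdist_le _ _ _ (nbhs z) _ f (f z)).2 => e e0; exact: H.
Qed.

(** * Hadamard's lemma *)

Section Hadamard.
Context {R : realType}.
Notation mu := (@lebesgue_measure R).
Local Notation J f := (\int[mu]_(s in `[0%R, 1%R]) f s)%R.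
Let cont01 (f : R -> R) := forall s : R, s \in `[0, 1] -> {for s, continuous f}.

Lemma cont01_integrable (f : R -> R) : cont01 f -> mu.-integrable `[0, 1] (EFin \o f).
Proof.
move=> cf; apply: continuous_compact_integrable; first exact: segment_compact.
by apply: continuous_in_subspaceT => s /set_mem; exact: cf.
Qed.

Lemma norm_int01_le (f : R -> R) e : cont01 f ->
  (forall s, s \in `[0, 1] -> `|f s| <= e) -> `|J f| <= e.
Proof.
move=> cf fe; have If := cont01_integrable cf.
apply: le_trans (le_normr_Rintegral _ If) _ => //.
have -> : e = J (fun=> e) :> R.
  rewrite Rintegral_cst//= lebesgue_measure_itv/= lte_fin ltr01/=.
  by rewrite oppr0 addr0 mulr1.
apply: le_Rintegral => //.
- by apply: integrable_norm.
- by apply: cont01_integrable => s _; exact: cst_continuous.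
Qed.

Context {n : nat} (p : 'rV[R]_n) (rho : R).
Let V := [set z : 'rV[R]_n | `|z - p| < rho].
Let seg (z : 'rV[R]_n) (s : R) := p + s *: (z - p).

Lemma open_norm_ball : open V.
Proof.
rewrite openE => z Vz; apply/nbhs_ballP; exists (rho - `|z - p|) => /=.
  by rewrite subr_gt0.
move=> y; rewrite -ball_normE /ball_/= distrC => zy.
rewrite /V/= -(subrKA z); apply: le_lt_trans (ler_normD _ _) _.
by rewrite -ltrBrDr.
Qed.

Let seg_V z s : V z -> s \in `[0, 1] -> V (seg z s).
Proof.
rewrite in_itv/= /V/= => Vz /andP[s0 s1].
rewrite /seg addrC addKr normrZ; apply: le_lt_trans Vz.
by rewrite ler_piMl// ger0_norm.
Qed.

Let cont_seg z s : {for s, continuous (seg z)}.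
Proof.
by apply: cvgD; [exact: cvg_cst|apply: cvgZr_tmp].
Qed.

Let seg_cvg z s : seg t.2 t.1 @[t --> (s, z)] --> seg z s.
Proof.
apply: cvgD; first exact: cvg_cst.
apply: cvgZ; first exact: cvg_fst.
by apply: cvgB; [exact: cvg_snd|exact: cvg_cst].
Qed.

(** Compactness of [0, 1] turns continuity at every [(s, z0)] into one neighbourhood of [z0] that
    serves all [s], which is what limits under the integral require. *)
Let seg_unif (v : 'rV[R]_n -> R) z0 e : (forall z, V z -> {for z, continuous v}) -> V z0 ->
  0 < e -> \forall z \near z0, forall s, s \in `[0, 1] ->
    `|v (seg z s) - v (seg z0 s)| <= e.
Proof.
move=> cv Vz0 e0.
have /compact_near_coveringP K := @segment_compact R 0 1.
pose P z s := `|v (seg z s) - v (seg z0 s)| <= e.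
have := K _ (nbhs z0) P _; apply => s s01; rewrite /P.
have e2 : 0 < e / 2 by rewrite divr_gt0.
have C : v (seg t.2 t.1) @[t --> (s, z0)] --> v (seg z0 s).
  by apply: (cvg_comp _ _ (@seg_cvg z0 s)); exact: cv (seg_V Vz0 s01).
have C' : v (seg z0 t) @[t --> s] --> v (seg z0 s).
  by apply: (cvg_comp _ _ (@cont_seg z0 s)); exact: cv (seg_V Vz0 s01).
have N1 : \forall t \near (s, z0), `|v (seg z0 s) - v (seg t.2 t.1)| <= e / 2.
  by move/cvgrPdist_le : C; exact.
have N2 : \forall t \near (s, z0), `|v (seg z0 s) - v (seg z0 t.1)| <= e / 2.
  have C2 : v (seg z0 t.1) @[t --> (s, z0)] --> v (seg z0 s).
    exact: (cvg_comp _ _ (@cvg_fst _ _ (nbhs s) (nbhs z0) _) C').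
  by move/cvgrPdist_le : C2; exact.
apply: filterS2 N1 N2 => -[s' z] /= H1 H2.
rewrite [e]splitr -(subrKA (v (seg z0 s))); apply: le_trans (ler_normD _ _) _.
by rewrite lerD// distrC.
Qed.

(** The weight [s ^+ m] closes the family under differentiation: a derivative in [z] of
    [v (seg z s)] brings out one factor [s], so the j-th partial derivative of [H m v] is [H m.+1]
    of that of [v]. *)
Let H m (v : 'rV[R]_n -> R) z := J (fun s => s ^+ m * v (seg z s)).

Let cont01_H m v z : (forall z, V z -> {for z, continuous v}) -> V z ->
  cont01 (fun s => s ^+ m * v (seg z s)).
Proof.
move=> cv Vz s s01; apply: cvgM; first exact: exprn_continuous.
by apply: continuous_comp (@cont_seg z s) _; exact: cv (seg_V Vz s01).
Qed.

Let H_cont m v z : (forall z, V z -> {for z, continuous v}) -> V z ->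
  {for z, continuous (H m v)}.
Proof.
move=> cv Vz; apply/continuous_forP => e e0.
have Vn : \forall z' \near z, V z' by exact: (open_nbhs_nbhs (conj open_norm_ball Vz)).
apply: filterS2 Vn (seg_unif cv Vz e0) => z' Vz' Hs.
rewrite /H -RintegralB//; [|exact: cont01_integrable (cont01_H cv Vz)
  |exact: cont01_integrable (cont01_H cv Vz')].
apply: norm_int01_le => [s s01|s s01].
  by apply: cvgB; [exact: (cont01_H cv Vz)|exact: (cont01_H cv Vz')].
rewrite -mulrBr normrM distrC; apply: le_trans (Hs s s01).
move: s01; rewrite in_itv/= => /andP[s0 s1].
by rewrite ler_piMl// ger0_norm ?exprn_ge0// exprn_ile1.
Qed.

Let H_derive m v z j : Ck_on 1 V v -> V z ->
  is_derive z (delta_mx 0 j) (H m v) (H m.+1 ('D_(delta_mx 0 j) v) z).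
Proof.
move=> [cv /(_ j)[dv [cdv _]]] Vz; apply/derivable_lineP/is_deriveP => e e0.
have Vn : \forall z' \near z, V z' by exact: (open_nbhs_nbhs (conj open_norm_ball Vz)).
have [d d0 Bd] := (nbhs_ballP z _).1
  (@filterI _ (nbhs z) _ _ _ Vn (seg_unif cdv Vz e0)).
have {}Bd (r : R) : `|r| < d -> V (z + r *: delta_mx 0 j) /\ forall s, s \in `[0, 1] ->
    `|'D_(delta_mx 0 j) v (seg (z + r *: delta_mx 0 j) s) - 'D_(delta_mx 0 j) v (seg z s)| <= e.
  move=> rd; apply: Bd; rewrite -ball_normE /ball_/= opprD addrA subrr sub0r normrN.
  apply: le_lt_trans rd; rewrite normrZ ler_piMr//; apply: norm_le_coord => // l.
  by rewrite mxE; case: (_ && _); rewrite ?normr1 ?normr0.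
apply/nbhs_ballP; exists d => // r; rewrite -ball_normE /ball_/= sub0r normrN => rd.
rewrite scale0r addr0 add0r.
have [Vr _] := Bd r rd.
have I1 := @cont01_H m _ _ cv Vz; have I2 := @cont01_H m _ _ cv Vr.
have I3 := @cont01_H m.+1 _ _ cdv Vz.
have I12 : cont01 (fun s => s ^+ m * v (seg (z + r *: delta_mx 0 j) s) - s ^+ m * v (seg z s)).
  by move=> s s01; apply: cvgB; [exact: I2|exact: I1].
have I4 : cont01 (fun s => s ^+ m.+1 * 'D_(delta_mx 0 j) v (seg z s) * r).
  by move=> s s01; apply: cvgM; [exact: I3|exact: cvg_cst].
rewrite /H -RintegralB//; [|exact: cont01_integrable..].
rewrite -RintegralZr//; [|exact: cont01_integrable].
rewrite -RintegralB//; [|exact: cont01_integrable..].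
apply: norm_int01_le => [s s01|s s01]; first by apply: cvgB; [exact: I12|exact: I4].
have segE t : seg (z + t *: delta_mx 0 j) s = seg z s + (s * t) *: delta_mx 0 j.
  by rewrite /seg -addrA [t *: _ + _]addrC addrA scalerDr addrA scalerA.
have s01' := s01; move: s01'; rewrite in_itv/= => /andP[s0 s1].
have := @mean_value_le R (fun t => v (seg (z + t *: delta_mx 0 j) s))
  (fun t => s * 'D_(delta_mx 0 j) v (seg (z + t *: delta_mx 0 j) s)) 0 r
  (s * 'D_(delta_mx 0 j) v (seg z s)) e.
have tr (t : R) : Num.min 0 r <= t <= Num.max 0 r -> `|t| < d.
  move=> tm; apply: le_lt_trans rd; move: tm; have [r0|r0] := leP 0 r => /andP[a b].
    by rewrite !ger0_norm.
  by rewrite !ler0_norm ?lerN2// ltW.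
move=> /(_ _ _) MV.
have {MV} : `|v (seg (z + r *: delta_mx 0 j) s) - v (seg (z + 0 *: delta_mx 0 j) s) -
   s * 'D_(delta_mx 0 j) v (seg z s) * (r - 0)| <= e * `|r - 0|.
  apply: MV => t /tr /Bd[Vt Et].
    have D : is_derive (s * t) (1 : R) (fun t => v (seg z s + t *: delta_mx 0 j))
        ('D_(delta_mx 0 j) v (seg z s + (s * t) *: delta_mx 0 j)).
      by apply: is_derive_line; apply: dv; rewrite -segE; exact: seg_V.
    have Ds : is_derive t (1 : R) (fun t : R => s * t) s.
      have := @is_deriveZ _ _ _ id s t 1 1 (is_derive_id _ _).
      by move=> /is_derive_eq; apply; rewrite /GRing.scale/= mulr1.
    under eq_fun do rewrite segE.
    rewrite segE mulrC.
    exact: (@is_derive1_comp _ (fun t => v (seg z s + t *: delta_mx 0 j))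
       (fun t => s * t) t _ _ D Ds).
  rewrite -mulrBr normrM; apply: le_trans (Et _ s01).
  by rewrite ler_piMl// ger0_norm.
rewrite scale0r addr0 subr0 => MV.
have -> : s ^+ m * v (seg (z + r *: delta_mx 0 j) s) - s ^+ m * v (seg z s) -
   s ^+ m.+1 * 'D_(delta_mx 0 j) v (seg z s) * r =
   s ^+ m * (v (seg (z + r *: delta_mx 0 j) s) - v (seg z s) -
   s * 'D_(delta_mx 0 j) v (seg z s) * r) by rewrite exprS; ring.
rewrite normrM; apply: le_trans MV.
by rewrite ler_piMl// ger0_norm ?exprn_ge0// exprn_ile1.
Qed.

Let Ck_on_H k m v : Ck_on k V v -> Ck_on k V (H m v).
Proof.
elim: k m v => [|k IH] m v Cv.
  by split=> // z; apply: H_cont; have [] := Cv.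
have C1 : Ck_on 1 V v.
  by move: Cv; clear IH; elim: k => // k IH /Ck_on_leq.
split=> [z|i]; first by apply: H_cont; have [] := Cv.
split=> [z Vz|]; first by have [] := @H_derive m _ _ i C1 Vz.
have [_ /(_ i)[_ Ci]] := Cv.
apply: Ck_on_ext (IH m.+1 _ Ci); first exact: open_norm_ball.
by move=> z /set_mem Vz; have [_ ->] := @H_derive m _ _ i C1 Vz.
Qed.

(** [h i z] is the mean of the i-th partial derivative of [u] on the segment from [p] to [z], and
    the expansion is the fundamental theorem of calculus along that segment. A derivation applied to
    it at [p] sees only the values [h i p]. *)
Lemma Hadamard (u : 'rV[R]_n -> R) : 0 < rho -> Cinfty_on V u ->
  exists h : 'I_n -> 'rV[R]_n -> R, [/\ forall i, Cinfty_on V (h i),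
    forall z, V z -> u z = u p + \sum_i (z 0 i - p 0 i) * h i z &
    forall i, h i p = 'D_(delta_mx 0 i) u p].
Proof.
move=> rho0 Cu; exists (fun i => H 0 ('D_(delta_mx 0 i) u)); split.
- by move=> i k; apply: Ck_on_H; have [_ /(_ i)[]] := Cu k.+1.
- move=> z Vz.
  have cdu i z' : V z' -> {for z', continuous ('D_(delta_mx 0 i) u)}.
    by have [_ /(_ i)[_ [+ _]]] := Cu 1%N; exact.
  have D (s : R) : s \in `[0, 1] -> is_derive s (1 : R) (fun s => u (seg z s))
      (\sum_i 'D_(delta_mx 0 i) u (seg z s) * (z 0 i - p 0 i)).
    move=> s01; apply: (is_derive_curve open_norm_ball (Cu 1%N) (seg_V Vz s01)) => j.
    rewrite /seg; apply/is_deriveP => e e0; near=> h.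
    rewrite [X in `|X|](_ : _ = 0); last by rewrite !mxE; ring.
    by rewrite normr0 mulr_ge0// ltW.
  have C0 i : cont01 (fun s => 'D_(delta_mx 0 i) u (seg z s)).
    by move=> s s01; exact: (cvg_comp _ _ (@cont_seg z s) (cdu i _ (seg_V Vz s01))).
  have C i : cont01 (fun s => 'D_(delta_mx 0 i) u (seg z s) * (z 0 i - p 0 i)).
    by move=> s s01; apply: cvgM; [exact: C0|exact: cvg_cst].
  have cs (r : seq 'I_n) : cont01 (fun s => \sum_(i <- r)
      'D_(delta_mx 0 i) u (seg z s) * (z 0 i - p 0 i)).
    move=> s s01; apply: (cvg_big (op := +%R)) => [|i _]; last exact: C.
    exact: add_continuous.
  have := @continuous_FTC2 R
    (fun s => \sum_i 'D_(delta_mx 0 i) u (seg z s) * (z 0 i - p 0 i))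
    (fun s => u (seg z s)) 0 1 ltr01.
  have c01 : {within `[0, 1], continuous (fun s : R =>
      \sum_i 'D_(delta_mx 0 i) u (seg z s) * (z 0 i - p 0 i))}.
    by apply: continuous_in_subspaceT => s /set_mem; exact: cs.
  have LR : derivable_oo_LRcontinuous (fun s : R => u (seg z s)) 0 1.
    split=> [s /subset_itv_oo_cc s01||]; first by have [] := D s s01.
      apply: cvg_at_right_filter.
      by apply: is_derive_near_cont (D 0 _); rewrite in_itv/= lexx ler01.
    apply: cvg_at_left_filter.
    by apply: is_derive_near_cont (D 1 _); rewrite in_itv/= lexx ler01.
  move=> /(_ c01 LR) FT.
  have {FT} := FT (fun s s01 => etrans (derive1E _ _) (@derive_val _ _ _ _ _ _ _ (D s (subset_itv_oo_cc s01)))).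
  rewrite /seg scale1r scale0r addr0 subrKC => FT.
  rewrite -[u z](subrK (u p)) addrC; congr (_ + _).
  have -> : u z - u p = J (fun s => \sum_i 'D_(delta_mx 0 i) u (seg z s) * (z 0 i - p 0 i)).
    by rewrite /Rintegral FT.
  have sumJ (r : seq 'I_n) : J (fun s => \sum_(i <- r)
      'D_(delta_mx 0 i) u (seg z s) * (z 0 i - p 0 i)) =
      \sum_(i <- r) J (fun s => 'D_(delta_mx 0 i) u (seg z s) * (z 0 i - p 0 i)).
    elim: r => [|i r IH].
      rewrite big_nil; under eq_Rintegral do rewrite big_nil.
      by rewrite Rintegral_cst// mul0r.
    rewrite big_cons; under eq_Rintegral do rewrite big_cons.
    by rewrite RintegralD//; [rewrite IH|exact: cont01_integrable (C i)
      |exact: cont01_integrable (cs r)].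
  rewrite sumJ; apply: eq_bigr => i _; rewrite RintegralZr//; last first.
    exact: cont01_integrable (C0 i).
  by rewrite mulrC; congr (_ * _); apply: eq_Rintegral => s _; rewrite expr0 mul1r.
- move=> i; rewrite /H.
  under eq_Rintegral do rewrite /seg subrr scaler0 addr0 expr0 mul1r.
  rewrite Rintegral_cst//= lebesgue_measure_itv/= lte_fin ltr01/=.
  by rewrite oppr0 addr0 mulr1.
Unshelve. all: by end_near. Qed.

End Hadamard.

Lemma near_open (T : topologicalType) (A : set T) x : open A -> A x -> \forall y \near x, A y.
Proof. by move=> oA Ax; exact: open_nbhs_nbhs. Qed.

Lemma near_ex_open (T : topologicalType) (x : T) (P : set T) : (\forall y \near x, P y) ->
  exists U, [/\ open U, U x & U `<=` P].
Proof. by move=> H; have : nbhs x P by []; rewrite nbhsE => -[U [oU Ux] UP]; exists U. Qed.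

Lemma compact_norm_ball (R : realType) n (c : 'rV[R]_n) (r : R) :
  compact [set z | `|z - c| <= r].
Proof.
have [r0|r0] := ltP r 0.
  rewrite (_ : [set _ | _] = set0); first exact: compact0.
  by apply/seteqP; split=> z //=; rewrite leNgt (lt_le_trans r0).
have := @rV_compact R n (fun i => `[c 0 i - r, c 0 i + r]%classic)
  (fun i => @segment_compact R _ _).
congr compact; apply/seteqP; split=> z /= H.
  apply: norm_le_coord => // j; rewrite !mxE.
  by have := H j; rewrite /= in_itv/= ler_distl.
move=> i; rewrite /= in_itv/= -ler_distl.
by apply: le_trans H; have := coord_le_norm (z - c) i; rewrite !mxE.
Qed.

(** * Derivations in charts and global frames *)

Section Charts.
Context {R : realType} {n : nat} {M : manifold R n}.
Implicit Types (a b : chart M) (f g : C^oo M) (X Y : Vect M).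

Lemma Cinf_smooth f : smooth f.
Proof. by case: f => f /= /asboolP. Qed.

Lemma open_cod a : open (cod a).
Proof. exact: cod_open. Qed.

Lemma cod_coord a x : dom a x -> cod a (coord a x).
Proof. by exists x. Qed.

Lemma paramK a y : cod a y -> dom a (param a y) /\ coord a (param a y) = y.
Proof. by move=> [x dx <-]; rewrite coordK. Qed.

Lemma near_dom a x : dom a x -> \forall y \near x, dom a y.
Proof. by move=> dx; exact: near_open (dom_open a) dx. Qed.

Lemma near_chart a x (P : set 'rV[R]_n) : dom a x -> (\forall z \near coord a x, P z) ->
  \forall y \near x, P (coord a y).
Proof. by move=> dx; exact: (coord_continuous dx). Qed.

Lemma near_param a y (P : set M) : cod a y -> (\forall x \near param a y, P x) ->
  \forall z \near y, P (param a z).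
Proof. by move=> cy; exact: (param_continuous cy). Qed.

Lemma open_overlap a b : open (coord a @` (dom a `&` dom b)).
Proof.
rewrite openE => _ [x [ax bx] <-].
have H1 : \forall z \near coord a x, cod a z.
  exact: near_open (@open_cod a) (cod_coord ax).
have H2 : \forall z \near coord a x, dom b (param a z).
  by apply: near_param; [exact: cod_coord|rewrite coordK//; exact: near_dom].
apply: filterS2 H1 H2 => z cz bz; have [az <-] := paramK cz.
by exists (param a z).
Qed.

Lemma smooth_continuous (f : M -> R) : smooth f -> continuous f.
Proof.
move=> sf x; have [a ax] := chart_cover x.
have cu := Ck_on_cont (sf a 0%N) (cod_coord ax).
apply/continuous_forP => e e0.
have /(near_chart ax) := (continuous_forP _ _).1 cu e e0.
apply: filterS2 (near_dom ax) => y ay /=.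
by rewrite !coordK.
Qed.

Definition ext0 a (v : 'rV[R]_n -> R) (x : M) : R :=
  if `[< dom a x >] then v (coord a x) else 0.

Lemma ext0E a v x : dom a x -> ext0 a v x = v (coord a x).
Proof. by move=> ax; rewrite /ext0 asboolT. Qed.

(** The support lies in the image of the closed ball of radius [r'], which is compact, hence closed
    as [M] is Hausdorff. Near a point outside [dom a] the function is therefore 0; inside [dom a] it
    is [v] composed with a transition map for radius below [r], and locally 0 otherwise. *)
Lemma smooth_ext0 a c (r' r : R) v : r' < r -> (forall z, `|z - c| < r -> cod a z) ->
  Cinfty_on [set z | `|z - c| < r] v -> (forall z, r' <= `|z - c| -> v z = 0) ->
  smooth (ext0 a v).
Proof.
move=> r'r sub Cv v0 b k; apply: Ck_on_local => y cy.
have [bx yE] := paramK cy; set x := param b y in bx yE.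
pose K := param a @` [set z | `|z - c| <= r'].
have sK z : `|z - c| <= r' -> cod a z by move=> H; apply: sub; exact: le_lt_trans r'r.
have cK : compact K.
  apply: continuous_compact.
    apply: continuous_in_subspaceT => z /set_mem /sK; exact: param_continuous.
  exact: compact_norm_ball.
have Kcl : closed K by apply: compact_closed => //; exact: hausdorff_carrier.
have [ax|nax] := pselect (dom a x).
  have NO : \forall z \near y, (coord b @` (dom b `&` dom a)) z.
    by apply: near_open; [exact: open_overlap|exists x].
  have Nc (P : set 'rV[R]_n) : (\forall w \near coord a x, P w) ->
      \forall z \near y, P (coord a (param b z)).
    move=> H; apply: (near_param (P := fun x => P (coord a x)) cy).
    exact: near_chart.
  have Oz z : (coord b @` (dom b `&` dom a)) z -> dom a (param b z).
    by move=> [w [bw aw] <-]; rewrite coordK.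
  have [wr|rw] := ltP `|coord a x - c| r.
    have Nr := Nc _ (near_open (@open_norm_ball R n c r) wr).
    have [U [oU Uy UK]] := near_ex_open (@filterI _ (nbhs y) _ _ _ NO Nr).
    exists U; split=> //.
    have C1 : Ck_on k U (v \o (fun z => coord a (param b z))).
      apply: (Ck_on_comp oU (@open_norm_ball R n c r)) (Cv k) => [z /UK[]//|j].
      apply: Ck_on_sub (transition_smooth b a j k); first by move=> z /UK[].
    apply: Ck_on_ext C1 => // z /set_mem /UK[/Oz az _].
    by rewrite /= ext0E.
  have Nr : \forall z \near y, r' < `|coord a (param b z) - c|.
    apply: (Nc (fun w => r' < `|w - c|)).
    pose N w := `|w - c| : R^o.
    have cN : {for coord a x, continuous N}.
      apply: (@cvg_norm _ _ _ (nbhs (coord a x))).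
      by apply: cvgB; [exact: cvg_id|exact: cvg_cst].
    exact: cN _ (lt_nbhsr (lt_le_trans r'r rw)).
  have [U [oU Uy UK]] := near_ex_open (@filterI _ (nbhs y) _ _ _ NO Nr).
  exists U; split=> //; apply: (Ck_on_ext oU _ (Ck_on_cst k 0 oU)) => z /set_mem.
  by move=> /UK[/Oz az /= rz]; rewrite /= ext0E// v0// ltW.
have nKx : (~` K) x.
  by move=> [z /sK/paramK[az _] zx]; apply: nax; rewrite -zx.
have NK : \forall z \near y, (~` K) (param b z).
  apply: near_param => //; apply: near_open => //; exact: closed_openC.
have Nb : \forall z \near y, cod b z by exact: near_open (@open_cod b) cy.
have [U [oU Uy UK]] := near_ex_open (@filterI _ (nbhs y) _ _ _ Nb NK).
exists U; split=> //; apply: (Ck_on_ext oU _ (Ck_on_cst k 0 oU)) => z /set_mem /UK[cz nKz].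
rewrite /= /ext0; case: asboolP => // az; rewrite v0// leNgt; apply/negP => zr.
by apply: nKz; exists (coord a (param b z)); rewrite /= ?(ltW zr)// coordK.
Qed.

Lemma mkCinf_subproof (f : M -> R) : smooth f -> f \in @smooth_pred R n M.
Proof. by move=> sf; exact/asboolP. Qed.

Definition mkCinf (f : M -> R) (sf : smooth f) : C^oo M := MkCinf (mkCinf_subproof sf).

Lemma derivationM X f g : X (f * g) = X f * g + f * X g.
Proof. by case: X => [X /= /asboolP[_]]. Qed.

Lemma derivation_lin X : linear X.
Proof. by case: X => [X /= /asboolP[]]. Qed.

Lemma derivationD X f g : X (f + g) = X f + X g.
Proof. by have := derivation_lin X 1 f g; rewrite !scale1r. Qed.

Lemma derivation0 X : X 0 = 0.
Proof. by have := derivationD X 0 0; rewrite addr0 => /eqP; rewrite -subr_eq subrr => /eqP. Qed.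

Lemma derivationN X f : X (- f) = - X f.
Proof. by apply/eqP; rewrite -addr_eq0 -derivationD addNr derivation0. Qed.

Lemma derivationB X f g : X (f - g) = X f - X g.
Proof. by rewrite derivationD derivationN. Qed.

Lemma derivationZ X c f : X (c *: f) = c *: X f.
Proof. by have := derivation_lin X c f 0; rewrite !addr0 derivation0 addr0. Qed.

Lemma derivation1 X : X 1 = 0.
Proof.
have := derivationM X 1 1; rewrite !mul1r mulr1 => /eqP.
by rewrite -subr_eq subrr => /eqP.
Qed.

Lemma derivation_sum X (I : Type) (s : seq I) (P : pred I) (F : I -> C^oo M) :
  X (\sum_(i <- s | P i) F i) = \sum_(i <- s | P i) X (F i).
Proof.
elim: s => [|i s IH]; first by rewrite !big_nil derivation0.
by rewrite !big_cons; case: ifP => _ //; rewrite derivationD IH.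
Qed.

Lemma Cinf_sumE (I : Type) (s : seq I) (P : pred I) (F : I -> C^oo M) x :
  (\sum_(i <- s | P i) F i) x = \sum_(i <- s | P i) F i x.
Proof.
elim: s => [|i s IH]; first by rewrite !big_nil.
by rewrite !big_cons; case: ifP => _ //; rewrite CinfDE IH.
Qed.

(** Radius [3 * r] leaves room for two nested cutoffs: [coordf] is the coordinate up to radius [r]
    and vanishes from [2 * r] on, while [boxf] vanishes from [r] on, so that [coordf] is the true
    coordinate wherever [boxf] is nonzero. *)
Lemma exists_box a x : dom a x ->
  exists2 r, 0 < r & forall z, `|z - coord a x| < 3 * r -> cod a z.
Proof.
move=> ax; have /nbhs_ballP[e e0 Be] := near_open (@open_cod a) (cod_coord ax).
exists (e / 3); first by rewrite divr_gt0.
move=> z ze; apply: Be; rewrite -ball_normE /ball_/= distrC.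
by move: ze; rewrite mulrC divfK.
Qed.

Section Box.
Variables (a : chart M) (c : 'rV[R]_n) (r : R).
Hypothesis r0 : 0 < r.
Hypothesis subc : forall z, `|z - c| < 3 * r -> cod a z.

Let C_bump k (U : set 'rV[R]_n) p s : open U -> Ck_on k U (bump p s).
Proof. by move=> oU; apply: (@Ck_on_bump _ n n k U p s id oU) => j; exact: Ck_on_coord. Qed.

Lemma smooth_coordf i : smooth (ext0 a (fun z => z 0 i * bump c r z)).
Proof.
apply: (@smooth_ext0 a c (2 * r) (3 * r)) => //.
- by rewrite ltr_pM2r// ltr_nat.
- move=> k; apply: Ck_onM; [exact: open_norm_ball| |exact/C_bump/open_norm_ball].
  exact/Ck_on_coord/open_norm_ball.
- by move=> z zr; rewrite bump0 ?mulr0.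
Qed.
Definition coordf i : C^oo M := mkCinf (smooth_coordf i).

Lemma coordfE i y : dom a y -> `|coord a y - c| <= r -> coordf i y = coord a y 0 i.
Proof. by move=> ay yr; rewrite /= ext0E// bump1 ?mulr1. Qed.

Lemma smooth_boxf : smooth (ext0 a (bump c (r / 2))).
Proof.
apply: (@smooth_ext0 a c r (3 * r)) => //.
- by rewrite ltr_pMl// ltr1n.
- by move=> k; exact/C_bump/open_norm_ball.
- by move=> z zr; rewrite bump0 ?divr_gt0// mulrC divfK.
Qed.
Definition boxf : C^oo M := mkCinf smooth_boxf.

Lemma boxf_ge0 y : 0 <= boxf y.
Proof. by rewrite /= /ext0; case: asboolP => // _; exact: bump_ge0. Qed.

Lemma boxf_neq0 y : boxf y != 0 -> dom a y /\ `|coord a y - c| < r.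
Proof.
rewrite /= /ext0; case: asboolP => [ay bn|_]; last by rewrite eqxx.
split=> //; rewrite ltNge; apply/negP => rb; move: bn.
by rewrite bump0 ?eqxx ?divr_gt0// mulrC divfK.
Qed.

Lemma boxf_gt0 y : dom a y -> `|coord a y - c| < r / 2 -> 0 < boxf y.
Proof. by move=> ay yr; rewrite /= ext0E// bump1 ?divr_gt0// ltW. Qed.

(** No locality of [X] is presupposed. Hadamard's lemma at [coord a y], multiplied by cutoffs,
    becomes an identity between global smooth functions, to which [X] applies. *)
Lemma derivation_local X f y : dom a y -> `|coord a y - c| < r ->
  X f y = \sum_i X (coordf i) y * 'D_(delta_mx 0 i) (f \o param a) (coord a y).
Proof.
move=> ay yr; set p := coord a y in yr *.
pose rho := r - `|p - c|.
have rho0 : 0 < rho by rewrite subr_gt0.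
have Vr z : `|z - p| < rho -> `|z - c| < r.
  move=> H; rewrite -(subrKA p); apply: le_lt_trans (ler_normD _ _) _.
  by rewrite -ltrBrDr.
have Vc z : `|z - p| < rho -> cod a z.
  move=> /Vr H; apply: subc; apply: lt_trans H _.
  by rewrite ltr_pMl// ltr1n.
have Cu : Cinfty_on [set z | `|z - p| < rho] (f \o param a).
  by move=> k; apply: Ck_on_sub (Cinf_smooth f a k) => z; exact: Vc.
have [h [Ch uE hp]] := Hadamard rho0 Cu.
have r4 : 0 < rho / 4 by rewrite divr_gt0.
have r24 : 2 * (rho / 4) = rho / 2 by field.
have r2 : rho / 2 < rho by rewrite ltr_pdivrMr// ltr_pMr// ltr1n.
pose b := bump p (rho / 4).
have b0 z : rho / 2 <= `|z - p| -> b z = 0 by rewrite -r24; exact: bump0.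
have sb : smooth (ext0 a b).
  apply: (@smooth_ext0 a p (rho / 2) rho) => //.
  by move=> k; exact/C_bump/open_norm_ball.
have sh i : smooth (ext0 a (fun z => b z * h i z)).
  apply: (@smooth_ext0 a p (rho / 2) rho) => // [k|z /b0 ->]; last by rewrite mul0r.
  by apply: Ck_onM; [exact: open_norm_ball|exact/C_bump/open_norm_ball|exact: Ch].
pose B := mkCinf sb; pose Hh i := mkCinf (sh i).
have By : B y = 1 by rewrite /= ext0E// /b bump1// subrr normr0 ltW.
(* Applying [X] at [y], the derivatives of the cutoffs and of the [Hh i] disappear, since [f - f y]
   and [coordf i - p 0 i] vanish there and [B y = 1]. *)
have E : B * (B * (f - f y *: (1 : C^oo M))) =
    \sum_i (B * (coordf i - p 0 i *: (1 : C^oo M))) * Hh i.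
  apply/Cinf_eq => x; rewrite Cinf_sumE !CinfE.
  have [ax|nax] := pselect (dom a x); last first.
    have -> : B x = 0 by rewrite /= /ext0 asboolF.
    by rewrite !mul0r big1// => i _; rewrite !CinfE /= /ext0 asboolF// mulr0.
  have [bx|bx] := eqVneq (B x) 0.
    by rewrite bx mul0r big1// => i _; rewrite !CinfE bx !mul0r.
  have xp : `|coord a x - p| < rho.
    apply: lt_trans _ r2; rewrite ltNge; apply/negP => /b0 H.
    by move: bx; rewrite /= ext0E// H eqxx.
  have -> : f x = f y + \sum_i (coord a x 0 i - p 0 i) * h i (coord a x).
    by have := uE _ xp; rewrite /= !coordK.
  rewrite mulr1 [X in _ * (_ * X)]addrC addKr mulr_sumr mulr_sumr; apply: eq_bigr => i _.
  rewrite !CinfE coordfE//; last exact/ltW/Vr.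
  by rewrite /= !ext0E//; ring.
have /(congr1 (fun g : C^oo M => X g y)) := E.
rewrite derivation_sum Cinf_sumE !derivationM derivationB derivationZ derivation1.
rewrite !CinfE By !mulr1 subrr !mulr0 !add0r !mul1r subr0 => ->.
apply: eq_bigr => i _.
rewrite !derivationM derivationB derivationZ derivation1 !CinfE By coordfE ?ltW//.
rewrite -/p mulr1 subrr !mulr0 !mul0r subr0 addr0 add0r mul1r.
by rewrite /= ext0E// -/p hp /b bump1 ?subrr ?normr0 ?ltW// mul1r.
Qed.

Lemma smooth_partial i f :
  smooth (ext0 a (fun z => bump c (r / 2) z * 'D_(delta_mx 0 i) (f \o param a) z)).
Proof.
apply: (@smooth_ext0 a c r (3 * r)) => //.
- by rewrite ltr_pMl// ltr1n.
- move=> k; apply: Ck_onM; [exact: open_norm_ball|exact/C_bump/open_norm_ball|].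
  have [_ /(_ i)[_ C]] := Cinf_smooth f a k.+1.
  by apply: Ck_on_sub C => z; exact: subc.
- by move=> z zr; rewrite bump0 ?mul0r ?divr_gt0// mulrC divfK.
Qed.

Lemma partial_derivation i : (fun f => mkCinf (smooth_partial i f)) \in @derivation_pred R n M.
Proof.
have d f y : dom a y -> derivable (f \o param a) (coord a y) (delta_mx 0 i).
  move=> ay; have [_ /(_ i)[D _]] := Cinf_smooth f a 1%N; apply: D; exact: cod_coord.
apply/asboolP; split=> [k|] f g; apply/Cinf_eq => y; rewrite !CinfE /= /ext0;
    case: asboolP => [ay|_]; rewrite ?mul0r ?mulr0 ?addr0//.
  have -> : (k *: f + g) \o param a = k *: (f \o param a : 'rV[R]_n -> R^o) + (g \o param a).
    by [].
  rewrite deriveD ?deriveZ; [|exact: d|by apply: derivableZ; exact: d|exact: d].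
  by rewrite /GRing.scale/=; ring.
have -> : (f * g) \o param a = (f \o param a) * (g \o param a).
  by [].
rewrite deriveM; [|exact: d|exact: d].
by rewrite /GRing.scale/= !coordK//; ring.
Qed.
Definition partialv i : Vect M := MkVfield (partial_derivation i).

Lemma boxf_derivation X f : boxf * X f = \sum_i X (coordf i) * partialv i f.
Proof.
apply/Cinf_eq => y; rewrite Cinf_sumE CinfE.
have [by0|by0] := eqVneq (boxf y) 0.
  rewrite by0 mul0r big1// => i _; rewrite CinfE /=; move: by0; rewrite /= /ext0.
  by case: asboolP => [ay ->|_ _]; rewrite ?mul0r mulr0.
have [ay yr] := boxf_neq0 by0.
rewrite (derivation_local X f ay yr) mulr_sumr; apply: eq_bigr => i _.
by rewrite CinfE /= !ext0E//; ring.
Qed.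

Lemma partialvE i f y : dom a y -> `|coord a y - c| <= r / 2 ->
  partialv i f y = 'D_(delta_mx 0 i) (f \o param a) (coord a y).
Proof. by move=> ay yr; rewrite /= ext0E// bump1 ?divr_gt0// mul1r. Qed.

End Box.

Lemma smoothV (f : M -> R) : smooth f -> (forall x, f x != 0) -> smooth (fun x => (f x)^-1).
Proof.
move=> sf f0 a k; have := @Ck_onV R n k (cod a) (f \o param a) (@open_cod a).
by apply=> [y _|]; [exact: f0|exact: sf].
Qed.

(* A finite global frame (E_k) whose coefficients are the X(x_k): the module of
   vector fields is finitely generated projective. *)
Lemma dual_basis : compact [set: M] ->
  exists (N : nat) (x_ : 'I_N -> C^oo M) (E : 'I_N -> Vect M),
    forall X f, X f = \sum_k X (x_ k) * E k f.
Proof.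
move=> cM.
have box x : exists ar : chart M * R, [/\ dom ar.1 x, 0 < ar.2 &
    forall z, `|z - coord ar.1 x| < 3 * ar.2 -> cod ar.1 z].
  have [a ax] := chart_cover x; have [r r0 sr] := exists_box ax.
  by exists (a, r).
pose ar x := sval (cid (box x)).
have ar1 x : dom (ar x).1 x by rewrite /ar; case: cid => ? [].
have ar2 x : 0 < (ar x).2 by rewrite /ar; case: cid => ? [].
have ar3 x : forall z, `|z - coord (ar x).1 x| < 3 * (ar x).2 -> cod (ar x).1 z.
  by rewrite /ar; case: cid => ? [].
pose bx x := boxf (ar2 x) (ar3 x).
have [D covD] : exists D : seq M, forall y, exists2 x, x \in D & 0 < bx x y.
  (* The filter of all sufficiently long finite lists, ordered by inclusion; with it the
     near-covering form of compactness returns a finite list of boxes covering [M]. *)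
  pose F : set_system (seq M) := [set P : set (seq M) | exists D : seq M,
    forall D' : seq M, {subset D <= D'} -> P D'].
  have FF : Filter F.
    split=> [|P Q [D DP] [D' DQ]|P Q PQ [D DP]]; first by exists [::].
      by exists (D ++ D') => E sE; split; [apply: DP|apply: DQ] => x xD; apply: sE;
        rewrite mem_cat xD ?orbT.
    by exists D => E sE; apply/PQ/DP.
  have /compact_near_coveringP/(_ _ F (fun D y => exists2 x, x \in D & 0 < bx x y) FF) := cM.
  case=> [y _|D DP]; last first.
    by exists D => y; exact: (DP D).
  have by0 : 0 < bx y y.
    by apply: boxf_gt0; [exact: ar1|rewrite subrr normr0 divr_gt0].
  have cb := smooth_continuous (Cinf_smooth (bx y)) (x := y).
  exists ([set z : M | 0 < bx y z], [set E : seq M | y \in E]) => /=.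
    split; first exact: cb _ (lt_nbhsr by0).
    by exists [:: y] => E; apply; rewrite mem_head.
  by move=> [z E] [/= bz yE]; exists y.
pose s := in_tuple D; pose m := size D.
pose S : C^oo M := \sum_(j < m) bx (tnth s j).
have S0 x : S x != 0.
  have [z zD zx] := covD x.
  have /tnthP[j jz] : z \in s by [].
  rewrite gt_eqF// Cinf_sumE (bigD1 j)//= -jz ltr_pwDl//.
  by apply: sumr_ge0 => k _; exact: (boxf_ge0 (ar2 (tnth s k)) (ar3 (tnth s k))).
(* Division by [S] makes a partition of unity. The factor [V] goes into the fields [E'], not into
   the functions [x'], so it is never differentiated. *)
pose V := mkCinf (smoothV (Cinf_smooth S) S0).
pose K : finType := ('I_m * 'I_n)%type.
pose x' (k : K) := coordf (ar2 (tnth s k.1)) (ar3 (tnth s k.1)) k.2.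
pose E' (k : K) := V *: partialv (ar2 (tnth s k.1)) (ar3 (tnth s k.1)) k.2.
exists #|K|, (x' \o enum_val), (E' \o enum_val) => X f.
rewrite -(big_enum_val (A := K) (fun k => X (x' k) * E' k f)).
have -> : \sum_(k in K) X (x' k) * E' k f = V * \sum_(j < m) bx (tnth s j) * X f.
  rewrite mulr_sumr (eq_bigl xpredT)//.
  transitivity (\sum_(j < m) \sum_(i < n) X (x' (j, i)) * E' (j, i) f).
    by rewrite pair_big; apply: eq_bigr => -[].
  apply: eq_bigr => j _; rewrite boxf_derivation mulr_sumr; apply: eq_bigr => i _.
  by rewrite mulrCA.
apply/Cinf_eq => y; rewrite -mulr_suml mulrA CinfME [(V * _) y]CinfME /=.
by rewrite mulVf ?mul1r.
Qed.

End Charts.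

(** * Smooth families of functions *)

Section DeriveReal.
Context {R : realType}.
Implicit Types (f g : R -> R) (t : R).

Lemma is_derive_bigsum (I : Type) (r : seq I) (P : pred I) (h : I -> R -> R) (dh : I -> R) t :
  (forall i, is_derive t (1 : R) (h i) (dh i)) ->
  is_derive t (1 : R) (fun s => \sum_(i <- r | P i) h i s) (\sum_(i <- r | P i) dh i).
Proof.
move=> H; elim: r => [|i r IH].
  have -> : (fun s => \sum_(i <- [::] | P i) h i s) = cst 0.
    by apply/funext => s; rewrite big_nil.
  by rewrite big_nil; exact: is_derive_cst.
have -> : (fun s => \sum_(i <- i :: r | P i) h i s) = (fun s =>
   if P i then h i s + \sum_(i <- r | P i) h i s else \sum_(i <- r | P i) h i s).
  by apply/funext => s; rewrite big_cons.
by rewrite big_cons; case: (P i) => //; exact: is_deriveD.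
Qed.

Lemma is_derive_mul f g df dg t : is_derive t (1 : R) f df -> is_derive t (1 : R) g dg ->
  is_derive t (1 : R) (fun s => f s * g s) (df * g t + f t * dg).
Proof.
move=> H1 H2; apply: is_derive_eq (is_deriveM H1 H2) _.
by rewrite /GRing.scale/=; ring.
Qed.

Lemma is_derive_mulc c f df t : is_derive t (1 : R) f df ->
  is_derive t (1 : R) (fun s => c * f s) (c * df).
Proof. by move=> H; apply: is_derive_eq (is_derive_mul (is_derive_cst c t 1) H) _; rewrite mul0r add0r. Qed.

Lemma is_derive_uniq f d d' t : is_derive t (1 : R) f d -> is_derive t (1 : R) f d' -> d = d'.
Proof. by move=> [_ <-] [_ <-]. Qed.

End DeriveReal.

Lemma cvg_to_pair (T : Type) (U V : topologicalType) (F : set_system T) {FF : Filter F}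
  (f : T -> U) (g : T -> V) (u : U) (v : V) :
  f @ F --> u -> g @ F --> v -> (f x, g x) @[x --> F] --> (u, v).
Proof.
move=> fu gv P [[A B] /= [Au Bv] AB].
by apply: (@filterS2 _ F _ _ _ _ _ (fu _ Au) (gv _ Bv)) => x Ax Bx; exact: AB.
Qed.

Section Families.
Context {R : realType} {n : nat} {M : manifold R n} (T : set R).
Hypothesis openT : open T.
Implicit Types (u v : R -> M -> R) (X Y : Vect M).

Let tx t (y : 'rV[R]_n) : 'rV[R]_(1 + n) := row_mx (const_mx t) y.
Let Dm (a : chart M) := [set z : 'rV[R]_(1 + n) | T (lsubmx z 0 0) /\ cod a (rsubmx z)].
Let loc u a (z : 'rV[R]_(1 + n)) := u (lsubmx z 0 0) (param a (rsubmx z)).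

Let txE z : z = tx (lsubmx z 0 0) (rsubmx z).
Proof. by rewrite -{1}[z]hsubmxK /tx; congr row_mx; apply/rowP => i; rewrite !mxE !ord1. Qed.

Let locE u a t y : loc u a (tx t y) = u t (param a y).
Proof. by rewrite /loc /tx row_mxKl row_mxKr mxE. Qed.

Let l_cont : continuous (fun z : 'rV[R]_(1 + n) => lsubmx z 0 0).
Proof.
have -> : (fun z : 'rV[R]_(1 + n) => lsubmx z 0 0) = (fun z => z 0 (lshift n 0)).
  by apply/funext => z; rewrite mxE.
exact: continuous_coord.
Qed.

Let r_cont : continuous (fun z : 'rV[R]_(1 + n) => rsubmx z).
Proof.
move=> z; apply: (@cvg_rowP R n _ (nbhs z)) => j.
have -> : (fun x : 'rV[R]_(1 + n) => rsubmx x 0 j) = (fun z => z 0 (rshift 1 j)).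
  by apply/funext => w; rewrite mxE.
by rewrite mxE; exact: continuous_coord.
Qed.

Let open_Dm a : open (Dm a).
Proof.
rewrite openE => z [Tz cz].
have H1 : \forall w \near z, T (lsubmx w 0 0) by exact: l_cont (near_open openT Tz).
have H2 : \forall w \near z, cod a (rsubmx w) by exact: r_cont (near_open (@open_cod _ _ _ a) cz).
by apply: filterS2 H1 H2 => w; split.
Qed.

Lemma fam_ext u v : (forall t x, T t -> u t x = v t x) ->
  smooth_family T u -> smooth_family T v.
Proof.
by move=> uv su a k; apply: (Ck_on_ext (@open_Dm a) _ (su a k)) => z /set_mem [Tz _]; exact: uv.
Qed.

Lemma famD u v : smooth_family T u -> smooth_family T v ->
  smooth_family T (fun t x => u t x + v t x).
Proof. by move=> su sv a k; exact: Ck_onD (@open_Dm a) (su a k) (sv a k). Qed.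

Lemma famM u v : smooth_family T u -> smooth_family T v ->
  smooth_family T (fun t x => u t x * v t x).
Proof. by move=> su sv a k; exact: Ck_onM (@open_Dm a) (su a k) (sv a k). Qed.

Lemma famV u : smooth_family T u -> (forall t x, T t -> u t x != 0) ->
  smooth_family T (fun t x => (u t x)^-1).
Proof.
move=> su u0 a k; apply: (Ck_onV (@open_Dm a) _ (su a k)) => z [Tz _]; exact: u0.
Qed.

Lemma fam_smooth (f : M -> R) : smooth f -> smooth_family T (fun _ x => f x).
Proof.
move=> sf a k; apply: (@Ck_on_comp R _ _ k (Dm a) (cod a) (f \o param a)
   (fun z => rsubmx z)) => //.
- exact: open_cod.
- by move=> z [].
- move=> j; apply: Ck_on_ext (Ck_on_coord k (rshift 1 j) (@open_Dm a)) => // z _.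
  by rewrite mxE.
- exact: sf.
Qed.

Lemma fam_cst c : smooth_family T (fun _ (_ : M) => c).
Proof. exact: (fam_smooth (smooth_cst c)). Qed.

Lemma fam_sum (I : Type) (r : seq I) (P : pred I) (u : I -> R -> M -> R) :
  (forall i, smooth_family T (u i)) -> smooth_family T (fun t x => \sum_(i <- r | P i) u i t x).
Proof.
by move=> su a k; apply: (Ck_on_sum r (@open_Dm a)) => i _; exact: su.
Qed.

Lemma fam_prod (I : Type) (r : seq I) (P : pred I) (u : I -> R -> M -> R) :
  (forall i, smooth_family T (u i)) -> smooth_family T (fun t x => \prod_(i <- r | P i) u i t x).
Proof.
by move=> su a k; apply: (Ck_on_prod r (@open_Dm a)) => i _; exact: su.
Qed.

Lemma fam_det m (A : 'I_m -> 'I_m -> R -> M -> R) : (forall i j, smooth_family T (A i j)) ->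
  smooth_family T (fun t x => \det (\matrix_(i, j) A i j t x)).
Proof.
move=> sA; rewrite /determinant; apply: fam_sum => s; apply: famM; first exact: fam_cst.
have H (p : 'I_m -> 'I_m) :
    smooth_family T (fun t x => \prod_i (\matrix_(i, j) A i j t x) i (p i)).
  apply: (@fam_ext (fun t x => \prod_i A i (p i) t x)); last exact: fam_prod.
  by move=> t x _; apply: eq_bigr => i _; rewrite mxE.
exact: H.
Qed.

Lemma fam_adj m (A : 'I_m -> 'I_m -> R -> M -> R) i j : (forall i j, smooth_family T (A i j)) ->
  smooth_family T (fun t x => (\adj (\matrix_(i, j) A i j t x)) i j).
Proof.
move=> sA; apply: (@fam_ext (fun t x => (-1) ^+ (j + i) *
   \det (\matrix_(k, l) A (lift j k) (lift i l) t x))) => [t x _|].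
  rewrite mxE /cofactor; congr (_ * \det _); apply/matrixP => k l; rewrite !mxE//.
by apply: famM; [exact: fam_cst|exact: fam_det].
Qed.

Let line_t t y s : tx t y + s *: delta_mx 0 (lshift n 0) = tx (t + s) y.
Proof.
apply/rowP => k; rewrite !mxE; case: (splitP k) => j kj.
  rewrite !mxE eqxx/=; have -> : k == lshift n 0 by apply/eqP/val_inj; rewrite /= kj ord1.
  by rewrite mulr1.
have -> : k == lshift n 0 = false by apply/eqP => /(congr1 val); rewrite /= kj.
by rewrite andbF mulr0 addr0.
Qed.

Let line_x t y s i : tx t y + s *: delta_mx 0 (rshift 1 i) = tx t (y + s *: delta_mx 0 i).
Proof.
apply/rowP => k; rewrite !mxE; case: (splitP k) => j kj.
  rewrite !mxE eqxx/=; have -> : k == rshift 1 i = false.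
    by apply/eqP => /(congr1 val)/= H; move: (ltn_ord j); rewrite -kj H.
  by rewrite mulr0 addr0.
rewrite !mxE eqxx/=; have -> // : (k == rshift 1 i) = (j == i).
by rewrite -val_eqE/= kj -[RHS]val_eqE/= eqn_add2l.
Qed.

Lemma fam_derivable u t x : smooth_family T u -> T t -> derivable (u^~ x) t 1.
Proof.
move=> su Tt; have [a ax] := chart_cover x.
have [_ /(_ (lshift n 0))[d _]] := su a 1%N.
have Dtx : Dm a (tx t (coord a x)).
  by rewrite /Dm/= row_mxKl row_mxKr mxE; split=> //; exact: cod_coord.
have /derivableP/derivable_lineP := d _ Dtx.
have -> : (fun r : R => loc u a (tx t (coord a x) + r *: delta_mx 0 (lshift n 0))) =
   (fun r => u (t + r) x).
  by apply/funext => r; rewrite line_t locE coordK.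
move=> /is_deriveP H.
suff [] : is_derive t (1 : R) (u^~ x)
  ('D_(delta_mx 0 (lshift n 0)) (loc u a) (tx t (coord a x))) by [].
apply/is_deriveP => e e0; apply: filterS (H e e0) => h.
by rewrite add0r addr0.
Qed.

Lemma fam_dt u v : smooth_family T u ->
  (forall t x, T t -> is_derive t 1 (u^~ x) (v t x)) -> smooth_family T v.
Proof.
move=> su du a k; have [_ /(_ (lshift n 0))[d C]] := su a k.+1.
apply: (Ck_on_ext (@open_Dm a) _ C) => z /set_mem Dz.
have /derivableP/derivable_lineP := d z Dz.
have [Tz cz] := Dz.
rewrite -/(loc u a).
have -> : (fun r : R => loc u a (z + r *: delta_mx 0 (lshift n 0))) =
   (fun r => u (lsubmx z 0 0 + r) (param a (rsubmx z))).
  by apply/funext => r; rewrite {1}[z]txE line_t locE.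
move=> /is_deriveP H.
have H' : is_derive (lsubmx z 0 0) (1 : R) (u^~ (param a (rsubmx z)))
    ('D_(delta_mx 0 (lshift n 0)) (loc u a) z).
  apply/is_deriveP => e e0; apply: filterS (H e e0) => h.
  by rewrite add0r addr0.
by have [_ <-] := du _ (param a (rsubmx z)) Tz; have [_ ->] := H'.
Qed.

Let tx_cont t y : tx p.1 p.2 @[p --> (t, y)] --> tx t y.
Proof.
apply: (@cvg_rowP R _ _ (nbhs (t, y))) => k.
case: (split_ordP k) => j ->.
  have -> : (fun p : R * 'rV[R]_n => tx p.1 p.2 0 (lshift n j)) = fst.
    by apply/funext => p; rewrite row_mxEl mxE.
  by rewrite row_mxEl mxE; exact: cvg_fst.
have -> : (fun p : R * 'rV[R]_n => tx p.1 p.2 0 (rshift 1 j)) =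
    (fun w : 'rV[R]_n => w 0 j) \o snd.
  by apply/funext => p; rewrite row_mxEr.
rewrite row_mxEr.
apply: (cvg_comp _ _ (@cvg_snd _ _ (nbhs t) (nbhs y) _)); exact: continuous_coord.
Qed.

Lemma fam_cont u t x : smooth_family T u -> T t ->
  {for (t, x), continuous (fun p : R * M => u p.1 p.2)}.
Proof.
move=> su Tt; have [a ax] := chart_cover x.
have Dtx : Dm a (tx t (coord a x)).
  by rewrite /Dm/= row_mxKl row_mxKr mxE; split=> //; exact: cod_coord.
have C := Ck_on_cont (su a 0%N) Dtx.
have C2 : (fun p : R * M => (p.1, coord a p.2)) @ (t, x) --> (t, coord a x).
  apply: (@cvg_to_pair _ _ _ (nbhs (t, x)) _ fst); first exact: cvg_fst.
  exact: (cvg_comp _ _ (@cvg_snd _ _ (nbhs t) (nbhs x) _) (coord_continuous ax)).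
have C3 := cvg_comp _ _ C2 (@tx_cont t (coord a x)).
have C4 := cvg_comp _ _ C3 C.
apply/continuous_forP => e e0.
have Nd : \forall p \near (t, x), dom a p.2.
  exact: (@cvg_snd _ _ (nbhs t) (nbhs x) _ _ (near_dom ax)).
have H : \forall p \near (t, x), `|loc u a (tx t (coord a x)) -
    loc u a (tx p.1 (coord a p.2))| <= e.
  exact: (@cvgrPdist_le _ _ _ (nbhs (t, x)) _ _ _).1 C4 e e0.
by apply: filterS2 Nd H => p ap; rewrite !locE !coordK.
Qed.

(** In a box, [X (u t)] is a combination of space derivatives of [u t] with coefficients independent
    of t, and these are partial derivatives of the joint function of (t, y), at the shifted indices
    [rshift 1 i]. *)
Lemma fam_vfield X (u : R -> C^oo M) : smooth_family T u -> smooth_family T (fun t => X (u t)).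
Proof.
move=> su b k; apply: Ck_on_local => z0 [Tz cz].
have [bx yE] := paramK cz.
have [r r0 sr] := exists_box bx; rewrite yE in sr.
pose U := [set z : 'rV[R]_(1 + n) | Dm b z /\ `|rsubmx z - rsubmx z0| < r].
have oU : open U.
  rewrite openE => z [Dz zr].
  have H1 := near_open (@open_Dm b) Dz.
  have H2 : \forall w \near z, `|rsubmx w - rsubmx z0| < r.
    exact: r_cont (near_open (@open_norm_ball R n (rsubmx z0) r) zr).
  exact: filterS2 H1 H2.
exists U; split=> //; first by split=> //; rewrite subrr normr0.
pose g z := \sum_i (X (coordf r0 sr i)) (param b (rsubmx z)) *
  'D_(delta_mx 0 (rshift 1 i)) (loc u b) z.
have UD : U `<=` Dm b by move=> z [].
apply: (@Ck_on_ext _ _ k U g) => // [z /set_mem [[Tz' cz'] zr]|].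
  have [dx xE] := paramK cz'.
  rewrite /g (derivation_local (c := rsubmx z0) r0 sr)//; last by rewrite xE.
  apply: eq_bigr => i _; congr (_ * _); rewrite xE.
  rewrite {1}[z]txE /derive; apply: congr1.
  have -> : (fun h : R => h^-1 *: ((loc u b \o shift (tx (lsubmx z 0 0) (rsubmx z)))
       (h *: delta_mx 0 (rshift 1 i)) - loc u b (tx (lsubmx z 0 0) (rsubmx z)))) =
    (fun h : R => h^-1 *: (((u (lsubmx z 0 0) \o param b) \o shift (rsubmx z))
       (h *: delta_mx 0 i) - (u (lsubmx z 0 0) \o param b) (rsubmx z))) => //.
  apply/funext => h /=.
  by rewrite [h *: _ + tx _ _]addrC line_x !locE [h *: _ + rsubmx z]addrC.
apply: Ck_on_sum => // i _; apply: Ck_onM => //.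
  apply: Ck_on_sub UD _; exact: (fam_smooth (Cinf_smooth _) b k).
have [_ /(_ (rshift 1 i))[_ C]] := su b k.+1.
exact: Ck_on_sub C.
Qed.

(* Schwarz' theorem: the time derivative commutes with X as soon as the time
   derivative g is smooth in space with jointly continuous space derivatives. *)
Lemma derive_vfield_comm X (u g : R -> C^oo M) t x :
  (forall t x, T t -> is_derive t 1 (fun s => u s x) (g t x)) ->
  (forall Y t x, T t -> {for (t, x), continuous (fun p : R * M => Y (g p.1) p.2)}) ->
  T t -> is_derive t 1 (fun s => X (u s) x) (X (g t) x).
Proof.
move=> ug cg Tt; have [a ax] := chart_cover x.
have [r r0 sr] := exists_box ax; set p0 := coord a x in sr.
have xr : `|coord a x - p0| < r by rewrite /p0 subrr normr0.
have E (f : C^oo M) : X f x = \sum_i X (coordf r0 sr i) x * 'D_(delta_mx 0 i) (f \o param a) p0.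
  exact: derivation_local.
rewrite E.
have -> : (fun s => X (u s) x) = (fun s => \sum_i X (coordf r0 sr i) x *
    'D_(delta_mx 0 i) (u s \o param a) p0) by apply/funext => s; exact: E.
apply: is_derive_bigsum => i; apply: is_derive_mulc.
have pc (z : R) : `|z| < r -> cod a (p0 + z *: delta_mx 0 i).
  move=> zr; have := sr (p0 + z *: delta_mx 0 i); apply; rewrite addrC addKr normrZ.
  have : `|z| * `|delta_mx 0 i : 'rV[R]_n| <= `|z|.
    rewrite ler_piMr//; apply: norm_le_coord => // l.
    by rewrite mxE; case: (_ && _); rewrite ?normr1 ?normr0.
  move=> /le_lt_trans; apply; apply: lt_trans zr _.
  by rewrite ltr_pMl// ltr1n.
have [d1 d10 Td] : exists2 d : R, 0 < d & forall s, `|s - t| < d -> T s.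
  have /nbhs_ballP[d d0 Bd] := near_open openT Tt.
  by exists d => // s sd; apply: Bd; rewrite -ball_normE /ball_/= distrC.
have dd (f : C^oo M) (z : R) : `|z| < r ->
    is_derive z (1 : R) (fun s => f (param a (p0 + s *: delta_mx 0 i)))
      ('D_(delta_mx 0 i) (f \o param a) (p0 + z *: delta_mx 0 i)).
  move=> zr; apply: (@is_derive_line R n (f \o param a)).
  by have [_ /(_ i)[d _]] := Cinf_smooth f a 1%N; apply: d; exact: pc.
pose q s z := 'D_(delta_mx 0 i) (g s \o param a) (p0 + z *: delta_mx 0 i).
have := @Schwarz_derive R (fun s z => u s (param a (p0 + z *: delta_mx 0 i)))
  (fun s z => g s (param a (p0 + z *: delta_mx 0 i))) q
  (fun s => 'D_(delta_mx 0 i) (u s \o param a) p0) t 0 (Num.min d1 r).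
have q0 : q t 0 = 'D_(delta_mx 0 i) (g t \o param a) p0 by rewrite /q scale0r addr0.
rewrite q0.
apply; first by rewrite lt_min d10.
- move=> s z; rewrite subr0 !lt_min => /andP[sd _] /andP[_ zr]; split.
  + by apply: ug; exact: Td.
  + have -> : 'D_(delta_mx 0 i) (u s \o param a) p0 =
       'D_(delta_mx 0 i) (u s \o param a) (p0 + 0 *: delta_mx 0 i) by rewrite scale0r addr0.
    by apply: dd; rewrite normr0.
  + exact: dd.
move=> e e0.
(* The continuity hypothesis concerns global fields. Within radius [r / 2] the cutoff in [partialv]
   is 1, so the partial derivative [q] is the value of such a field. *)
have qE (s z : R) : `|z| < r / 2 -> q s z =
    partialv r0 sr i (g s) (param a (p0 + z *: delta_mx 0 i)).
  move=> zr; have zr' : `|z| < r.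
    by apply: lt_trans zr _; rewrite ltr_pdivrMr// ltr_pMr// ltr1n.
  have [az azE] := paramK (pc z zr').
  rewrite partialvE// azE// addrC addKr normrZ; apply: le_trans (ltW zr).
  rewrite ler_piMr//; apply: norm_le_coord => // l.
  by rewrite mxE; case: (_ && _); rewrite ?normr1 ?normr0.
have r2 : 0 < r / 2 by rewrite divr_gt0.
have C0 := cg (partialv r0 sr i) t x Tt.
have xE : x = param a (p0 + 0 *: delta_mx 0 i) by rewrite scale0r addr0 coordK.
have C1 : param a (p0 + z *: delta_mx 0 i) @[z --> (0 : R)] --> x.
  rewrite [X in _ --> X]xE.
  have Cl : (p0 + z *: delta_mx 0 i : 'rV[R]_n) @[z --> (0 : R)] --> p0 + 0 *: delta_mx 0 i.
    by apply: cvgD; [exact: cvg_cst|apply: cvgZr_tmp].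
  apply: (cvg_comp _ _ Cl); apply: param_continuous; apply: pc.
  by rewrite normr0.
have C2 : (fun p : R * R => (p.1, param a (p0 + p.2 *: delta_mx 0 i))) @ (t, 0 : R) --> (t, x).
  apply: (@cvg_to_pair _ _ _ (nbhs (t, 0 : R)) _ fst); first exact: cvg_fst.
  exact: (cvg_comp _ _ (@cvg_snd _ _ (nbhs t) (nbhs (0 : R)) _) C1).
have C3 := cvg_comp _ _ C2 C0.
have [d dp Bd] := (nbhs_ballP (t, 0 : R) _).1
  ((@cvgrPdist_le _ _ _ (nbhs (t, 0 : R)) _ _ _).1 C3 e e0).
exists (Num.min d (r / 2)); first by rewrite lt_min dp.
move=> s z; rewrite subr0 !lt_min => /andP[sd _] /andP[zd zr].
rewrite -q0 qE// qE ?normr0// distrC -xE; apply: (Bd (s, z)).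
by split; rewrite /= -ball_normE /ball_/= ?sub0r ?normrN// distrC.
Qed.

Lemma derive_vfield_fam X (u g : R -> C^oo M) t x :
  smooth_family T u -> (forall t x, T t -> is_derive t 1 (fun s => u s x) (g t x)) ->
  T t -> is_derive t 1 (fun s => X (u s) x) (X (g t) x).
Proof.
move=> su ug; apply: derive_vfield_comm => // Y {}t {}x Tt.
apply: (@fam_cont (fun t => Y (g t)) t x _ Tt); apply: fam_vfield.
exact: fam_dt su ug.
Qed.

(** The sets where a [boxf] is positive form arbitrarily small neighbourhoods of a point, so testing
    on smooth functions detects continuity of a map into [M]. *)
Lemma flow_cont (h : R -> M -> M) :
  (forall f : C^oo M, smooth_family T (fun t x => f (h t x))) ->
  forall t x, T t -> {for (t, x), continuous (fun p : R * M => h p.1 p.2)}.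
Proof.
move=> sh t x Tt P /near_ex_open[U [oU Uh UP]].
have [a ax] := chart_cover (h t x); have [r0 r00 sr0] := exists_box ax.
have : \forall z \near coord a (h t x), U (param a z).
  by apply: near_param; [exact: cod_coord|rewrite coordK//; exact: near_open oU Uh].
move=> /nbhs_ballP[e e0 Be].
pose r := Num.min r0 e.
have rp : 0 < r by rewrite lt_min r00.
have sr z : `|z - coord a (h t x)| < 3 * r -> cod a z.
  move=> zr; apply: sr0; apply: lt_le_trans zr _.
  by rewrite ler_pM2l// ge_min lexx.
have b0 : 0 < boxf rp sr (h t x) by apply: boxf_gt0; rewrite ?subrr ?normr0 ?divr_gt0.
have C := @fam_cont _ t x (sh (boxf rp sr)) Tt.
have N : \forall p \near (t, x), 0 < boxf rp sr (h p.1 p.2) by exact: C _ (lt_nbhsr b0).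
have : \forall p \near (t, x), P (h p.1 p.2); last by [].
apply: filterS N => p bp; apply: UP.
have [ap pr] : dom a (h p.1 p.2) /\ `|coord a (h p.1 p.2) - coord a (h t x)| < r.
  by apply: (boxf_neq0 (r0 := rp) (subc := sr)); rewrite gt_eqF.
rewrite -(coordK ap); apply: Be; rewrite -ball_normE /ball_/= distrC.
by apply: lt_le_trans pr _; rewrite ge_min lexx orbT.
Qed.

(** By [flow_cont] the images stay in one box for nearby (t, x); there the coordinates of [h t x]
    are the global functions [coordf] along [h], smooth by hypothesis, and the chain rule in charts
    applies. *)
Lemma fam_comp (u : R -> M -> R) (h : R -> M -> M) :
  (forall f : C^oo M, smooth_family T (fun t x => f (h t x))) ->
  smooth_family T u -> smooth_family T (fun t x => u t (h t x)).
Proof.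
move=> sh su a k; apply: Ck_on_local => z0 Dz0; have [Tz cz] := Dz0.
pose t0 := lsubmx z0 0 0; pose x0 := param a (rsubmx z0).
have [b bx] := chart_cover (h t0 x0); have [r r0 sr] := exists_box bx.
have Pc : (fun z => (lsubmx z 0 0, param a (rsubmx z))) @ z0 --> (t0, x0).
  apply: (@cvg_to_pair _ _ _ (nbhs z0) _ (fun z => lsubmx z 0 0)); first exact: l_cont.
  exact: (cvg_comp _ _ (@r_cont z0) (param_continuous cz)).
have N1 : \forall p \near (t0, x0), dom b (h p.1 p.2) /\
    `|coord b (h p.1 p.2) - coord b (h t0 x0)| < r.
  have c0 : `|coord b (h t0 x0) - coord b (h t0 x0)| < r by rewrite subrr normr0.
  have Ny : \forall y \near h t0 x0, dom b y /\ `|coord b y - coord b (h t0 x0)| < r.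
    have N2 := near_chart bx (near_open (@open_norm_ball R n (coord b (h t0 x0)) r) c0).
    by apply: filterS2 (near_dom bx) N2.
  have FC := @flow_cont h sh t0 x0 Tz.
  exact: FC _ Ny.
have [U [oU Uz UN]] := near_ex_open (@filterI _ (nbhs z0) _ _ _
  (near_open (@open_Dm a) Dz0) (Pc _ N1)).
exists U; split=> //.
pose G (z : 'rV[R]_(1 + n)) := tx (lsubmx z 0 0) (\row_j coordf r0 sr j (h (lsubmx z 0 0) (param a (rsubmx z)))).
have GE (z : 'rV[R]_(1 + n)) : U z -> G z = tx (lsubmx z 0 0) (coord b (h (lsubmx z 0 0) (param a (rsubmx z)))).
  move=> /UN[_ [bz zr]]; congr tx; apply/rowP => j; rewrite mxE coordfE//.
  exact: ltW.
have C : Ck_on k U (loc u b \o G).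
  apply: (Ck_on_comp oU (@open_Dm b)) (su b k) => [z Uz'|j].
    have [[Tz' _] [bz _]] := UN _ Uz'.
    by rewrite GE// /Dm/= row_mxKl row_mxKr mxE; split=> //; exact: cod_coord.
  case: (split_ordP j) => i ->.
    apply: (Ck_on_ext oU _ (Ck_on_coord k (lshift n i) oU)) => z _.
    by rewrite row_mxEl !mxE !ord1.
  have := sh (coordf r0 sr i) a k => Cs.
  have {}Cs := Ck_on_sub (fun z Uz' => (UN z Uz').1) Cs.
  by apply: (Ck_on_ext oU _ Cs) => z _; rewrite row_mxEr mxE.
apply: (Ck_on_ext oU _ C) => z /set_mem Uz'.
have [_ [bz _]] := UN _ Uz'.
by rewrite /comp GE// locE coordK.
Qed.

End Families.

(** * Isotopies *)

Section PositiveMatrix.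
Context {R : realType}.

Lemma posdef_det_neq0 N (Q : 'M[R]_N) :
  (forall u : 'rV[R]_N, \sum_l \sum_m u 0 l * Q l m * u 0 m = 0 -> u = 0) -> \det Q != 0.
Proof.
move=> H; apply/negP => /det0P[u u0 uQ]; move: u0; rewrite (H u) ?eqxx//.
rewrite exchange_big/= big1// => m _; rewrite -mulr_suml.
by have /rowP/(_ m) := uQ; rewrite !mxE => ->; rewrite mul0r.
Qed.

Lemma solve_adj N (Q : 'M[R]_N) (w b : 'rV[R]_N) : \det Q != 0 -> w *m Q = b ->
  forall l, w 0 l = (\sum_m b 0 m * (\adj Q) m l) * (\det Q)^-1.
Proof.
move=> d0 wQ l; have := congr1 (mulmx^~ (\adj Q)) wQ.
rewrite /= -mulmxA mul_mx_adj mul_mx_scalar => /rowP/(_ l).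
by rewrite !mxE => <-; rewrite mulrAC mulfV ?mul1r.
Qed.

Lemma sum_sqr_eq0 (I : finType) (a : I -> R) : \sum_i a i ^+ 2 = 0 -> forall i, a i = 0.
Proof.
move=> /eqP; rewrite psumr_eq0 => [/allP H i|i _]; last exact: sqr_ge0.
by have := H i (mem_index_enum i); rewrite /= sqrf_eq0 => /eqP.
Qed.

End PositiveMatrix.

Section PullPush.
Context {R : realType} {n : nat} {M : manifold R n}.
Variable Q : diffeo M.
Implicit Types (X : Vect M) (f : C^oo M).
Local Notation Qi := (diffeo_inv Q).

Lemma pull_invK f : pull Qi (pull Q f) = f.
Proof. by apply/Cinf_eq => x; rewrite /= dinvK. Qed.

Lemma pullK_inv f : pull Q (pull Qi f) = f.
Proof. by apply/Cinf_eq => x; rewrite /= dfunK. Qed.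

Lemma push_invfE X f : push Qi X f = pull Q (X (pull Qi f)).
Proof. exact/Cinf_eq. Qed.

Lemma pushfE X f : push Q X f = pull Qi (X (pull Q f)).
Proof. by []. Qed.

End PullPush.

(** * Time regularity of pullbacks along an isotopy *)

Section Flows.
Context {R : realType} {n : nat} {M : manifold R n} (T : set R).
Hypothesis openT : open T.
Hypothesis cptM : compact [set: M].
Variables (N : nat) (x_ : 'I_N -> C^oo M) (E : 'I_N -> Vect M).
Hypothesis dualE : forall (X : Vect M) (f : C^oo M), X f = \sum_k X (x_ k) * E k f.
Variables (Z : R -> Vect M) (Phi : R -> diffeo M).
Hypothesis isoP : isotopy_of T Z Phi.
Implicit Types (X Y V W : Vect M) (f g h : C^oo M).

Lemma dualEx X f x : X f x = \sum_k X (x_ k) x * E k f x.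
Proof. by rewrite {1}dualE Cinf_sumE. Qed.

Lemma iso_fam f : smooth_family T (fun t x => f (Phi t x)).
Proof. by have [_ + _] := isoP; exact. Qed.

Lemma iso_derive f t x : T t -> is_derive t 1 (fun s => f (Phi s x)) (Z t f (Phi t x)).
Proof. by have [_ _ +] := isoP; exact. Qed.

Lemma iso_cont t x : T t -> {for (t, x), continuous (fun p : R * M => Phi p.1 p.2)}.
Proof. by move=> Tt; exact: (@flow_cont _ _ _ T (fun t x => Phi t x) iso_fam t x Tt). Qed.

(** A tube argument. Off a neighbourhood of the preimage of [y] the points form a compact set on
    which [Phi t] avoids [y]; by separation and joint continuity [Phi s] still avoids [w] there for
    (s, w) near (t, y), so the preimage of [w] stays in the neighbourhood. *)
Lemma iso_inv_cont t y : T t -> {for (t, y), continuous (fun p : R * M => dinv (Phi p.1) p.2)}.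
Proof.
move=> Tt P /near_ex_open[U [oU Ux UP]].
have cK : compact (~` U).
  apply: (subclosed_compact _ cptM) => //; exact: open_closedC.
have /compact_near_coveringP K := cK.
have H : forall z, (~` U) z -> \forall z' \near z & q \near (t, y), Phi q.1 z' != q.2.
  move=> z nUz.
  have zy : Phi t z != y.
    by apply/eqP => zy; apply: nUz; move: Ux; rewrite /= -zy dfunK.
  have := @hausdorff_carrier _ _ M; rewrite open_hausdorff => /(_ _ _ zy)[[A B]/=].
  rewrite !inE => -[Az By] [oA oB AB].
  have Nz := @iso_cont t z Tt _ (near_open oA Az).
  have [[S S'] /= [NS NS'] SS] := Nz.
  exists (S', S `*` B) => /=.
    by split=> //; exists (S, B) => //=; split=> //; exact: near_open.
  move=> [z' [s w]] /= [S'z [Ss Bw]]; apply/eqP => zw.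
  have : (A `&` B) w by split=> //; rewrite -zw; exact: (SS (s, z')).
  by rewrite AB.
have Hn := K _ (nbhs (t, y)) (fun q z => Phi q.1 z != q.2) (nbhs_filter _) H.
have : \forall q \near (t, y), P (dinv (Phi q.1) q.2); last by [].
apply: filterS Hn => q Kq; apply: UP; apply: contrapT => /Kq.
by rewrite dinvK eqxx.
Qed.

Definition pullv t V : Vect M := push (diffeo_inv (Phi t)) V.

Lemma pullvE t V f x : pullv t V f x = V (pull (diffeo_inv (Phi t)) f) (Phi t x).
Proof. by []. Qed.

Lemma pullv_pull t V f : pullv t V (pull (Phi t) f) = pull (Phi t) (V f).
Proof. by apply/Cinf_eq => x; rewrite pullvE pull_invK. Qed.

Lemma pushE t V f x : push (Phi t) V f x = V (pull (Phi t) f) (dinv (Phi t) x).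
Proof. by []. Qed.

(** Pushing [V] to [Phi t x] turns the functions [pull (Phi t) (x_ k)] into the [x_ k]; as [Phi t]
    is a diffeomorphism, the former also separate tangent vectors. *)
Lemma vfield_eq0_pull t x V : (forall k, V (pull (Phi t) (x_ k)) x = 0) -> forall f, V f x = 0.
Proof.
move=> V0 f; have -> : V f x = push (Phi t) V (pull (diffeo_inv (Phi t)) f) (Phi t x).
  by rewrite pushE dfunK pullK_inv.
rewrite dualEx big1// => k _; rewrite pushE dfunK V0 mul0r//.
Qed.

Let fam_pull f : smooth_family T (fun t => pull (Phi t) f).
Proof. exact: iso_fam. Qed.

(* The coefficients w_l of Phi_t^* V solve the overdetermined smooth system
   \sum_l w_l A_kl = (V x_k) o Phi_t, \sum_l w_l C_kl = 0, which is injective;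
   Q is the matrix of its normal equations. *)
Let A k l t x := E l (pull (Phi t) (x_ k)) x.
Let C k l x := (k == l)%:R - E l (x_ k) x.
Let Qf l m t x := \sum_k (A k l t x * A k m t x + C k l x * C k m x).
Let Q t x : 'M[R]_N := \matrix_(l, m) Qf l m t x.

Let fam_A k l : smooth_family T (A k l).
Proof. exact: (fam_vfield openT (E l) (fam_pull (x_ k))). Qed.

Let fam_C k l : smooth_family T (fun _ => C k l).
Proof.
apply: (famD openT); first exact: (fam_cst openT).
apply: (fam_ext openT (u := fun _ x => -1 * E l (x_ k) x)) => [t x _|]; first by rewrite mulN1r.
by apply: (famM openT); [exact: fam_cst|apply: (fam_smooth openT); exact: Cinf_smooth].
Qed.

Let fam_Q l m : smooth_family T (Qf l m).
Proof.
by apply: (fam_sum openT) => k; apply: (famD openT); apply: (famM openT).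
Qed.

Let constv (u : 'I_N -> R) : Vect M := \sum_l (u l *: (1 : C^oo M)) *: E l.

Let vsumE (I : Type) (r : seq I) (F : I -> Vect M) f x :
  (\sum_(i <- r) F i) f x = \sum_(i <- r) F i f x.
Proof. by elim: r => [|i r IH]; rewrite ?big_nil// !big_cons -IH. Qed.

Let constvE u f x : constv u f x = \sum_l u l * E l f x.
Proof. by rewrite vsumE; apply: eq_bigr => l _; rewrite CinfME CinfZE mulr1. Qed.

(** If the quadratic form of [Q] vanishes on u, both sums of squares do. The [A] part says that the
    vector with coefficients u kills all [pull (Phi t) (x_ k)], hence is zero; the [C] part says
    that u is the coefficient list of that vector, so u = 0. *)
Let Q_det t x : \det (Q t x) != 0.
Proof.
apply: posdef_det_neq0 => u Qu.
have : \sum_k ((\sum_l u 0 l * A k l t x) ^+ 2 + (\sum_l u 0 l * C k l x) ^+ 2) = 0.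
  rewrite -[RHS]Qu; symmetry.
  under eq_bigr => l _ do under eq_bigr => m _ do rewrite mxE mulr_sumr mulr_suml.
  under eq_bigr => l _ do rewrite exchange_big/=.
  rewrite exchange_big/=; apply: eq_bigr => k _.
  rewrite !expr2 !mulr_suml -big_split/=; apply: eq_bigr => l _.
  rewrite !mulr_sumr -big_split/=; apply: eq_bigr => m _; ring.
rewrite big_split/= => /eqP; rewrite paddr_eq0; try (by apply: sumr_ge0 => k _; exact: sqr_ge0).
move=> /andP[/eqP/sum_sqr_eq0 HA /eqP/sum_sqr_eq0 HC].
have U0 := @vfield_eq0_pull t x (constv (fun l => u 0 l)) _.
have {}U0 f : constv (fun l => u 0 l) f x = 0 by apply: U0 => k; rewrite constvE; exact: HA.
apply/rowP => k; rewrite mxE; have := HC k.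
under eq_bigr do rewrite /C mulrBr.
rewrite sumrB -constvE U0 subr0 (bigD1 k)//= eqxx mulr1 big1 ?addr0// => l lk.
by rewrite eq_sym (negbTE lk) mulr0.
Qed.

Let pullv_coef t V x l : T t -> pullv t V (x_ l) x =
  (\sum_m (\sum_k V (x_ k) (Phi t x) * A k m t x) * (\adj (Q t x)) m l) * (\det (Q t x))^-1.
Proof.
move=> Tt.
pose w l := pullv t V (x_ l) x; rewrite -/(w l).
have S1 k : \sum_l w l * A k l t x = V (x_ k) (Phi t x).
  by rewrite /w -dualEx pullv_pull.
have S2 k : \sum_l w l * C k l x = 0.
  under eq_bigr do rewrite /C mulrBr.
  rewrite sumrB -dualEx (bigD1 k)//= eqxx mulr1 big1 ?addr0 ?subrr// => j jk.
  by rewrite eq_sym (negbTE jk) mulr0.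
have := @solve_adj R N (Q t x) (\row_l w l)
  (\row_m \sum_k V (x_ k) (Phi t x) * A k m t x) (@Q_det t x) _ l.
rewrite mxE => ->; first by congr (_ * _); apply: eq_bigr => m _; rewrite mxE.
apply/rowP => m; rewrite !mxE.
under eq_bigr do rewrite !mxE mulr_sumr.
rewrite exchange_big/=; apply: eq_bigr => k _.
under eq_bigr do rewrite mulrDr !mulrA.
by rewrite big_split/= -!mulr_suml S1 S2 mul0r addr0.
Qed.

(** By definition [pullv] involves the inverse of [Phi t], about which no smoothness in t is given.
    Cramer's rule for the normal equations expresses its coefficients through functions along
    [Phi t] alone. *)
Lemma fam_pullv V f : smooth_family T (fun t => pullv t V f).
Proof.
apply: (fam_ext openT (u := fun t x => \sum_l pullv t V (x_ l) x * E l f x)).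
  by move=> t x _; rewrite -dualEx.
apply: (fam_sum openT) => l; apply: (famM openT); last first.
  by apply: (fam_smooth openT); exact: Cinf_smooth.
apply: (fam_ext openT (fun t x Tt => esym (@pullv_coef t V x l Tt))).
apply: (famM openT); last by apply: (famV openT) => [|t x _]; [exact: fam_det|exact: Q_det].
apply: (fam_sum openT) => m; apply: (famM openT); last exact: fam_adj.
apply: (fam_sum openT) => k; apply: (famM openT); last exact: fam_A.
exact: iso_fam.
Qed.

(** Differentiability comes from [fam_pullv]; the value is found by differentiating the relation
    [pullv_pull] on each [x_ k]. This determines the derivative, because the functions
    [pull (Phi t) (x_ k)] separate tangent vectors. *)
Lemma derive_pullv V f t x : T t ->
  is_derive t 1 (fun s => pullv s V f x) (pullv t (lie (Z t) V) f x).
Proof.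
move=> Tt.
pose w l s := pullv s V (x_ l) x.
have dw l : is_derive t 1 (w l) ('D_1 (w l) t).
  exact: derivableP (@fam_derivable _ _ _ T (fun s => pullv s V (x_ l)) t x (fam_pullv V (x_ l)) Tt).
have dA k l : is_derive t 1 (fun s => E l (pull (Phi s) (x_ k)) x)
    (E l (pull (Phi t) (Z t (x_ k))) x).
  apply: (@derive_vfield_fam _ _ _ T openT (E l) (fun s => pull (Phi s) (x_ k))
     (fun s => pull (Phi s) (Z s (x_ k)))) => //.
  by move=> s y Ts; exact: iso_derive.
have dw' h : is_derive t 1 (fun s => pullv s V h x) (\sum_l 'D_1 (w l) t * E l h x).
  have -> : (fun s => pullv s V h x) = (fun s => \sum_l w l s * E l h x).
    by apply/funext => s; rewrite dualEx.
  apply: is_derive_bigsum => l; apply: is_derive_eq (is_derive_mul (dw l) (is_derive_cst _ _ _)) _.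
  by rewrite mulr0 addr0.
have key k : \sum_l 'D_1 (w l) t * E l (pull (Phi t) (x_ k)) x =
    pullv t (lie (Z t) V) (pull (Phi t) (x_ k)) x.
  have d1 : is_derive t 1 (fun s => \sum_l w l s * E l (pull (Phi s) (x_ k)) x)
     (\sum_l ('D_1 (w l) t * E l (pull (Phi t) (x_ k)) x +
        w l t * E l (pull (Phi t) (Z t (x_ k))) x)).
    by apply: is_derive_bigsum => l; exact: is_derive_mul.
  have E1 : (fun s => \sum_l w l s * E l (pull (Phi s) (x_ k)) x) =
     (fun s => V (x_ k) (Phi s x)).
    by apply/funext => s; rewrite -dualEx pullv_pull.
  have d2 := @iso_derive (V (x_ k)) t x Tt.
  rewrite E1 in d1; have := is_derive_uniq d1 d2.
  have S : \sum_l w l t * E l (pull (Phi t) (Z t (x_ k))) x = V (Z t (x_ k)) (Phi t x).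
    by rewrite /w -dualEx pullv_pull.
  rewrite big_split S pullv_pull => H.
  have -> : pull (Phi t) (lie (Z t) V (x_ k)) x =
    Z t (V (x_ k)) (Phi t x) - V (Z t (x_ k)) (Phi t x) by [].
  by rewrite -H addrK.
apply: is_derive_eq (dw' f) _; apply/eqP; rewrite -subr_eq0; apply/eqP.
rewrite -constvE -CinfNE -CinfDE.
have -> : constv (fun l => 'D_1 (w l) t) f - pullv t (lie (Z t) V) f =
   (constv (fun l => 'D_1 (w l) t) - pullv t (lie (Z t) V)) f by [].
apply: (@vfield_eq0_pull t x) => k.
rewrite -[LHS]/(constv _ _ _ - pullv _ _ _ _) constvE key subrr//.
Qed.

(** The space point may move with h because joint continuity makes [d] nearly constant along the
    vertical segment over [c (t + h)]. Only continuity of [c] is asked, which is all that is known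
    of an inverse flow line. *)
Lemma moving_point (D d : R -> M -> R) (c : R -> M) t :
  (forall s x, T s -> is_derive s 1 (D^~ x) (d s x)) -> T t ->
  {for (t, c t), continuous (fun p : R * M => d p.1 p.2)} -> {for t, continuous c} ->
  forall e, 0 < e -> \forall h \near (0 : R),
    `|D (t + h) (c (t + h)) - D t (c (t + h)) - d t (c t) * h| <= e * `|h|.
Proof.
move=> dD Tt cd cc e e0.
have [[S S'] /= [NS NS'] SS] := (continuous_forP _ _).1 cd e e0.
have [r r0 Br] := (nbhs_ballP t _).1 (@filterI _ (nbhs t) _ _ _ NS
  (@filterI _ (nbhs t) _ _ _ (near_open openT Tt) (cc _ NS'))).
have {}Br s : `|s - t| < r -> [/\ S s, T s & S' (c s)].
  by move=> sr; have [|? [? ?]] := Br s; rewrite -?ball_normE /ball_/= 1?distrC.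
apply/nbhs_ballP; exists r => // h; rewrite -ball_normE /ball_/= sub0r normrN => hr.
have [_ _ S'h] : [/\ S (t + h), T (t + h) & S' (c (t + h))] by apply: Br; rewrite addrC addKr.
have := @mean_value_le R (D^~ (c (t + h))) (d^~ (c (t + h))) t (t + h) (d t (c t)) e.
have btw s : Num.min t (t + h) <= s <= Num.max t (t + h) -> `|s - t| < r.
  move=> H; apply: le_lt_trans hr; move: H; have [h0|h0] := leP 0 h.
    rewrite min_l ?max_r ?lerDl// => /andP[a b].
    by rewrite ger0_norm ?subr_ge0// lerBlDl ger0_norm.
  rewrite min_r ?max_l ?gerDl ?(ltW h0)// => /andP[a b].
  by rewrite ler0_norm ?subr_le0// ltr0_norm// lerN2 lerBrDl.
rewrite [t + h - t]addrC addKr; apply => s /btw /Br[Ss Ts _]; first exact: dD.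
by rewrite distrC; exact: (SS (s, c (t + h))).
Qed.

Lemma derive_along (G g : R -> C^oo M) t x :
  (forall s y, T s -> is_derive s 1 (fun s => G s y) (g s y)) -> T t ->
  {for (t, Phi t x), continuous (fun p : R * M => g p.1 p.2)} ->
  is_derive t 1 (fun s => G s (Phi s x)) (g t (Phi t x) + Z t (G t) (Phi t x)).
Proof.
move=> dG Tt cg; apply/is_deriveP => e e0.
have cc : {for t, continuous (fun s => Phi s x)}.
  have Cp : (fun s => (s, x)) @ t --> (t, x).
    by apply: (@cvg_to_pair _ _ _ (nbhs t) _ id); [exact: cvg_id|exact: cvg_cst].
  exact: (cvg_comp _ _ Cp (@iso_cont t x Tt)).
have e2 : 0 < e / 2 by rewrite divr_gt0.
have H1 := @moving_point (fun s => G s) (fun s => g s) (fun s => Phi s x) t dG Tt cg cc _ e2.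
have /is_deriveP/(_ _ e2) H2 := @iso_derive (G t) t x Tt.
apply: filterS2 H1 H2 => h H1 H2.
set a := G (t + h) _ - G t _ in H1; set b := G t _ - G t _ in H2.
have -> : G (t + h) (Phi (t + h) x) - G t (Phi t x) - (g t (Phi t x) + Z t (G t) (Phi t x)) * h =
  (a - g t (Phi t x) * h) + (b - Z t (G t) (Phi t x) * h) by rewrite /a /b; ring.
apply: le_trans (ler_normD _ _) _; apply: le_trans (lerD H1 H2) _.
by rewrite -mulrDl -splitr.
Qed.

(* Differentiating u_t(Phi_t x) = v_t(x) at a fixed point of the target. *)
Lemma derive_advect (u : R -> C^oo M) (v v' : R -> M -> R) t y :
  (forall s x, T s -> v s x = u s (Phi s x)) -> smooth_family T v ->
  (forall s x, T s -> is_derive s 1 (v^~ x) (v' s x)) -> T t ->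
  is_derive t 1 (fun s => u s y) (v' t (dinv (Phi t) y) - Z t (u t) y).
Proof.
move=> vu fv dv Tt.
(* At x = [c s] this is [u s y - u t y], and [D t] vanishes identically. So the increment of [u] at
   the fixed point [y] is a time increment of [D] over the moving point [c], and the inverse flow is
   never differentiated. *)
pose D s x := v s x - u t (Phi s x).
pose d s x := v' s x - Z s (u t) (Phi s x).
have dD s x : T s -> is_derive s 1 (D^~ x) (d s x).
  by move=> Ts; apply: is_deriveB; [exact: dv|exact: iso_derive].
have fD : smooth_family T D.
  apply: (fam_ext openT (u := fun s x => v s x + (-1) * u t (Phi s x))) => [s x _|].
    by rewrite /D mulN1r.
  by apply: (famD openT) => //; apply: (famM openT); [exact: fam_cst|exact: iso_fam].
have fd : smooth_family T d := fam_dt openT fD dD.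
pose c s := dinv (Phi s) y.
have cc : {for t, continuous c}.
  have Cp : (fun s => (s, y)) @ t --> (t, y).
    by apply: (@cvg_to_pair _ _ _ (nbhs t) _ id); [exact: cvg_id|exact: cvg_cst].
  exact: (cvg_comp _ _ Cp (@iso_inv_cont t y Tt)).
have cd := @fam_cont _ _ _ T d t (c t) fd Tt.
apply/is_deriveP => e e0.
have NT : \forall h \near (0 : R), T (t + h).
  have Ct : (t + h) @[h --> (0 : R)] --> t.
    by rewrite -[X in _ --> X]addr0; apply: cvgD; [exact: cvg_cst|exact: cvg_id].
  exact: Ct _ (near_open openT Tt).
apply: filterS2 NT (moving_point dD Tt cd cc e0) => h Th.
rewrite /D /d /c !vu// !dinvK.
by congr (`|_| <= _); ring.
Qed.

End Flows.

(** * Tensor identities on generalized Kähler data *)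

Section TensorCalculus.
Context {R : realType} {n : nat} {M : manifold R n}.
Implicit Types (f g : C^oo M) (X Y Z V W : Vect M) (a : form1 M) (F : form2 M) (I J : endo M).

Lemma vfield_eqP X Y : (forall f, X f = Y f) -> X = Y.
Proof. by move=> XY; apply/val_inj/funext. Qed.

Lemma vfieldDE X Y f : (X + Y) f = X f + Y f. Proof. by []. Qed.
Lemma vfieldNE X f : (- X) f = - X f. Proof. by []. Qed.
Lemma vfieldZE g X f : (g *: X) f = g * X f. Proof. by []. Qed.
Lemma vfield0E f : (0 : Vect M) f = 0. Proof. by []. Qed.
Lemma lieE X Y f : lie X Y f = X (Y f) - Y (X f). Proof. by []. Qed.
Definition vfieldE := (vfieldDE, vfieldNE, vfieldZE, vfield0E, lieE).

Lemma vfield_sumE (T : Type) (r : seq T) (P : pred T) (G : T -> Vect M) f :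
  (\sum_(i <- r | P i) G i) f = \sum_(i <- r | P i) G i f.
Proof.
elim: r => [|i r IH]; first by rewrite !big_nil.
by rewrite !big_cons; case: ifP => _ //; rewrite vfieldDE IH.
Qed.

Lemma lieDl X Y Z : lie (X + Y) Z = lie X Z + lie Y Z.
Proof. by apply: vfield_eqP => f; rewrite !vfieldE derivationD; ring. Qed.

Lemma lieNl X Z : lie (- X) Z = - lie X Z.
Proof. by apply: vfield_eqP => f; rewrite !vfieldE derivationN; ring. Qed.

Lemma lieC X Y : lie X Y = - lie Y X.
Proof. by apply: vfield_eqP => f; rewrite !vfieldE; ring. Qed.

Lemma lieDr X Y Z : lie Z (X + Y) = lie Z X + lie Z Y.
Proof. by rewrite lieC lieDl opprD -!(lieC Z). Qed.

Lemma lieNr X Z : lie Z (- X) = - lie Z X.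
Proof. by rewrite lieC lieNl -lieC. Qed.

Lemma lieZr X f Z : lie Z (f *: X) = Z f *: X + f *: lie Z X.
Proof. by apply: vfield_eqP => g; rewrite !vfieldE derivationM; ring. Qed.

Lemma lie_jacobi X Y Z : lie (lie X Y) Z - lie (lie X Z) Y + lie (lie Y Z) X = 0.
Proof. by apply: vfield_eqP => g; rewrite !vfieldE !derivationB; ring. Qed.

Lemma tensor1P a : tensor1 a <->
  (forall X Y, a (X + Y) = a X + a Y) /\ (forall f X, a (f *: X) = f * a X).
Proof.
split=> [l|[D Z] f X Y]; last by rewrite D Z.
have D X Y : a (X + Y) = a X + a Y by rewrite -[X in LHS](scale1r X) l scale1r.
split=> // f X.
have a0 : a 0 = 0 by have := D 0 0; rewrite addr0 => /eqP; rewrite -subr_eq subrr => /eqP.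
by have := l f X 0; rewrite !addr0 a0 addr0.
Qed.

Section Tensor1.
Variables (a : form1 M) (ta : tensor1 a).
Lemma tensor1D X Y : a (X + Y) = a X + a Y. Proof. exact: ((tensor1P a).1 ta).1. Qed.
Lemma tensor1Z f X : a (f *: X) = f * a X. Proof. exact: ((tensor1P a).1 ta).2. Qed.
Lemma tensor10 : a 0 = 0. Proof. by rewrite -(scale0r 0) tensor1Z mul0r. Qed.
Lemma tensor1N X : a (- X) = - a X.
Proof. by apply/eqP; rewrite -addr_eq0 -tensor1D addNr tensor10. Qed.
Lemma tensor1B X Y : a (X - Y) = a X - a Y. Proof. by rewrite tensor1D tensor1N. Qed.
Lemma tensor1_sum (T : Type) (r : seq T) (P : pred T) (G : T -> Vect M) :
  a (\sum_(i <- r | P i) G i) = \sum_(i <- r | P i) a (G i).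
Proof.
elim: r => [|i r IH]; first by rewrite !big_nil tensor10.
by rewrite !big_cons; case: ifP => _ //; rewrite tensor1D IH.
Qed.
End Tensor1.

Section TensorEndo.
Variables (I : endo M) (tI : tensor_endo I).
Lemma endoD X Y : I (X + Y) = I X + I Y.
Proof. by have := tI 1 X Y; rewrite !scale1r. Qed.
Lemma endo0 : I 0 = 0.
Proof. by have := endoD 0 0; rewrite addr0 => /eqP; rewrite -subr_eq subrr => /eqP. Qed.
Lemma endoZ f X : I (f *: X) = f *: I X.
Proof. by have := tI f X 0; rewrite !addr0 endo0 addr0. Qed.
Lemma endoN X : I (- X) = - I X.
Proof. by apply/eqP; rewrite -addr_eq0 -endoD addNr endo0. Qed.
Lemma endoB X Y : I (X - Y) = I X - I Y. Proof. by rewrite endoD endoN. Qed.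
Lemma endo_sum (T : Type) (r : seq T) (P : pred T) (G : T -> Vect M) :
  I (\sum_(i <- r | P i) G i) = \sum_(i <- r | P i) I (G i).
Proof.
elim: r => [|i r IH]; first by rewrite !big_nil endo0.
by rewrite !big_cons; case: ifP => _ //; rewrite endoD IH.
Qed.

Lemma tensor_act1 f : tensor1 (act1 I (d0 f)).
Proof. by move=> g X Y; rewrite /act1 /dual_endo /d0 endoD endoZ vfieldE vfieldE /GRing.scale/=; ring. Qed.
End TensorEndo.

Lemma tensor_d0 f : tensor1 (d0 f).
Proof. by move=> g X Y; rewrite /d0 !vfieldE. Qed.

Lemma act1E I f Y : act1 I (d0 f) Y = - I Y f. Proof. by []. Qed.

Lemma d1_skew a X Y : tensor1 a -> d1 a X Y = - d1 a Y X.
Proof. by move=> ta; rewrite /d1 (lieC X Y) (tensor1N ta); ring. Qed.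

Lemma tensor2_d1 a : tensor1 a -> tensor2 (d1 a).
Proof.
move=> ta; have T1 X : tensor1 (d1 a X).
  apply/tensor1P; split=> [Y Z|f Y]; rewrite /d1.
    by rewrite lieDr !(tensor1D ta) derivationD !vfieldE; ring.
  by rewrite lieZr !(tensor1D ta) !(tensor1Z ta) derivationM !vfieldE; ring.
split=> // Y; apply/tensor1P; split=> [X Z|f X]; rewrite d1_skew//.
  by rewrite (tensor1D (T1 Y)) (d1_skew Y X)// (d1_skew Y Z)//; ring.
by rewrite (tensor1Z (T1 Y)) (d1_skew Y X)//; ring.
Qed.

Lemma d2_d1 a X Y Z : tensor1 a -> d2 (d1 a) X Y Z = 0.
Proof.
move=> ta; have := congr1 a (lie_jacobi X Y Z).
rewrite (tensor1D ta) (tensor1B ta) (tensor10 ta) => H.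
rewrite /d2 /d1 !derivationB !vfieldE -[RHS]H; ring.
Qed.

Section Form2.
Variables (F : form2 M) (tF : tensor2 F).
Lemma form2Dl X Y Z : F (X + Y) Z = F X Z + F Y Z. Proof. exact: (tensor1D (tF.2 Z)). Qed.
Lemma form2Nl X Z : F (- X) Z = - F X Z. Proof. exact: (tensor1N (tF.2 Z)). Qed.
Lemma form2Bl X Y Z : F (X - Y) Z = F X Z - F Y Z. Proof. exact: (tensor1B (tF.2 Z)). Qed.
Lemma form2Zl f X Z : F (f *: X) Z = f * F X Z. Proof. exact: (tensor1Z (tF.2 Z)). Qed.
Lemma form2Dr X Y Z : F Z (X + Y) = F Z X + F Z Y. Proof. exact: (tensor1D (tF.1 Z)). Qed.
Lemma form2Nr X Z : F Z (- X) = - F Z X. Proof. exact: (tensor1N (tF.1 Z)). Qed.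
Lemma form2Br X Y Z : F Z (X - Y) = F Z X - F Z Y. Proof. exact: (tensor1B (tF.1 Z)). Qed.
Lemma form2Zr f X Z : F Z (f *: X) = f * F Z X. Proof. exact: (tensor1Z (tF.1 Z)). Qed.
End Form2.

Definition Lie_form2 V F : form2 M := fun X Y => V (F X Y) - F (lie V X) Y - F X (lie V Y).

Lemma Cartan V F X Y : tensor2 F -> (forall X Y, F X Y = - F Y X) ->
  (forall X Y Z, d2 F X Y Z = 0) -> Lie_form2 V F X Y = d1 (F V) X Y.
Proof.
move=> tF sF cF; have := cF V X Y; rewrite /d2 /Lie_form2 /d1 => H.
apply/eqP; rewrite -subr_eq0; apply/eqP; rewrite -H.
by rewrite (sF X (lie V Y)) (sF V (lie X Y)); ring.
Qed.

(** With [J (J W) = - W], the difference of the two sides is exactly the Nijenhuis tensor of [J] on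
    [X], [W]. *)
Lemma Lie_endo_complex J X W : complex_structure J ->
  Lie_endo (J X) J W = J (Lie_endo X J W).
Proof.
move=> [tJ J2 nJ]; have := nJ X W; rewrite /nijenhuis /Lie_endo (endoB tJ) J2 => H.
apply/eqP; rewrite -subr_eq0; apply/eqP; rewrite -H.
by apply: vfield_eqP => f; rewrite !vfieldE; ring.
Qed.

Lemma Lie_endo_anti J X W : complex_structure J -> Lie_endo X J (J W) = - J (Lie_endo X J W).
Proof.
move=> [tJ J2 nJ]; rewrite /Lie_endo (endoB tJ) !J2 lieNr.
by apply: vfield_eqP => f; rewrite !vfieldE; ring.
Qed.

(** The form is of type (1,1): expanding both sides, the second-order terms cancel and the remainder
    is the Nijenhuis tensor applied to [f]. *)
Lemma ddc_type11 I f X Y : complex_structure I -> ddc I f (I X) Y = - ddc I f X (I Y).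
Proof.
move=> [tI I2 nI]; have := congr1 (fun V : Vect M => V f) (nI X Y).
rewrite /nijenhuis !vfieldE => H.
rewrite /ddc /d1 !act1E !I2 !vfieldE !derivationN; apply/eqP; rewrite -subr_eq0; apply/eqP.
by rewrite -[RHS]oppr0 -H; ring.
Qed.

(** * Lie derivatives along Hamiltonian fields *)

Section GK.
Variables (F : form2 M) (I J : endo M).
Hypotheses (sF : symplectic F) (cI : complex_structure I) (cJ : complex_structure J).
Hypothesis FI : forall X Y, F (I X) Y = - F X (J Y).

Let tF : tensor2 F. Proof. by case: sF. Qed.
Let kF X Y : F X Y = - F Y X. Proof. by case: sF => _ + _ _; exact. Qed.
Let dF X Y Z : d2 F X Y Z = 0. Proof. by case: sF. Qed.
Let tI : tensor_endo I. Proof. by case: cI. Qed.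
Let tJ : tensor_endo J. Proof. by case: cJ. Qed.

Lemma GK_FJ X Y : F (J X) Y = - F X (I Y).
Proof. by rewrite (kF X) FI opprK kF. Qed.

Lemma Lie_GK V W Y : F (Lie_endo V I W) Y =
  - Lie_form2 V F (I W) Y - Lie_form2 V F W (J Y) - F W (Lie_endo V J Y).
Proof.
rewrite /Lie_endo (form2Bl tF) (form2Br tF) /Lie_form2 !FI derivationN.
ring.
Qed.

Lemma Lie_form2_Ham X f : F X = d0 f -> forall Y W, Lie_form2 X F Y W = 0.
Proof.
by move=> Xf Y W; rewrite Cartan// Xf /d1 /d0 !vfieldE; ring.
Qed.

Lemma contract_J X f : F X = d0 f -> F (J X) = act1 I (d0 f).
Proof. by move=> Xf; apply/funext => Y; rewrite GK_FJ Xf. Qed.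

(** The part along [J X] is computed by [Lie_GK], with L_{JX} F = dd^c_I f from Cartan's formula and
    L_{JX} J = J L_X J. As L_X F = 0, transposing this last term through [F] gives I L_X I, which
    cancels the part along [I X]. *)
Lemma Lie_Ham_I X f W Y : F X = d0 f ->
  F (Lie_endo (J X - I X) I W) Y = ddc I f W (I Y) - ddc I f W (J Y).
Proof.
move=> Xf.
have E1 : Lie_endo (J X - I X) I W = Lie_endo (J X) I W - Lie_endo (I X) I W.
  rewrite /Lie_endo !lieDl !lieNl (endoB tI).
  by apply: vfield_eqP => g; rewrite !vfieldE; ring.
rewrite E1 (form2Bl tF) (Lie_endo_complex _ _ cI) Lie_GK.
rewrite !Cartan// (contract_J Xf) -/(ddc I f).
rewrite (Lie_endo_complex _ _ cJ).
have -> : F W (J (Lie_endo X J Y)) = - F (I W) (Lie_endo X J Y) by rewrite FI opprK.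
have -> : F (I W) (Lie_endo X J Y) = - F (Lie_endo X I (I W)) Y.
  by rewrite Lie_GK !(Lie_form2_Ham Xf); ring.
rewrite (Lie_endo_anti _ _ cI) (form2Nl tF) ddc_type11//.
ring.
Qed.

Lemma form2_inj X Y : F X = F Y -> X = Y.
Proof.
move=> XY; apply/eqP; rewrite -subr_eq0; apply/eqP; apply: contrapT => XY0.
have [f [x fx]] : exists f x, (X - Y) f x != 0.
  apply: contrapT => H; apply: XY0; apply: vfield_eqP => f; apply/Cinf_eq => x.
  by apply: contrapT => /eqP fx; apply: H; exists f, x.
have [_ _ nd _] := sF; have [|Z] := nd (X - Y) x; first by exists f.
by rewrite (form2Bl tF) XY subrr eqxx.
Qed.

Lemma form2_inj2 X Y : (forall Z, F X Z = F Y Z) -> X = Y.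
Proof. by move=> H; apply: form2_inj; apply/funext. Qed.

End GK.

(** * The Poisson bivector *)

Section Poisson.
Variables (F : form2 M) (I J : endo M) (P : C^oo M -> Vect M).
Hypotheses (sF : symplectic F) (cI : complex_structure I) (cJ : complex_structure J).
Hypothesis FI : forall X Y, F (I X) Y = - F X (J Y).
Hypothesis HP : forall f, exists2 X, F X = d0 f & P f = J X - I X.

Let tF : tensor2 F. Proof. by case: sF. Qed.
Let tI : tensor_endo I. Proof. by case: cI. Qed.
Let tJ : tensor_endo J. Proof. by case: cJ. Qed.
Let FJ X Y : F (J X) Y = - F X (I Y). Proof. exact: GK_FJ sF FI X Y. Qed.

Lemma Poisson_form f Y : F (P f) Y = J Y f - I Y f.
Proof.
have [X Xf ->] := HP f.
by rewrite (form2Bl tF) FJ FI Xf /d0; ring.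
Qed.

Lemma Poisson_anti f g : P f g = - P g f.
Proof.
have [X Xf Pf] := HP f; have [Y Yg _] := HP g.
have E : P f g = F Y (P f) by rewrite Yg.
rewrite E; have [_ kF _ _] := sF.
have [Y' Yg' ->] := HP g; have {Y' Yg'} -> : Y' = Y by apply: (form2_inj sF); rewrite Yg' Yg.
rewrite kF Poisson_form; by rewrite !vfieldE; ring.
Qed.

Lemma Lie_Poisson_I f W Y :
  F (Lie_endo (P f) I W) Y = ddc I f W (I Y) - ddc I f W (J Y).
Proof. by have [X Xf ->] := HP f; exact: Lie_Ham_I. Qed.

(** The hypotheses are symmetric under exchanging [I] and [J], which only changes the sign of
    [P]. *)
Lemma Lie_Poisson_J f W Y :
  F (Lie_endo (P f) J W) Y = ddc J f W (I Y) - ddc J f W (J Y).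
Proof.
have [X Xf ->] := HP f; have E : J X - I X = - (I X - J X) by rewrite opprB.
have -> : Lie_endo (J X - I X) J W = - Lie_endo (I X - J X) J W.
  by rewrite E /Lie_endo !lieNl (endoN tJ); apply: vfield_eqP => g; rewrite !vfieldE; ring.
by rewrite (form2Nl tF) (Lie_Ham_I sF cJ cI FJ _ _ Xf); ring.
Qed.

(** Write [P g = J U - I U] and pair with [F]. The Lie derivatives of [I], [J] and [F] along [P f]
    are all expressed by dd^c_I f and dd^c_J f, and these terms cancel, leaving d(P f g) evaluated
    on [J Y - I Y]. *)
Lemma Poisson_lie f g : lie (P f) (P g) = P (P f g).
Proof.
apply: (form2_inj2 sF) => Y; rewrite Poisson_form.
have [U Ug Pg] := HP g; set V := P f.
have E : lie V (P g) = Lie_endo V J U - Lie_endo V I U + (J (lie V U) - I (lie V U)).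
  by rewrite Pg /Lie_endo lieDr lieNr; apply: vfield_eqP => h; rewrite !vfieldE; ring.
have L A B : Lie_form2 V F A B = ddc I f A B - ddc J f A B.
  have [_ kF _ dF] := sF; rewrite Cartan// /ddc /d1.
  have FV C : F V C = act1 I (d0 f) C - act1 J (d0 f) C.
    by rewrite Poisson_form !act1E; ring.
  by rewrite !FV !derivationB; ring.
have FW A : F (lie V U) A = A (V g) - ddc I f U A + ddc J f U A.
  have := L U A; rewrite /Lie_form2 Ug /d0 lieE => H.
  transitivity (A (V g) - (ddc I f U A - ddc J f U A)); last ring.
  by rewrite -H; ring.
rewrite E (form2Dl tF) (form2Bl tF (Lie_endo V J U) (Lie_endo V I U)).
rewrite (form2Bl tF (J (lie V U)) (I (lie V U))) (Lie_Poisson_I f) (Lie_Poisson_J f) FJ FI !FW.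
ring.
Qed.

Lemma Poisson_jacobi f g h : P f (P g h) = P (P f g) h + P g (P f h).
Proof. by rewrite -Poisson_lie lieE subrK. Qed.

End Poisson.
End TensorCalculus.

(** * Inversion of forms *)

Section Inversion.
Context {R : realType} {n : nat} {M : manifold R n}.
Variables (N : nat) (x_ : 'I_N -> C^oo M) (E : 'I_N -> Vect M).
Hypothesis dualE : forall (X : Vect M) (f : C^oo M), X f = \sum_k X (x_ k) * E k f.
Implicit Types (X Y : Vect M) (f g : C^oo M).

Lemma dual_expand X : X = \sum_k X (x_ k) *: E k.
Proof. by apply: vfield_eqP => f; rewrite vfield_sumE dualE. Qed.

Lemma tensor1_dual (a : form1 M) X : tensor1 a -> a X = \sum_k X (x_ k) * a (E k).
Proof.
move=> ta; rewrite {1}(dual_expand X) (tensor1_sum ta).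
by apply: eq_bigr => k _; rewrite (tensor1Z ta).
Qed.

Lemma tensor2_dual (B : form2 M) X Y : tensor2 B ->
  B X Y = \sum_k \sum_l X (x_ k) * Y (x_ l) * B (E k) (E l).
Proof.
move=> tB; rewrite (tensor1_dual X (tB.2 Y)); apply: eq_bigr => k _.
rewrite (tensor1_dual Y (tB.1 _)) mulr_sumr.
by apply: eq_bigr => l _; rewrite mulrA.
Qed.

(** The frame embeds TM in a trivial bundle of rank [N], where the matrix of the [E l (x_ k)]
    projects onto TM; this is the matrix of the complementary projection. *)
Definition dual_defect (k l : 'I_N) : C^oo M := (k == l)%:R - E l (x_ k).
Local Notation C := dual_defect.

(* Positive forms: completing B by the orthogonal projection off the tangent
   bundle gives an invertible matrix of smooth functions. *)
Lemma posdef_surj (B : form2 M) (a : form1 M) : tensor2 B ->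
  (forall X x, nonzero_at X x -> 0 < B X X x) -> tensor1 a -> exists X, B X = a.
Proof.
move=> tB pB ta.
pose q l m : C^oo M := B (E l) (E m) + \sum_k C k l * C k m.
pose Q x : 'M[R]_N := \matrix_(l, m) q l m x.
have Q0 x : \det (Q x) != 0.
  apply: posdef_det_neq0 => u Qu.
  pose U : Vect M := \sum_l (u 0 l *: (1 : C^oo M)) *: E l.
  have UE f : U f x = \sum_l u 0 l * E l f x.
    rewrite vfield_sumE Cinf_sumE; apply: eq_bigr => l _.
    by rewrite vfieldZE CinfME CinfZE mulr1.
  have BU : B U U x + \sum_k (\sum_l u 0 l * C k l x) ^+ 2 = 0.
    rewrite -[RHS]Qu.
    have -> : B U U x = \sum_l \sum_m u 0 l * B (E l) (E m) x * u 0 m.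
      rewrite {1}/U (tensor1_sum (tB.2 U)) Cinf_sumE; apply: eq_bigr => l _.
      rewrite (form2Zl tB) CinfME CinfZE mulr1 (tensor1_sum (tB.1 (E l))) Cinf_sumE mulr_sumr.
      apply: eq_bigr => m _; by rewrite (form2Zr tB) CinfME CinfZE Cinf1E; ring.
    have -> : \sum_k (\sum_l u 0 l * C k l x) ^+ 2 =
        \sum_l \sum_m u 0 l * (\sum_k C k l * C k m) x * u 0 m.
      under [RHS]eq_bigr => l _ do under eq_bigr => m _ do
        rewrite Cinf_sumE mulr_sumr mulr_suml.
      under [RHS]eq_bigr => l _ do rewrite exchange_big.
      rewrite [RHS]exchange_big; apply: eq_bigr => k _.
      rewrite expr2 mulr_suml; apply: eq_bigr => l _.
      rewrite mulr_sumr; apply: eq_bigr => m _.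
      by rewrite -[(C k l * C k m) x]/(C k l x * C k m x); ring.
    rewrite -big_split/=; apply: eq_bigr => l _; rewrite -big_split/=.
    by apply: eq_bigr => m _; rewrite mxE CinfDE; ring.
  have sq : 0 <= \sum_k (\sum_l u 0 l * C k l x) ^+ 2.
    by apply: sumr_ge0 => k _; exact: sqr_ge0.
  (* If [U] is nonzero at x, positivity of [B] already contradicts [BU]. Otherwise only the squares
     remain, and their vanishing makes u the coefficients of [U], which are 0. *)
  have [U0|/existsNP[f /eqP Uf]] := pselect (forall f, U f x = 0); last first.
    have P : 0 < B U U x by apply: pB; exists f.
    by move: BU => /eqP; rewrite gt_eqF// ltr_pwDl.
  have B0 : B U U x = 0.
    rewrite (tensor1_dual U (tB.2 U)) Cinf_sumE big1// => k _.
    by rewrite CinfME U0 mul0r.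
  move: BU; rewrite B0 add0r => /sum_sqr_eq0 HC.
  apply/rowP => k; rewrite mxE; have := HC k.
  have CE l : C k l x = (k == l)%:R - E l (x_ k) x.
    by rewrite /dual_defect CinfDE CinfNE; congr (_ - _); case: (k == l).
  under eq_bigr do rewrite CE mulrBr.
  rewrite sumrB -UE U0 subr0 (bigD1 k)//= eqxx mulr1 big1 ?addr0// => l lk.
  by rewrite eq_sym (negbTE lk) mulr0.
pose A : 'M[C^oo M]_N := \matrix_(l, m) q l m.
have detE x : (\det A) x = \det (Q x).
  rewrite /determinant Cinf_sumE; apply: eq_bigr => s _.
  have CP (I : Type) (r : seq I) (F : I -> C^oo M) : (\prod_(i <- r) F i) x = \prod_(i <- r) F i x.
    by elim: r => [|i r IH]; rewrite ?big_nil// !big_cons CinfME IH.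
  rewrite CinfME CP; congr (_ * _); first by case: (perm.odd_perm s).
  by apply: eq_bigr => i _; rewrite !mxE.
have A0 x : (\det A) x != 0 by rewrite detE.
pose dV := mkCinf (smoothV (Cinf_smooth (\det A)) A0).
have dK : \det A * dV = 1 by apply/Cinf_eq => x; rewrite CinfME /= mulfV.
pose b : 'rV[C^oo M]_N := \row_m a (E m).
pose v : 'rV[C^oo M]_N := b *m \adj A.
have vA : v *m A = (\det A) *: b by rewrite /v -mulmxA mul_adj_mx mul_mx_scalar.
pose c k := dV * v 0 k.
have cA m : \sum_l c l * q l m = a (E m).
  have := congr1 (fun w : 'rV[C^oo M]_N => w 0 m) vA; rewrite !mxE => H.
  rewrite -[RHS]mul1r -dK [_ * dV]mulrC -mulrA -H mulr_sumr; apply: eq_bigr => l _.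
  by rewrite mulrA; congr (_ * _); rewrite mxE.
exists (\sum_l c l *: E l); apply/funext => Y.
rewrite (tensor1_sum (tB.2 Y)) [RHS](tensor1_dual Y ta).
under [RHS]eq_bigr => m _ do rewrite -cA /q.
transitivity (\sum_m Y (x_ m) * \sum_l c l * B (E l) (E m)).
  under eq_bigr do rewrite (form2Zl tB) (tensor1_dual Y (tB.1 _)) mulr_sumr.
  rewrite exchange_big/=; apply: eq_bigr => m _; rewrite mulr_sumr.
  by apply: eq_bigr => l _; ring.
apply/eqP; rewrite eq_sym -subr_eq0 -sumrB; apply/eqP.
(* Coefficient lists of actual vector fields lie in the kernel of [C], so the term added to make the
   matrix invertible does not disturb the equation for [B]. *)
have S2 k : \sum_m Y (x_ m) * C k m = 0.
  under eq_bigr do rewrite /dual_defect mulrBr.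
  rewrite sumrB -dualE (bigD1 k)//= eqxx mulr1 big1 ?addr0 ?subrr// => j jk.
  by rewrite eq_sym (negbTE jk) mulr0.
transitivity (\sum_m \sum_l \sum_k c l * C k l * (Y (x_ m) * C k m)).
  apply: eq_bigr => m _; rewrite -mulrBr -sumrB mulr_sumr; apply: eq_bigr => l _.
  rewrite -mulrBr addrC addKr mulr_sumr mulr_sumr; apply: eq_bigr => k _; ring.
rewrite exchange_big/= big1// => l _; rewrite exchange_big/= big1// => k _.
by rewrite -mulr_sumr S2 mulr0.
Qed.

Lemma inv_formP (B : form2 M) a : (exists X, B X = a) -> B (inv_form B a) = a.
Proof. by case=> X BX; rewrite /inv_form; apply: (xgetPex 0 (P := [set X | B X = a])); exists X. Qed.

Lemma inv_form_uniq (B : form2 M) a X : injective B -> B X = a -> inv_form B a = X.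
Proof. by move=> iB BX; apply: iB; rewrite inv_formP ?BX//; exists X. Qed.

End Inversion.

(** * Differentiating an oriented integral *)

Section OrientedIntegral.
Context {R : realType}.
Notation mu := (@lebesgue_measure R).

(** Near t the oriented integral equals a difference of ordinary integrals from a common lower end
    [c], taken in [T] below both [a] and [t]; the upper end [u] makes [t] interior. The sign of
    [t - a] then does not matter. *)
Lemma is_derive_oriented_int (T : set R) (f : R -> R) a t : open T -> is_interval T ->
  (forall s, T s -> {for s, continuous f}) -> T a -> T t ->
  is_derive t 1 (fun s => oriented_int a s f) (f t).
Proof.
move=> oT iT cf Ta Tt.
have below b : T b -> exists2 c, T c & c < b.
  move=> Tb; have /nbhs_ballP[e e0 Be] := near_open oT Tb.
  exists (b - e / 2); last by rewrite ltrBlDr ltrDl divr_gt0.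
  apply: Be; rewrite -ball_normE /ball_/= opprB addrC subrK gtr0_norm ?divr_gt0//.
  by rewrite ltr_pdivrMr// ltr_pMr// ltr1n.
have above b : T b -> exists2 c, T c & b < c.
  move=> Tb; have /nbhs_ballP[e e0 Be] := near_open oT Tb.
  exists (b + e / 2); last by rewrite ltrDl divr_gt0.
  apply: Be; rewrite -ball_normE /ball_/= opprD addrA subrr sub0r normrN gtr0_norm ?divr_gt0//.
  by rewrite ltr_pdivrMr// ltr_pMr// ltr1n.
have [c Tc [ca ct]] : exists2 c, T c & c < a /\ c < t.
  have [at_|ta] := leP a t.
    by have [c Tc ca] := below a Ta; exists c => //; split=> //; exact: lt_le_trans ca at_.
  by have [c Tc ct] := below t Tt; exists c => //; split=> //; exact: lt_trans ct ta.
have [u Tu [au tu]] : exists2 u, T u & a < u /\ t < u.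
  have [at_|ta] := leP a t.
    by have [u Tu tu] := above t Tt; exists u => //; split=> //; exact: le_lt_trans at_ tu.
  by have [u Tu au] := above a Ta; exists u => //; split=> //; exact: lt_trans ta au.
have int x y : T x -> T y -> mu.-integrable `[x, y] (EFin \o f).
  move=> Tx Ty; apply: continuous_compact_integrable; first exact: segment_compact.
  apply: continuous_in_subspaceT => s /set_mem/=; rewrite in_itv/= => /andP[xs sy].
  by apply: cf; apply: (iT x y) => //; rewrite xs.
have [D1 D2] := @continuous_FTC1_closed R f c t u tu (int c u Tc Tu) ct (cf t Tt).
have D : is_derive t (1 : R) (fun s => \int[mu]_(x in `[c, s]) f x) (f t).
  by split; [exact: D1|rewrite -derive1E; exact: D2].
have chasles x y : T x -> T y -> c < x -> x <= y ->
    \int[mu]_(s in `[c, y]) f s - \int[mu]_(s in `[c, x]) f s =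
    \int[mu]_(s in `[x, y]) f s - \int[mu]_(s in `[y, x]) f s.
  move=> Tx Ty cx xy.
  rewrite (@Rintegral_itvB R f (BLeft c) (BRight y) x (int c y Tc Ty)) ?bnd_simp ?(ltW cx)//.
  rewrite Rintegral_itv_obnd_cbnd; last first.
    by apply: integrableS (int x y Tx Ty) => //; apply: subset_itvr; rewrite bnd_simp.
  have -> : \int[mu]_(s in `[y, x]) f s = 0; last by rewrite subr0.
  move: xy; rewrite le_eqVlt => /predU1P[->|xy].
    by rewrite set_itv1 Rintegral_set1.
  by rewrite set_itv_ge ?Rintegral_set0// bnd_simp -ltNge.
have E : \forall s \near t, \int[mu]_(x in `[c, s]) f x - \int[mu]_(x in `[c, a]) f x =
    oriented_int a s f.
  have NT := near_open oT Tt; have Nc := lt_nbhsr ct.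
  apply: filterS2 NT Nc => s Ts cs; rewrite /oriented_int.
  have [as_|sa] := leP a s; first exact: chasles.
  by rewrite -[LHS]opprB chasles ?opprB// ltW.
apply: (near_eq_is_derive E); rewrite -[f t]subr0.
by apply: is_deriveB; exact: is_derive_cst.
Qed.

End OrientedIntegral.

(** * Inverting tamed forms *)

Section TamedForms.
Context {R : realType} {n : nat} {M : manifold R n}.
Variables (N : nat) (x_ : 'I_N -> C^oo M) (E : 'I_N -> Vect M).
Hypothesis dualE : forall (X : Vect M) (f : C^oo M), X f = \sum_k X (x_ k) * E k f.
Variables (F : form2 M) (J : endo M).
Hypotheses (tF : tensor2 F) (kF : forall X Y, F X Y = - F Y X) (tam : tames F J).
Hypotheses (tJ : tensor_endo J) (J2 : forall X, J (J X) = - X).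
Implicit Types (X Y V : Vect M) (f : C^oo M).

Lemma vfield_neq0 X : X != 0 -> exists x, nonzero_at X x.
Proof.
move=> X0; apply: contrapT => H; move/eqP: X0; apply; apply: vfield_eqP => f; apply/Cinf_eq => x.
by apply: contrapT => /eqP fx; apply: H; exists x, f.
Qed.

Lemma tames_nondeg X x : nonzero_at X x -> exists Y, F X Y x != 0.
Proof. by move=> /tam; exists (J X); rewrite gt_eqF. Qed.

Lemma tames_inj : injective F.
Proof.
move=> X Y XY; apply/eqP; rewrite -subr_eq0; apply: contrapT => /negP/vfield_neq0[x].
by move=> /tames_nondeg[Z]; rewrite (form2Bl tF) XY subrr eqxx.
Qed.

(** Although [F] is skew, [- F (J X) Y] is positive on the diagonal, so [posdef_surj] solves for
    [X], and [- J X] is the solution for [F]. *)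
Lemma tames_surj a : tensor1 a -> exists X, F X = a.
Proof.
move=> ta; pose B : form2 M := fun X Y => - F (J X) Y.
have tB : tensor2 B.
  split=> X; apply/tensor1P; split=> [Y Y'|f Y]; rewrite /B.
  - by rewrite (form2Dr tF) opprD.
  - by rewrite (form2Zr tF) mulrN.
  - by rewrite (endoD tJ) (form2Dl tF) opprD.
  - by rewrite (endoZ tJ) (form2Zl tF) mulrN.
have [X x /tam|X BX] := posdef_surj dualE tB _ ta; first by rewrite /B -kF.
by exists (- J X); apply/funext => Y; rewrite (form2Nl tF) -BX.
Qed.

Lemma GK_I_E X Y : F (GK_I F J X) Y = - F X (J Y).
Proof.
rewrite /GK_I (form2Nl tF) inv_formP//; apply: tames_surj; apply/tensor1P.
rewrite /dual_endo; split=> [U V|f U].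
  by rewrite (endoD tJ) (form2Dr tF).
by rewrite (endoZ tJ) (form2Zr tF).
Qed.

Lemma tensor_GK_I : tensor_endo (GK_I F J).
Proof.
move=> f X Y; apply: tames_inj; apply/funext => V.
by rewrite GK_I_E !(form2Dl tF) !(form2Zl tF) !GK_I_E; ring.
Qed.

Lemma GK_I2 X : GK_I F J (GK_I F J X) = - X.
Proof.
by apply: tames_inj; apply/funext => V; rewrite !GK_I_E J2 (form2Nl tF) (form2Nr tF) opprK.
Qed.

Lemma GK_I_uniq (I : endo M) : (forall X Y, F (I X) Y = - F X (J Y)) -> GK_I F J = I.
Proof. by move=> H; apply/funext => X; apply: tames_inj; apply/funext => Y; rewrite GK_I_E H. Qed.

Lemma half_funD f : half_fun * f + half_fun * f = f.
Proof.
apply/Cinf_eq => x; rewrite CinfDE !CinfME /half_fun CinfZE Cinf1E mulr1 -mulrDl.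
by field.
Qed.

(** If g X = df, then U = -1/2 (I + J) X satisfies F U = df, because g is the symmetric part of -F
    J. Expanding with I^2 = J^2 = -1, (J - I) U equals 1/2 [I, J] X. This replaces the metric by a
    Hamiltonian vector. *)
Lemma GK_pi_Ham f : exists2 X, F X = d0 f & GK_pi F J (d0 f) = J X - GK_I F J X.
Proof.
have tg : tensor2 (GK_g F J).
  split=> X; apply/tensor1P; split=> [Y Y'|g Y]; rewrite /GK_g.
  - by rewrite (endoD tJ) !(form2Dl tF) (form2Dr tF); ring.
  - by rewrite (endoZ tJ) !(form2Zl tF) (form2Zr tF); ring.
  - by rewrite (endoD tJ) !(form2Dl tF) (form2Dr tF); ring.
  - by rewrite (endoZ tJ) !(form2Zl tF) (form2Zr tF); ring.
have gE X : GK_g F J X X = F X (J X).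
  by rewrite /GK_g mulrBr -mulrN half_funD -kF.
have [|X gX] := posdef_surj dualE tg _ (tensor_d0 f).
  by move=> X x /tam; rewrite gE.
have tI := tensor_GK_I.
have ginj : injective (GK_g F J).
  move=> U V UV; apply/eqP; rewrite -subr_eq0; apply: contrapT => /negP/vfield_neq0[x].
  by move=> /tam; rewrite -gE (form2Bl tg) UV subrr Cinf0E ltxx.
exists (- half_fun *: (GK_I F J X + J X)).
  rewrite -gX; apply/funext => Y.
  by rewrite (form2Zl tF) (form2Dl tF) GK_I_E /GK_g (kF (J Y)); ring.
rewrite /GK_pi (inv_form_uniq ginj gX).
rewrite (endoZ tJ) (endoZ tI) (endoD tJ) (endoD tI) J2 GK_I2.
by apply: vfield_eqP => g; rewrite !vfieldE; ring.
Qed.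

End TamedForms.

(** * Naturality under diffeomorphisms *)

Section Conjugation.
Context {R : realType} {n : nat} {M : manifold R n}.
Variable Q : diffeo M.
Implicit Types (X Y V : Vect M) (f g : C^oo M) (I : endo M).
Local Notation Qi := (diffeo_inv Q).

Lemma push_invK X : push Q (push Qi X) = X.
Proof. by apply: vfield_eqP => f; rewrite pushfE push_invfE !pull_invK. Qed.

Lemma pushK_inv X : push Qi (push Q X) = X.
Proof. by apply: vfield_eqP => f; rewrite push_invfE pushfE !pullK_inv. Qed.

Lemma pushD X Y : push Q (X + Y) = push Q X + push Q Y.
Proof. by apply: vfield_eqP => f; exact/Cinf_eq. Qed.

Lemma pushN X : push Q (- X) = - push Q X.
Proof. by apply: vfield_eqP => f; exact/Cinf_eq. Qed.

Lemma pushZ f X : push Q (f *: X) = pull Qi f *: push Q X.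
Proof. by apply: vfield_eqP => g; exact/Cinf_eq. Qed.

Lemma push_lie X Y : push Q (lie X Y) = lie (push Q X) (push Q Y).
Proof. by apply: vfield_eqP => f; rewrite lieE !pushfE !pullK_inv lieE; exact/Cinf_eq. Qed.

Definition conj_endo I : endo M := fun X => push Q (I (push Qi X)).

End Conjugation.

Section ConjugationComplex.
Context {R : realType} {n : nat} {M : manifold R n}.
Variable Q : diffeo M.
Implicit Types (X Y V : Vect M) (f g : C^oo M) (I : endo M).
Local Notation Qi := (diffeo_inv Q).

Lemma push_endo I X : push Q (I X) = conj_endo Q I (push Q X).
Proof. by rewrite /conj_endo pushK_inv. Qed.

Lemma push_surj X : exists Y, X = push Q Y.
Proof. by exists (push Qi X); rewrite push_invK. Qed.

Lemma push0 : push Q 0 = 0.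
Proof. by apply: vfield_eqP => f; exact/Cinf_eq. Qed.

Lemma complex_conj I : complex_structure I -> complex_structure (conj_endo Q I).
Proof.
move=> [tI I2 nI]; split.
- move=> f X Y; have [{}X ->] := push_surj X; have [{}Y ->] := push_surj Y.
  have -> : f = pull Qi (pull Q f) by rewrite pull_invK.
  by rewrite -pushZ -pushD -!push_endo tI pushD pushZ.
- by move=> X; have [{}X ->] := push_surj X; rewrite -!push_endo I2 pushN.
- move=> X Y; have [{}X ->] := push_surj X; have [{}Y ->] := push_surj Y.
  rewrite /nijenhuis -!(push_endo, push_lie).
  by rewrite -!pushN -!pushD -[_ - lie X Y]/(nijenhuis I X Y) nI push0.
Qed.

Lemma pull_ddc I f X Y :
  ddc (conj_endo Q I) f (push Q X) (push Q Y) = pull Qi (ddc I (pull Q f) X Y).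
Proof.
have A Z : act1 (conj_endo Q I) (d0 f) (push Q Z) = pull Qi (act1 I (d0 (pull Q f)) Z).
  by rewrite !act1E -push_endo pushfE; exact/Cinf_eq.
rewrite /ddc /d1 -push_lie !A !pushfE !pullK_inv.
exact/Cinf_eq.
Qed.

Lemma Lie_endo_conj I V X :
  Lie_endo (push Q V) (conj_endo Q I) (push Q X) = push Q (Lie_endo V I X).
Proof. by rewrite /Lie_endo -!(push_endo, push_lie) -pushN -pushD. Qed.

End ConjugationComplex.

(** * Deformations *)

Section VectorFamilies.
Context {R : realType} {n : nat} {M : manifold R n} (T : set R).
Hypothesis openT : open T.
Variables (N : nat) (x_ : 'I_N -> C^oo M) (E : 'I_N -> Vect M).
Hypothesis dualE : forall (X : Vect M) (f : C^oo M), X f = \sum_k X (x_ k) * E k f.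
Implicit Types (W V : R -> Vect M) (u : R -> C^oo M).

Definition vfam W := forall f, smooth_family T (fun t => W t f).

Lemma famN (u : R -> M -> R) : smooth_family T u -> smooth_family T (fun t x => - u t x).
Proof.
move=> su; apply: (fam_ext openT (u := fun t x => (-1) * u t x)) => [t x _|].
  by rewrite mulN1r.
by apply: (famM openT) => //; exact: fam_cst.
Qed.

Lemma vfam_app W u : vfam W -> smooth_family T (fun t => u t) -> smooth_family T (fun t => W t (u t)).
Proof.
move=> fW fu; apply: (fam_ext openT (u := fun t x => \sum_k W t (x_ k) x * E k (u t) x)).
  by move=> t x _; rewrite [in RHS]dualE Cinf_sumE.
apply: (fam_sum openT) => k; apply: (famM openT); first exact: fW.
exact: (fam_vfield openT).
Qed.

Lemma vfam_lie W V : vfam W -> vfam V -> vfam (fun t => lie (W t) (V t)).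
Proof.
move=> fW fV f; apply: (famD openT); first exact: (vfam_app fW (fV f)).
by apply: famN; exact: (vfam_app fV (fW f)).
Qed.

Lemma vfam_endo (I : endo M) W : tensor_endo I -> vfam W -> vfam (fun t => I (W t)).
Proof.
move=> tI fW f.
apply: (fam_ext openT (u := fun t x => \sum_k W t (x_ k) x * I (E k) f x)).
  move=> t x _; rewrite {2}(dual_expand dualE (W t)) (endo_sum tI) vfield_sumE Cinf_sumE.
  by apply: eq_bigr => k _; rewrite (endoZ tI).
apply: (fam_sum openT) => k; apply: (famM openT); first exact: fW.
exact: (fam_smooth openT (Cinf_smooth _)).
Qed.

Lemma fam_ddc (I : endo M) u W V : tensor_endo I -> smooth_family T (fun t => u t) ->
  vfam W -> vfam V -> smooth_family T (fun t => ddc I (u t) (W t) (V t)).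
Proof.
move=> tI fu fW fV.
have A (W' : R -> Vect M) : vfam W' -> smooth_family T (fun t => act1 I (d0 (u t)) (W' t)).
  by move=> fW'; apply: famN; apply: vfam_app fu; exact: vfam_endo.
apply: (famD openT); last by apply: famN; apply: A; exact: vfam_lie.
apply: (famD openT); first exact: vfam_app fW (A _ fV).
by apply: famN; exact: vfam_app fV (A _ fW).
Qed.

End VectorFamilies.

(** * Time derivatives of pulled back tensors *)

Section PullbackAlongIsotopy.
Context {R : realType} {n : nat} {M : manifold R n} (T : set R).
Hypotheses (openT : open T) (iT : is_interval T) (T0 : T 0).
Variables (N : nat) (x_ : 'I_N -> C^oo M) (E : 'I_N -> Vect M).
Hypothesis dualE : forall (X : Vect M) (f : C^oo M), X f = \sum_k X (x_ k) * E k f.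
Variables (Z : R -> Vect M) (Phi : R -> diffeo M).
Hypothesis isoP : isotopy_of T Z Phi.
Implicit Types (X Y V : Vect M) (f : C^oo M).

Lemma derive_push X f x t : T t ->
  is_derive t 1 (fun s => X (pull (Phi s) f) x) (X (pull (Phi t) (Z t f)) x).
Proof.
move=> Tt; apply: (@derive_vfield_fam _ _ _ T openT X (fun s => pull (Phi s) f)
     (fun s => pull (Phi s) (Z s f))) => //.
  exact: (iso_fam isoP).
by move=> s y Ts; exact: (iso_derive isoP).
Qed.

(* d/dt Phi_t^* F_t = Phi_t^* (L_Z F_t + B_t), computed in the frame (E_k). *)
Lemma pull_form2_const (F B : R -> form2 M) :
  (forall t, T t -> tensor2 (F t)) -> (forall t, T t -> tensor2 (B t)) ->
  (forall X Y x t, T t -> is_derive t 1 (fun s => F s X Y x) (B t X Y x)) ->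
  (forall X Y x t, T t -> {for (t, x), continuous (fun p : R * M => B p.1 X Y p.2)}) ->
  (forall X Y t, T t -> B t X Y + Lie_form2 (Z t) (F t) X Y = 0) ->
  forall t, T t -> pull_form2 (Phi t) (F t) = F 0.
Proof.
move=> tF tB dF cB LZ t Tt; apply/funext => X; apply/funext => Y; apply/Cinf_eq => x.
(* In the frame only fixed fields [E k], [E l] enter [F s], so each summand is a product of three
   functions of s with known derivatives. *)
pose G s := \sum_k \sum_l X (pull (Phi s) (x_ k)) x * Y (pull (Phi s) (x_ l)) x *
   F s (E k) (E l) (Phi s x).
have GE s : T s -> pull_form2 (Phi s) (F s) X Y x = G s.
  move=> Ts; rewrite /pull_form2 /= (tensor2_dual dualE _ _ (tF s Ts)) Cinf_sumE.
  apply: eq_bigr => k _; rewrite Cinf_sumE; apply: eq_bigr => l _.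
  by rewrite !CinfME !pushfE /= !dfunK.
have dG s : T s -> is_derive s 1 G 0.
  move=> Ts; set y := Phi s x; set X' := push (Phi s) X; set Y' := push (Phi s) Y.
  have pE (V : Vect M) f : V (pull (Phi s) f) x = push (Phi s) V f y by rewrite pushfE /= dfunK.
  have dd := is_derive_bigsum (index_enum 'I_N) xpredT (fun k =>
    is_derive_bigsum (index_enum 'I_N) xpredT (fun l =>
      is_derive_mul (is_derive_mul (@derive_push X (x_ k) x s Ts) (@derive_push Y (x_ l) x s Ts))
        (derive_along openT isoP (fun s y => dF (E k) (E l) y s) Ts (cB (E k) (E l) y s Ts)))).
  apply: is_derive_eq dd _; rewrite -/y.
  transitivity ((B s X' Y' + Lie_form2 (Z s) (F s) X' Y') y); last by rewrite LZ.
  have F2 := tensor2_dual dualE _ _ (tF s Ts).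
  have -> : Lie_form2 (Z s) (F s) X' Y' = \sum_k \sum_l (
      (X' (Z s (x_ k)) * Y' (x_ l) + X' (x_ k) * Y' (Z s (x_ l))) * F s (E k) (E l) +
       X' (x_ k) * Y' (x_ l) * Z s (F s (E k) (E l))).
    rewrite /Lie_form2 !F2 derivation_sum -!sumrB; apply: eq_bigr => k _.
    rewrite derivation_sum -!sumrB; apply: eq_bigr => l _.
    by rewrite !derivationM !lieE; ring.
  have sumD (u v : 'I_N -> R) : \sum_k u k + \sum_k v k = \sum_k (u k + v k).
    by rewrite big_split.
  rewrite (tensor2_dual dualE _ _ (tB s Ts)) CinfDE !Cinf_sumE sumD.
  apply: eq_bigr => k _; rewrite !Cinf_sumE sumD; apply: eq_bigr => l _.
  by rewrite !pE !(CinfDE, CinfME) -/X' -/Y' -/y; ring.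
rewrite (GE t Tt) (is_derive0_cst iT dG Tt T0) -GE//.
have P0 : Phi 0 = id :> (M -> M) by apply/funext => z; have [] := isoP.
have pull0 f : pull (Phi 0) f = f by apply/Cinf_eq => z /=; rewrite P0.
have push0 V : push (Phi 0) V = V.
  by apply: vfield_eqP => f; apply/Cinf_eq => z; rewrite -{1}[z]/(id z) -P0 pushfE /= dfunK pull0.
by rewrite /pull_form2 !push0 pull0.
Qed.

(** Expanding the pushed field in the frame separates the time dependence into coefficients, covered
    by [derive_push], and pullbacks of the fixed fields [J (E k)], covered by [derive_pullv]. *)
Lemma derive_conj (J : endo M) X f x t : tensor_endo J -> T t ->
  is_derive t 1 (fun s => push (diffeo_inv (Phi s)) (J (push (Phi s) X)) f x)
    (push (diffeo_inv (Phi t)) (Lie_endo (Z t) J (push (Phi t) X)) f x).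
Proof.
move=> tJ Tt.
have GE s (V : Vect M) : push (diffeo_inv (Phi s)) (J (push (Phi s) V)) f x =
    \sum_k V (pull (Phi s) (x_ k)) x * pullv Phi s (J (E k)) f x.
  rewrite {1}(dual_expand dualE (push _ V)) (endo_sum tJ) push_invfE /=.
  rewrite vfield_sumE Cinf_sumE; apply: eq_bigr => k _.
  by rewrite (endoZ tJ) vfieldZE CinfME /= dfunK.
have -> : (fun s => push (diffeo_inv (Phi s)) (J (push (Phi s) X)) f x) = (fun s =>
  \sum_k X (pull (Phi s) (x_ k)) x * pullv Phi s (J (E k)) f x) by apply/funext => s.
have dd := is_derive_bigsum (index_enum 'I_N) xpredT (fun k =>
   is_derive_mul (@derive_push X (x_ k) x t Tt) (derive_pullv openT dualE isoP (J (E k)) f x Tt)).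
apply: is_derive_eq dd _; set X' := push (Phi t) X; set f' := pull (diffeo_inv (Phi t)) f.
have pE (V : Vect M) g : V (pull (Phi t) g) x = push (Phi t) V g (Phi t x).
  by rewrite pushfE /= dfunK.
rewrite push_invfE -/f'.
have -> : Lie_endo (Z t) J X' f' = \sum_k (X' (Z t (x_ k)) * J (E k) f' +
    X' (x_ k) * lie (Z t) (J (E k)) f').
  have JE (V : Vect M) g : J V g = \sum_k V (x_ k) * J (E k) g.
    rewrite {1}(dual_expand dualE V) (endo_sum tJ) vfield_sumE.
    by apply: eq_bigr => k _; rewrite (endoZ tJ).
  rewrite /Lie_endo !vfieldE !(JE X') (JE (lie _ _)) derivation_sum -!sumrB.
  apply: eq_bigr => k _; rewrite derivationM !lieE; ring.
rewrite [RHS]Cinf_sumE; apply: eq_bigr => k _.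
by rewrite (pE X (Z t (x_ k))) (pE X (x_ k)) !pullvE -/f'.
Qed.

End PullbackAlongIsotopy.

(** * Identities propagated along the deformation *)

Section Deformation.
Context {R : realType} {n : nat} {M : manifold R n} (T : set R).
Hypotheses (cptM : compact [set: M]) (oT : open T) (iT : is_interval T) (T0 : T 0).
Variables (N : nat) (x_ : 'I_N -> C^oo M) (E : 'I_N -> Vect M).
Hypothesis dualE : forall (X : Vect M) (f : C^oo M), X f = \sum_k X (x_ k) * E k f.
Variables (phi : R -> C^oo M) (I0 J0 : endo M) (F : R -> form2 M) (P : C^oo M -> Vect M).
Variable Xi : R -> diffeo M.
Hypotheses (sF0 : symplectic (F 0)) (cI0 : complex_structure I0) (cJ0 : complex_structure J0).
Hypothesis FI0 : forall X Y, F 0 (I0 X) Y = - F 0 X (J0 Y).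
Hypothesis HP : forall f, exists2 X, F 0 X = d0 f & P f = J0 X - I0 X.
Hypothesis fphi : smooth_family T (fun t => phi t).
Hypothesis isoXi : isotopy_of T (fun t => - P (phi t)) Xi.
Let I s := conj_endo (Xi s) I0.
Let B s := ddc (I s) (phi s).
Hypothesis FE : forall t X Y x, T t -> F t X Y x = F 0 X Y x +
  oriented_int 0 t (fun s => B s X Y x).
Hypothesis tam : forall t, T t -> tames (F t) J0.
Implicit Types (X Y V W : Vect M) (f g h a b : C^oo M).

Let Panti f g : P f g = - P g f. Proof. exact: (Poisson_anti sF0 FI0 HP). Qed.

(** Antisymmetry makes [P] a derivation in its first argument as well, so both arguments expand in
    the frame. *)
Lemma Poisson_expand f g : P f g = \sum_k \sum_l P (x_ k) (x_ l) * E k f * E l g.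
Proof.
have P1 f' g' : P f' g' = \sum_k P (x_ k) g' * E k f'.
  rewrite Panti dualE -sumrN; apply: eq_bigr => k _.
  by rewrite [in RHS]Panti mulNr.
rewrite P1; apply: eq_bigr => k _; rewrite dualE mulr_suml.
by apply: eq_bigr => l _; rewrite mulrAC.
Qed.

Let zero_derive (G : R -> R) : (forall s, T s -> is_derive s 1 G 0) -> G 0 = 0 ->
  forall t, T t -> G t = 0.
Proof. by move=> dG G0 t Tt; rewrite (is_derive0_cst iT dG Tt T0). Qed.

Let Xi0 : Xi 0 = id :> (M -> M). Proof. by apply/funext => z; have [] := isoXi. Qed.
Let pull0 f : pull (Xi 0) f = f. Proof. by apply/Cinf_eq => z /=; rewrite Xi0. Qed.
Let pullI0 f : pull (diffeo_inv (Xi 0)) f = f.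
Proof. by rewrite -[in LHS](pull0 f) pull_invK. Qed.
Let push00 V : push (Xi 0) V = V.
Proof. by apply: vfield_eqP => f; rewrite pushfE pullI0 pull0. Qed.
Let pushI0 V : push (diffeo_inv (Xi 0)) V = V.
Proof. by rewrite -[in LHS](push00 V) pushK_inv. Qed.

(** Invariance of the bivector under the flow: the function [G] is the pulled back bracket of [a]
    and [b] at x, and its derivative is the Jacobi expression for [phi s] and the two transported
    functions. *)
Lemma push_Poisson t a : T t -> push (Xi t) (P a) = P (pull (diffeo_inv (Xi t)) a).
Proof.
move=> Tt; suff H b : pull (Xi t) (P (pull (diffeo_inv (Xi t)) a) (pull (diffeo_inv (Xi t)) b)) = P a b.
  by apply: vfield_eqP => g; rewrite pushfE -H !pull_invK.
apply/Cinf_eq => x.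
pose G s := \sum_k \sum_l P (x_ k) (x_ l) (Xi s x) * pullv Xi s (E k) a x * pullv Xi s (E l) b x.
have GE s : pull (Xi s) (P (pull (diffeo_inv (Xi s)) a) (pull (diffeo_inv (Xi s)) b)) x = G s.
  rewrite Poisson_expand [LHS]Cinf_sumE; apply: eq_bigr => k _; rewrite Cinf_sumE.
  by apply: eq_bigr => l _.
have dG s : T s -> is_derive s 1 G 0.
  move=> Ts; have dd := is_derive_bigsum (index_enum 'I_N) xpredT (fun k =>
    is_derive_bigsum (index_enum 'I_N) xpredT (fun l =>
      is_derive_mul (is_derive_mul (iso_derive isoXi (P (x_ k) (x_ l)) x Ts)
         (derive_pullv oT dualE isoXi (E k) a x Ts))
        (derive_pullv oT dualE isoXi (E l) b x Ts))).
  apply: is_derive_eq dd _.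
  set f := pull (diffeo_inv (Xi s)) a; set g := pull (diffeo_inv (Xi s)) b.
  pose V := P (phi s).
  transitivity ((- V (P f g) + P (V f) g + P f (V g)) (Xi s x)); last first.
    by rewrite (Poisson_jacobi sF0 cI0 cJ0 FI0 HP (phi s)) -/V opprD addrAC subrK addNr.
  have E3 (W : Vect M) : - W (P f g) + P (W f) g + P f (W g) = \sum_k \sum_l (
    - W (P (x_ k) (x_ l)) * E k f * E l g + P (x_ k) (x_ l) * lie (- W) (E k) f * E l g
    + P (x_ k) (x_ l) * E k f * lie (- W) (E l) g).
    rewrite (Poisson_expand f) (Poisson_expand (W f)) (Poisson_expand f (W g)) derivation_sum -sumrN -!big_split; apply: eq_bigr => k _; rewrite [LHS]/=.
    rewrite derivation_sum -sumrN -!big_split; apply: eq_bigr => l _; rewrite [LHS]/=.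
    by rewrite !derivationM !vfieldE !derivationN; ring.
  rewrite E3 Cinf_sumE; apply: eq_bigr => k _; rewrite Cinf_sumE; apply: eq_bigr => l _.
  by rewrite !CinfDE !CinfME !pullvE -/f -/g CinfNE mulrDl.
rewrite GE (is_derive0_cst iT dG Tt T0) -GE.
by rewrite !pullI0 pull0.
Qed.

Let sI t : complex_structure (I t). Proof. exact: complex_conj. Qed.
Let tI t : tensor_endo (I t). Proof. by case: (sI t). Qed.
Let tJ0 : tensor_endo J0. Proof. by case: cJ0. Qed.
Let tB t : tensor2 (B t). Proof. exact/tensor2_d1/tensor_act1. Qed.
Let kB t X Y : B t X Y = - B t Y X. Proof. exact/d1_skew/tensor_act1. Qed.

Let Lie_Poisson_static f W h : Lie_endo (P f) I0 W h = ddc I0 f W (P h).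
Proof.
have [X Xh Ph] := HP h; have [tF0 kF0 _ _] := sF0.
rewrite -[LHS]/(d0 h _) -Xh kF0 (Lie_Poisson_I sF0 cI0 cJ0 FI0 HP) Ph.
have tB0 : tensor2 (ddc I0 f) by apply/tensor2_d1/tensor_act1; case: cI0.
by rewrite (form2Br tB0 (J0 X) (I0 X)); ring.
Qed.

(** At time 0 this is [Lie_Poisson_static]. Transport by [Xi t] carries it to time t, because [Xi t]
    conjugates [I0] into [I t] and preserves [P]. *)
Lemma Lie_endo_Ham t X h : T t -> Lie_endo (P (phi t)) (I t) X h = B t X (P h).
Proof.
move=> Tt; have [X' ->] := push_surj (Xi t) X.
have PE a : P a = push (Xi t) (P (pull (Xi t) a)) by rewrite push_Poisson// pull_invK.
rewrite (PE (phi t)) (PE h) Lie_endo_conj pushfE Lie_Poisson_static.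
by rewrite /B pull_ddc.
Qed.

(** Undoing the flow needs its inverse, known to be jointly continuous only; hence continuity of
    [u], although [v] is smooth. *)
Lemma advect_cont (u v : R -> C^oo M) t y : (forall s x, v s x = u s (Xi s x)) ->
  smooth_family T (fun t => v t) -> T t ->
  {for (t, y), continuous (fun p : R * M => u p.1 p.2)}.
Proof.
move=> vu fv Tt.
have -> : (fun p : R * M => u p.1 p.2) =
  (fun p : R * M => v p.1 p.2) \o (fun p => (p.1, dinv (Xi p.1) p.2)).
  by apply/funext => p; rewrite /= vu dinvK.
have C1 : (fun p : R * M => (p.1, dinv (Xi p.1) p.2)) @ (t, y) --> (t, dinv (Xi t) y).
  apply: (@cvg_to_pair _ _ _ (nbhs (t, y)) _ fst); first exact: cvg_fst.
  exact: (@iso_inv_cont _ _ _ T cptM _ _ isoXi t y Tt).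
exact: (cvg_comp _ _ C1 (fam_cont fv Tt)).
Qed.

Let fpull (u : R -> C^oo M) : smooth_family T (fun t => u t) ->
  smooth_family T (fun t => pull (Xi t) (u t)).
Proof.
by move=> fu; apply: (fam_comp oT (h := fun t x => Xi t x) (u := fun t => u t)) => // f;
   exact: (iso_fam isoXi).
Qed.

Let vpull X : vfam T (fun t => pullv Xi t X).
Proof. by move=> f; exact: (fam_pullv oT dualE isoXi). Qed.

Lemma ddc_cont W X Y t x : T t ->
  {for (t, x), continuous (fun p : R * M => W (B p.1 X Y) p.2)}.
Proof.
move=> Tt; pose b s := ddc I0 (pull (Xi s) (phi s)) (pullv Xi s X) (pullv Xi s Y).
have fb : smooth_family T (fun s => b s).
  by apply: (fam_ddc oT dualE) => //; [case: cI0|exact: fpull].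
apply: (@advect_cont (fun s => W (B s X Y)) (fun s => pullv Xi s W (b s))) => //.
  move=> s y; rewrite pullvE; congr (W _ _).
  by rewrite -pull_ddc !push_invK.
exact: (vfam_app oT dualE).
Qed.

Lemma ddc_cont0 X Y t x : T t -> {for (t, x), continuous (fun p : R * M => B p.1 X Y p.2)}.
Proof.
move=> Tt; pose b s := ddc I0 (pull (Xi s) (phi s)) (pullv Xi s X) (pullv Xi s Y).
have fb : smooth_family T (fun s => b s).
  by apply: (fam_ddc oT dualE) => //; [case: cI0|exact: fpull].
apply: (@advect_cont (fun s => B s X Y) b) => //.
move=> s y; have := pull_ddc (Xi s) I0 (phi s) (pullv Xi s X) (pullv Xi s Y).
by rewrite !push_invK /B => ->; rewrite /= dfunK.
Qed.

Lemma derive_form X Y x t : T t -> is_derive t 1 (fun s => F s X Y x) (B t X Y x).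
Proof.
move=> Tt.
have E1 : \forall s \near t, F 0 X Y x + oriented_int 0 s (fun r => B r X Y x) = F s X Y x.
  by apply: filterS (near_open oT Tt) => s Ts; rewrite (FE _ _ _ Ts).
apply: (near_eq_is_derive E1); rewrite -[B t X Y x]add0r.
apply: (is_deriveD (is_derive_cst (F 0 X Y x) t (1 : R))).
apply: (is_derive_oriented_int oT iT) => // s Ts.
have Cp : (fun r => (r, x)) @ s --> (s, x).
  by apply: (@cvg_to_pair _ _ _ (nbhs s) _ id); [exact: cvg_id|exact: cvg_cst].
have C : {for (s, x), continuous (fun p : R * M => B p.1 X Y p.2)} by exact: ddc_cont0.
exact: (cvg_comp _ _ Cp C).
Qed.

Lemma deformed_skew t X Y : T t -> F t X Y = - F t Y X.
Proof.
move=> Tt; apply/Cinf_eq => x; apply/eqP; rewrite -subr_eq0; apply/eqP.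
have [_ kF0 _ _] := sF0.
apply: (@zero_derive (fun t => F t X Y x - (- F t Y X) x)) Tt => [s Ts|]; last first.
  by rewrite kF0 subrr.
apply: is_derive_eq (is_deriveB (derive_form X Y x Ts) (is_deriveN (derive_form Y X x Ts))) _.
by rewrite kB CinfNE opprK addNr.
Qed.

Lemma deformed_tensor2 t : T t -> tensor2 (F t).
Proof.
have [tF0 kF0 _ _] := sF0.
suff L s X : T s -> tensor1 (F s X).
  move=> Tt; split=> [X|Y]; first exact: L.
  have /tensor1P[D Z] := L t Y Tt; apply/tensor1P; split=> [X X'|f X].
    by rewrite !(@deformed_skew t _ Y Tt) D opprD.
  by rewrite !(@deformed_skew t _ Y Tt) Z mulrN.
move=> Ts; apply/tensor1P; split=> [Y Y'|f Y]; apply/Cinf_eq => x;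
  apply/eqP; rewrite -subr_eq0; apply/eqP.
  apply: (@zero_derive (fun s => F s X (Y + Y') x - (F s X Y + F s X Y') x)) Ts => [r Tr|].
    apply: is_derive_eq (is_deriveB (derive_form X (Y + Y') x Tr)
      (is_deriveD (derive_form X Y x Tr) (derive_form X Y' x Tr))) _.
    by rewrite (form2Dr (tB r)) CinfDE subrr.
  by rewrite (form2Dr tF0) subrr.
apply: (@zero_derive (fun s => F s X (f *: Y) x - (f * F s X Y) x)) Ts => [r Tr|].
  apply: is_derive_eq (is_deriveB (derive_form X (f *: Y) x Tr)
     (is_derive_mulc (f x) (derive_form X Y x Tr))) _.
  by rewrite (form2Zr (tB r)) CinfME subrr.
by rewrite (form2Zr tF0) subrr.
Qed.

(** [d2] differentiates [F t] in space, so its time derivative requires exchanging d/dt with a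
    field. [derive_vfield_comm] allows this knowing just the joint continuity of [W (B s X Y)] from
    [ddc_cont]. The result is d(dd^c) = 0. *)
Lemma deformed_closed t X Y Z : T t -> d2 (F t) X Y Z = 0.
Proof.
move=> Tt; apply/Cinf_eq => x; have [_ _ _ dF0] := sF0.
have dX s (U V W : Vect M) : T s -> is_derive s 1 (fun s => U (F s V W) x) (U (B s V W) x).
  move=> Ts; apply: (@derive_vfield_comm _ _ _ T oT U (fun s => F s V W) (fun s => B s V W)) => //.
    by move=> r y Tr; exact: derive_form.
  by move=> U' r y Tr; exact: ddc_cont.
apply: (@zero_derive (fun t => d2 (F t) X Y Z x)) Tt => [s Ts|]; last by rewrite dF0.
have dd := is_deriveB (is_deriveD (is_deriveB (is_deriveD (is_deriveB
  (dX s X Y Z Ts) (dX s Y X Z Ts)) (dX s Z X Y Ts)) (derive_form (lie X Y) Z x Ts))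
  (derive_form (lie X Z) Y x Ts)) (derive_form (lie Y Z) X x Ts).
apply: is_derive_eq dd _.
by rewrite -[0]/((0 : C^oo M) x) -(d2_d1 X Y Z (tensor_act1 (tI s) (phi s))).
Qed.

Lemma deformed_symplectic t : T t -> symplectic (F t).
Proof.
move=> Tt; split; first exact: deformed_tensor2.
- by move=> X Y; exact: deformed_skew.
- by move=> X x; apply: tames_nondeg; exact: tam.
- by move=> X Y Z; exact: deformed_closed.
Qed.

Let Lie_endoN V W t : Lie_endo (- V) (I t) W = - Lie_endo V (I t) W.
Proof. by rewrite /Lie_endo !lieNl (endoN (tI t)) opprD. Qed.

(** Along the flow, [I s X h] becomes [v s], built from the fixed [I0] and pulled back data, hence
    smooth in s; [derive_advect] returns to the fixed point [y]. The generator is [- P (phi s)], so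
    the sign of the Lie derivative comes out positive. *)
Lemma derive_conj_endo X h y t : T t ->
  is_derive t 1 (fun s => I s X h y) (Lie_endo (P (phi t)) (I t) X h y).
Proof.
move=> Tt; have tI0 : tensor_endo I0 by case: cI0.
have IE (s : R) V f : I0 V f = \sum_k V (x_ k) * I0 (E k) f.
  rewrite {1}(dual_expand dualE V) (endo_sum tI0) vfield_sumE.
  by apply: eq_bigr => k _; rewrite (endoZ tI0).
pose v s : C^oo M := I0 (pullv Xi s X) (pull (Xi s) h).
pose v' s : C^oo M := I0 (pullv Xi s (lie (- P (phi s)) X)) (pull (Xi s) h) +
   I0 (pullv Xi s X) (pull (Xi s) ((- P (phi s)) h)).
have fv : smooth_family T (fun s => v s).
  apply: (vfam_app oT dualE (W := fun s => I0 (pullv Xi s X)) (u := fun s => pull (Xi s) h)).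
    exact: (vfam_endo oT dualE).
  exact: (iso_fam isoXi).
have dv s x : T s -> is_derive s 1 (fun s => v s x) (v' s x).
  move=> Ts.
  have vE r : v r x = \sum_k pullv Xi r X (x_ k) x * I0 (E k) (pull (Xi r) h) x.
    by rewrite /v (IE r) Cinf_sumE.
  have -> : (fun r => v r x) = (fun r => \sum_k pullv Xi r X (x_ k) x *
    I0 (E k) (pull (Xi r) h) x) by apply/funext.
  have dd := is_derive_bigsum (index_enum 'I_N) xpredT (fun k =>
    is_derive_mul (derive_pullv oT dualE isoXi X (x_ k) x Ts)
      (derive_push oT isoXi (I0 (E k)) h x Ts)).
  apply: is_derive_eq dd _.
  rewrite /v' (IE s (pullv Xi s X)) (IE s (pullv _ _ (lie _ _))) CinfDE !Cinf_sumE.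
  by rewrite big_split.
have := @derive_advect _ _ _ T oT cptM _ _ isoXi (fun s => I s X h) (fun s => v s)
  (fun s => v' s) t y _ fv dv Tt.
have IvE s V f : T s -> I0 (pullv Xi s V) (pull (Xi s) f) = pull (Xi s) (I s V f).
  by move=> Ts; rewrite /I /conj_endo pushfE pullK_inv.
move=> H; apply: is_derive_eq (H _) _ => [s x Ts|]; first by rewrite /v IvE.
have pE u : pull (Xi t) u (dinv (Xi t) y) = u y by rewrite /= dinvK.
rewrite /v' !IvE// CinfDE !pE -[P (phi t) in RHS]opprK Lie_endoN -/(I t).
rewrite /Lie_endo -CinfNE -!CinfDE; congr (Cfun _ y).
by rewrite !vfieldE; ring.
Qed.

(* I_t = J_0 - pi F_t along the deformation *)
Lemma deformed_Poisson t X h : T t -> F t X (P h) = I t X h - J0 X h.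
Proof.
move=> Tt; apply/Cinf_eq => x; apply/eqP; rewrite eq_sym -subr_eq0; apply/eqP.
apply: (@zero_derive (fun t => (I t X h - J0 X h) x - F t X (P h) x)) Tt => [s Ts|].
  apply: is_derive_eq (is_deriveB (is_deriveB (derive_conj_endo X h x Ts)
    (is_derive_cst (J0 X h x) s (1 : R))) (derive_form X (P h) x Ts)) _.
  by rewrite (Lie_endo_Ham X h Ts) subr0 subrr.
have [_ kF0 _ _] := sF0.
rewrite (kF0 X) (Poisson_form sF0 FI0 HP) /I /conj_endo push00 pushI0.
by rewrite -CinfNE -CinfDE -[RHS]/((0 : C^oo M) x); congr (Cfun _ x); ring.
Qed.

Lemma deformed_GK t X Y : T t -> F t (I t X) Y = - F t X (J0 Y).
Proof.
move=> Tt; apply/Cinf_eq => x; apply/eqP; rewrite -subr_eq0; apply/eqP.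
apply: (@zero_derive (fun t => F t (I t X) Y x - (- F t X (J0 Y)) x)) Tt => [s Ts|]; last first.
  by rewrite /I /conj_endo push00 pushI0 FI0 subrr.
have tF := deformed_tensor2 Ts.
pose L := Lie_endo (P (phi s)) (I s) X.
(* Both the form and its argument move with r. The frame splits them into scalar factors, so the
   product rule applies. *)
have E1 : \forall r \near s, \sum_k I r X (x_ k) x * F r (E k) Y x = F r (I r X) Y x.
  apply: filterS (near_open oT Ts) => r Tr.
  rewrite (tensor1_dual dualE (I r X) ((deformed_tensor2 Tr).2 Y)) Cinf_sumE.
  by apply: eq_bigr.
have d1 : is_derive s 1 (fun s => F s (I s X) Y x) ((F s L Y + B s (I s X) Y) x).
  apply: (near_eq_is_derive E1).
  have dd := is_derive_bigsum (index_enum 'I_N) xpredT (fun k =>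
    is_derive_mul (derive_conj_endo X (x_ k) x Ts) (derive_form (E k) Y x Ts)).
  apply: is_derive_eq dd _.
  rewrite (tensor1_dual dualE L (tF.2 Y)) (tensor1_dual dualE (I s X) ((tB s).2 Y)).
  by rewrite CinfDE !Cinf_sumE big_split.
apply: is_derive_eq (is_deriveB d1 (is_deriveN (derive_form X (J0 Y) x Ts))) _.
(* [deformed_Poisson] read as a vector identity: contracting [F s Y] with the bivector gives
   [J0 Y - I s Y]. Together with [Lie_endo_Ham] this evaluates [F s L Y] although the formula for
   [L] involves [P] only. *)
have PE : \sum_k F s Y (E k) *: P (x_ k) = J0 Y - I s Y.
  apply: vfield_eqP => h; rewrite vfield_sumE.
  transitivity (- F s Y (P h)); last by rewrite deformed_Poisson// !vfieldE opprB.
  rewrite (tensor1_dual dualE (P h) (tF.1 Y)) -sumrN; apply: eq_bigr => k _.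
  by rewrite vfieldZE Panti; ring.
have FL : F s L Y = B s X (I s Y) - B s X (J0 Y).
  rewrite (deformed_skew L Y Ts) (tensor1_dual dualE L (tF.1 Y)).
  transitivity (- B s X (\sum_k F s Y (E k) *: P (x_ k))).
    rewrite (tensor1_sum ((tB s).1 X)); congr (- _); apply: eq_bigr => k _.
    by rewrite (form2Zr (tB s)) -(Lie_endo_Ham X (x_ k) Ts) mulrC.
  by rewrite PE (form2Br (tB s) (J0 Y) (I s Y)) opprB.
have BI : B s (I s X) Y = - B s X (I s Y) by exact: ddc_type11.
rewrite opprK -CinfDE FL BI -[RHS]/((0 : C^oo M) x); congr (Cfun _ x).
by ring.
Qed.

End Deformation.

Theorem lemma4p1 (R : realType) (n : nat) (M : manifold R n)
    (T : set R) (phi : R -> C^oo M) (J0 : endo M) (F : R -> form2 M)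
    (Phi : R -> diffeo M) :
  compact [set: M] ->
  open T -> is_interval T -> T 0 ->
  Hamiltonian_flow_deformation T phi J0 F ->
  let I t := GK_I (F t) J0 in
  let Z t := - inv_form (F t) (act1 (I t) (d0 (phi t))) in
  isotopy_of T Z Phi ->
  let J t X := push (diffeo_inv (Phi t)) (J0 (push (Phi t) X)) in
  let psi t := pull (Phi t) (phi t) in
  let Y t := - inv_form (F 0) (d0 (psi t)) in
  forall t, T t ->
    pull_form2 (Phi t) (F t) = F 0 /\
    forall X f x,
      is_derive t 1 (fun s => J s X f x) (J t (Lie_endo (Y t) (J t) X) f x).
Proof.
move=> cptM oT iT T0 [[cJ0 sF0 tam0 intI0] fphi [Xi isoXi FE] tam] I Z isoP J psi Y t Tt.
have [N [x_ [E dualE]]] := dual_basis cptM.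
have [tF0 kF0 _ _] := sF0; have [tJ0 J2 _] := cJ0.
pose I0 := GK_I (F 0) J0; pose P f := GK_pi (F 0) J0 (d0 f).
have FI0 X Y' : F 0 (I0 X) Y' = - F 0 X (J0 Y') by exact: (GK_I_E dualE).
have cI0 : complex_structure I0.
  by split=> //; [exact: (tensor_GK_I dualE)|move=> X; exact: (GK_I2 dualE)].
have HP f : exists2 X, F 0 X = d0 f & P f = J0 X - I0 X by exact: (GK_pi_Ham dualE).
pose Is s := conj_endo (Xi s) I0.
have sF s : T s -> symplectic (F s).
  by move=> Ts; exact: (deformed_symplectic cptM oT iT T0 dualE sF0 cI0 fphi isoXi FE tam Ts).
have FI s X Y' : T s -> F s (Is s X) Y' = - F s X (J0 Y').
  by move=> Ts; exact: (deformed_GK cptM oT iT T0 dualE sF0 cI0 cJ0 FI0 HP fphi isoXi FE X Y' Ts).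
have cI s : complex_structure (Is s) by exact: complex_conj.
have tI s : tensor_endo (Is s) by case: (cI s).
have tF s (Ts : T s) : tensor2 (F s) by case: (sF s Ts).
(* The complex structure of the conclusion is defined from [F s], the one driving the deformation by
   conjugation with [Xi s]; [deformed_GK] and injectivity of [F s] identify them. *)
have IE s : T s -> I s = Is s.
  move=> Ts; have [tFs kFs _ _] := sF s Ts.
  by apply: (GK_I_uniq dualE tFs kFs (tam s Ts) tJ0) => X Y'; exact: FI.
have FZ s V : T s -> F s (Z s) V = - act1 (Is s) (d0 (phi s)) V.
  move=> Ts; have [tFs kFs _ _] := sF s Ts.
  rewrite /Z (form2Nl tFs) inv_formP ?IE//.
  by apply: (tames_surj dualE tFs kFs (tam s Ts) tJ0); exact: tensor_act1.
have pF s : T s -> pull_form2 (Phi s) (F s) = F 0.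
  apply: (pull_form2_const oT iT T0 dualE isoP (B := fun s => ddc (Is s) (phi s))) => //.
  - by move=> r _; exact/tensor2_d1/tensor_act1.
  - move=> X Y' x r Tr; exact: (derive_form cptM oT iT T0 dualE cI0 fphi isoXi FE X Y' x Tr).
  - move=> X Y' x r Tr; exact: (ddc_cont0 cptM oT dualE cI0 fphi isoXi Tr).
  - move=> X Y' r Tr; have [tFr kFr _ dFr] := sF r Tr.
    by rewrite Cartan// /ddc /d1 !FZ// !derivationN; ring.
split=> [|X f x]; first exact: pF.
apply: is_derive_eq (derive_conj oT dualE isoP X f x tJ0 Tt) _.
set V := push (Phi t) (Y t).
(* The equation that defines [Y t], with right-hand side minus the differential of [psi t], is
   pushed forward by [Phi t]: the form [F 0] becomes [F t] by [pF], and [psi t] becomes [phi t]. *)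
have FV W : F t V W = - W (phi t).
  have [W' ->] := push_surj (Phi t) W.
  have -> : F t V (push (Phi t) W') = pull (diffeo_inv (Phi t)) (F 0 (Y t) W').
    by rewrite -(pF t Tt) /pull_form2 pull_invK.
  rewrite /Y (form2Nl tF0) inv_formP; last first.
    by apply: (tames_surj dualE tF0 kF0 tam0 tJ0); exact: tensor_d0.
  by rewrite pushfE; exact/Cinf_eq.
(* Both sides pair with [W] under [F t] to [Is t W (phi t)]: on the left by moving [J0] across as
   [- Is t], on the right by [FZ]. Nondegeneracy concludes. *)
have JV : J0 V = Z t.
  apply: (form2_inj2 (sF t Tt)) => W.
  have GI X' Y' : F t (Is t X') Y' = - F t X' (J0 Y') by exact: FI.
  by rewrite FZ// (GK_FJ (sF t Tt) GI) FV act1E !opprK.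
rewrite -JV Lie_endo_complex// /J; congr (push _ (J0 _) f x).
by rewrite /Lie_endo pushD pushN !push_lie !push_invK.
Qed.
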